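(* Let $d,k\ge1$ be integers, $T>0$, $H:\mathbb{R}^d\times\mathbb{R}^d\times\mathbb{R}^k\to\mathbb{R}$, $G:\mathbb{R}^d\times\mathcal{P}\to\mathbb{R}$, $m_0\in\mathcal{P}$, $\Phi:[0,T]\times\mathbb{R}^d\times\mathbb{R}^d\to\mathbb{R}^k$, and let $$q>1,\qquad r\ge q,\qquad \gamma:=\frac{r}{q-1}\ge q',\qquad q':=\frac{q}{q-1}.$$ Assume: (0) there are $A\in C([0,T]\times\mathbb{R}^k,\mathbb{R}^{k\times k})$ and $B\in C([0,T]\times\mathbb{R}^k,\mathbb{R}^k)$ such that, for all $(t,x,p,\phi)\in[0,T]\times\mathbb{R}^d\times\mathbb{R}^d\times\mathbb{R}^k$, $\partial_t\Phi(t,x,p)-D_pH(x,p,\phi)\cdot D_x\Phi(t,x,p)+D_xH(x,p,\phi)\cdot D_p\Phi(t,x,p)+A(t,\phi)\Phi(t,x,p)+B(t,\phi)=0$; (1) for some $C>0$ and all $(t,y,p)$: $|\Phi(t,y,p)|\le C(1+|p|^r)$, $|D_p\Phi(t,y,p)|\le C(1+|p|^{r-1})$, $|D_x\Phi(t,y,p)|\le C(1+|p|^{r-q+1})$; (2) $m_0\in\mathcal{P}_\lambda$ for some $\lambda>\gamma$; (3) $H\in C^{1,1}(\mathbb{R}^d\times\mathbb{R}^d\times\mathbb{R}^k)$ is convex in the gradient variable $p$ and, for some $C>0$ and all $(x,p,\phi)$: $|H(x,p,\phi)|+|D_xH(x,p,\phi)|\le C(1+|p|^q)$, $|D_pH(x,p,\phi)|\le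 C(1+|p|^{q-1})$, $D^2_{xx}H(x,p,\phi)\le0$, and $|D^2_{px}H(x,p,\phi)|\le C$; (4) for all $m\in\mathcal{P}_\gamma$, $G(\cdot,m)\in C^{1,1}(\mathbb{R}^d)$ is convex and, for some $C>0$ and all $x\in\mathbb{R}^d$: $|G(x,m)|\le C(1+|x|^{q'})$, $|D_xG(x,m)|\le C(1+|x|^{q'-1})$, $|D^2_xG(x,m)|\le C(1+|x|)^{q'-2}$; (5) there are a modulus $\omega:[0,\infty)\to[0,\infty)$ and $C>0$ such that, for all $m_1,m_2\in\mathcal{P}_\gamma$ and $x\in\mathbb{R}^d$, $|G(x,m_1)-G(x,m_2)|+|D_xG(x,m_1)-D_xG(x,m_2)|\le C(1+|x|^{q'})\,\omega(d_\gamma(m_1,m_2))$; (6) $\sup_{t\in[0,T]}\big(\|A(t,\cdot)\|_{C^{0,1}(\mathbb{R}^k)}+\|B(t,\cdot)\|_{C^{0,1}(\mathbb{R}^k)}\big)<\infty$. Let $f(t,\phi):=A(t,\phi)\phi+B(t,\phi)$ and $g(m):=\int_{\mathbb{R}^d}\Phi(T,y,D_yG(y,m))\,m(dy)$. Then there exists a classical solution $(u,m,\phi)$ of $$\begin{cases}-\frac{\partial u}{\partial t}+H(x,Du,\phi)=0\ \text{ in }\mathbb{R}^d\times[0,T],& u(T,\cdot)=G(\cdot,m(T,\cdot)),\\ \frac{\partial m}{\partial t}-\operatorname{div}[D_pH(x,Du,\phi)m]=0\ \text{ in }\mathbb{R}^d\times[0,T],& m(0,\cdot)=m_0,\\ 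-\dot\phi(t)=f(t,\phi(t)),&\phi(T)=g(m(T,\cdot)).\end{cases}$$
   Context: $\mathcal{P}=\mathcal{P}(\mathbb{R}^d)$ is the set of Borel probability measures on $\mathbb{R}^d$; for $s\ge1$, $\mathcal{P}_s$ is the subset of those with finite $s$-th moment, equipped with the $s$-Wasserstein distance $d_s$. The arguments of $H$ are $(x,p,\phi)$ with $x$ the state, $p$ the gradient variable and $\phi\in\mathbb{R}^k$. The unknowns are $u:[0,T]\times\mathbb{R}^d\to\mathbb{R}$, $m:[0,T]\to\mathcal{P}$ and $\phi:[0,T]\to\mathbb{R}^k$. Inequalities on second derivatives of $C^{1,1}$ functions are understood almost everywhere. A modulus is a continuous nondecreasing function $\omega$ with $\omega(0)=0$. ''Classical solution'' means that $u$ and $\phi$ satisfy their equations classically, while $m$ is a continuous measure-valued solution of the continuity equation, i.e. for every compactly supported $\rho\in C^1([0,T]\times\mathbb{R}^d)$ and $t\in[0,T]$, with $b=D_pH(x,Du,\phi)$, $\int\rho(t,x)m_t(dx)=\int\rho(0,x)m_0(dx)+\int_0^t\int[\partial_t\rho(s,x)-b(s,x)\cdot D_x\rho(s,x)]\,m_s(dx)\,ds$.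
   Formalization: In (4) the constant C is taken independent of the measure m; if C may depend on m the claim fails, e.g. d=1, H=p²/2, G(x,m)=-c(1+∫|y|m(dy))x with cT≥1, m_0=δ_0, Φ=0, A=B=0. *)

(* Defs.v *)
From HB Require Import structures.
From mathcomp Require Import all_boot all_order all_algebra.
From mathcomp Require Import all_classical all_reals all_analysis.

Set Implicit Arguments.
Unset Strict Implicit.
Unset Printing Implicit Defensive.

Import Order.TTheory GRing.Theory Num.Theory.
Import numFieldNormedType.Exports.

Local Open Scope classical_set_scope.
Local Open Scope ring_scope.

(* R^d is 'rV[R]_d with its Borel sigma-algebra. *)
HB.instance Definition _ (R : realType) (m n : nat) :=
  @isMeasurable.Build (sigma_display (@open 'M[R]_(m, n))) 'M[R]_(m, n)
    <<s @open 'M[R]_(m, n) >> (@sigma_algebra0 _ setT _) (@sigma_algebraC _ _)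
    (@sigma_algebra_bigcup _ setT _).

(* The library norm on matrices is the sup norm; enorm is the Euclidean norm
   on row vectors and the Frobenius norm on matrices. *)
Definition enorm (R : realType) (m n : nat) (A : 'M[R]_(m, n)) : R :=
  Num.sqrt (\sum_i \sum_j A i j ^+ 2).

Definition dot (R : realType) (d : nat) (v w : 'rV[R]_d) : R :=
  \sum_i v 0 i * w 0 i.

Definition grad (R : realType) (d : nat) (f : 'rV[R]_d -> R) (x : 'rV[R]_d) :
    'rV[R]_d :=
  \row_i 'D_(delta_mx 0 i) f x.

(* Derivative in time of a function on [0, T], one-sided at both ends. *)
Definition time_slope (R : realType) (V : normedModType R) (f : R -> V)
    (t s : R) : V :=
  (s - t)^-1 *: (f s - f t).

Definition time_derivable (R : realType) (V : normedModType R) (T : R)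
    (f : R -> V) (t : R) : Prop :=
  cvg (time_slope f t s @[s --> within `[0, T] t^']).

Definition time_derive (R : realType) (V : normedModType R) (T : R)
    (f : R -> V) (t : R) : V :=
  lim (time_slope f t s @[s --> within `[0, T] t^']).

Definition slab (R : realType) (V : Type) (T : R) : set (R * V) :=
  `[0, T] `*` setT.

Definition C1_slab (R : realType) (d : nat) (T : R)
    (v : R -> 'rV[R]_d -> R) : Prop :=
  [/\ forall (t : R) x, t \in `[0, T] -> time_derivable T (fun s => v s x) t,
      forall (t : R) x, t \in `[0, T] -> differentiable (v t) x,
      {within slab T, continuous
        (fun z : R * 'rV[R]_d => time_derive T (fun s => v s z.2) z.1)} &
      {within slab T, continuous
        (fun z : R * 'rV[R]_d => grad (v z.1) z.2)}].

Definition compactly_supported (R : realType) (d : nat) (T : R)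
    (v : R -> 'rV[R]_d -> R) : Prop :=
  exists M : R, forall (t : R) x, t \in `[0, T] -> M < enorm x -> v t x = 0.

(* C^{1,1} is understood locally: functions of superquadratic growth, such as
   those allowed by |D^2 G(x)| <= C (1 + |x|)^(q' - 2) with q' > 2, need have no
   globally Lipschitz gradient. *)
Definition C11 (R : realType) (V : normedModType R) (f : V -> R) : Prop :=
  (forall z, differentiable f z) /\
  forall v z : V, exists2 U, nbhs z U & [lipschitz 'D_v f w | w in U].

(* Lebesgue null sets of R^n, as the sets with countable covers by closed boxes
   of arbitrarily small total volume. *)
Definition lebesgue_null (R : realType) (n : nat) (N : set 'rV[R]_n) : Prop :=
  forall e : R, 0 < e -> exists a b : nat -> 'rV[R]_n,
    [/\ forall i j, a i 0 j <= b i 0 j,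
        N `<=` \bigcup_i [set x | forall j, a i 0 j <= x 0 j <= b i 0 j] &
        (\sum_(0 <= i <oo) (\prod_j (b i 0 j - a i 0 j))%:E <= e%:E)%E].

Definition lebesgue_ae (R : realType) (n : nat) (P : 'rV[R]_n -> Prop) : Prop :=
  lebesgue_null [set x | ~ P x].

Definition lebesgue_ae3 (R : realType) (d k : nat)
    (P : 'rV[R]_d -> 'rV[R]_d -> 'rV[R]_k -> Prop) : Prop :=
  lebesgue_ae (fun z : 'rV[R]_(d + d + k) =>
    P (lsubmx (lsubmx z)) (rsubmx (lsubmx z)) (rsubmx z)).

Definition finite_moment (R : realType) (d : nat) (s : R)
    (m : probability 'rV[R]_d R) : Prop :=
  (\int[m]_x (enorm x `^ s)%:E < +oo)%E.

Definition coupling (R : realType) (d : nat) (m1 m2 : probability 'rV[R]_d R)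
    (P : probability ('rV[R]_d * 'rV[R]_d)%type R) : Prop :=
  forall A : set 'rV[R]_d, measurable A ->
    P (A `*` setT) = m1 A /\ P (setT `*` A) = m2 A.

(* The infimum is finite when m1 and m2 have finite s-th moments. *)
Definition wasserstein (R : realType) (d : nat) (s : R)
    (m1 m2 : probability 'rV[R]_d R) : R :=
  fine (ereal_inf [set (\int[P]_z (enorm (z.1 - z.2) `^ s)%:E)%E
                  | P in coupling m1 m2]) `^ s^-1.

Definition modulus (R : realType) (w : R -> R) : Prop :=
  [/\ {within `[0, +oo[, continuous w},
      {in `[0, +oo[ &, {homo w : a b / a <= b}} & w 0 = 0].

Definition C01_norm (R : realType) (k m n : nat)
    (F : 'rV[R]_k -> 'M[R]_(m, n)) : \bar R :=
  (ereal_sup [set (enorm (F x))%:E | x in setT] +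
   ereal_sup [set (enorm (F z.1 - F z.2) / enorm (z.1 - z.2))%:E
             | z in [set z : 'rV[R]_k * 'rV[R]_k | z.1 != z.2]])%E.

Section partial_derivatives.
Variables (R : realType) (d k : nat).
Variable H : 'rV[R]_d -> 'rV[R]_d -> 'rV[R]_k -> R.
Variable Phi : R -> 'rV[R]_d -> 'rV[R]_d -> 'rV[R]_k.
Implicit Types (x p : 'rV[R]_d) (phi : 'rV[R]_k).

Definition DxH x p phi : 'rV[R]_d := grad (fun y => H y p phi) x.
Definition DpH x p phi : 'rV[R]_d := grad (fun p' => H x p' phi) p.
Definition DxxH x p phi : 'M[R]_d := 'J (fun y => DxH y p phi) x.
Definition DpxH x p phi : 'M[R]_d := 'J (fun y => DpH y p phi) x.

(* Jacobians act on the right of row vectors: v *m DxPhi t x p is the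
   derivative of Phi t ^~ p at x in the direction v. *)
Definition DxPhi t x p : 'M[R]_(d, k) := 'J (fun y => Phi t y p) x.
Definition DpPhi t x p : 'M[R]_(d, k) := 'J (Phi t x) p.

Definition partially_differentiable (T : R) : Prop :=
  forall (t : R) x p, t \in `[0, T] ->
    [/\ time_derivable T (fun s => Phi s x p) t,
        differentiable (fun y => Phi t y p) x &
        differentiable (Phi t x) p].

End partial_derivatives.

Section terminal_coupling.
Variables (R : realType) (d k : nat).
Variable G : 'rV[R]_d -> probability 'rV[R]_d R -> R.

Definition DG x m : 'rV[R]_d := grad (fun y => G y m) x.
Definition DxxG x m : 'M[R]_d := 'J (fun y => DG y m) x.

Definition terminal_phi (T : R) (Phi : R -> 'rV[R]_d -> 'rV[R]_d -> 'rV[R]_k)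
    (m : probability 'rV[R]_d R) : 'rV[R]_k :=
  \row_i \int[m]_y Phi T y (DG y m) 0 i.

End terminal_coupling.

(* The product A(t, phi) phi of a matrix and a column vector, in row form. *)
Definition drift (R : realType) (k : nat) (A : R -> 'rV[R]_k -> 'M[R]_k)
    (B : R -> 'rV[R]_k -> 'rV[R]_k) (t : R) (phi : 'rV[R]_k) : 'rV[R]_k :=
  phi *m (A t phi)^T + B t phi.

Section classical_solutions.
Variables (R : realType) (d k : nat) (T : R).
Variable H : 'rV[R]_d -> 'rV[R]_d -> 'rV[R]_k -> R.
Variables (u : R -> 'rV[R]_d -> R) (m : R -> probability 'rV[R]_d R)
  (phi : R -> 'rV[R]_k).

Definition hj_solution (uT : 'rV[R]_d -> R) : Prop :=
  [/\ C1_slab T u,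
      forall (t : R) x, t \in `[0, T] ->
        - time_derive T (fun s => u s x) t + H x (grad (u t) x) (phi t) = 0 &
      forall x, u T x = uT x].

Definition wasserstein_continuous (s : R) : Prop :=
  (forall t : R, t \in `[0, T] -> finite_moment s (m t)) /\
  forall t : R, t \in `[0, T] ->
    wasserstein s (m r) (m t) @[r --> within `[0, T] (nbhs t)] --> 0.

Definition continuity_solution (m0 : probability 'rV[R]_d R) : Prop :=
  forall rho : R -> 'rV[R]_d -> R, C1_slab T rho -> compactly_supported T rho ->
    forall t : R, t \in `[0, T] ->
      \int[m t]_x rho t x = \int[m0]_x rho 0 x +
        \int[lebesgue_measure]_(s in `[0, t]) \int[m s]_x
          (time_derive T (fun s' => rho s' x) s
           - dot (DpH H x (grad (u s) x) (phi s)) (grad (rho s) x)).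

Definition ode_solution (f : R -> 'rV[R]_k -> 'rV[R]_k) (phiT : 'rV[R]_k) :
    Prop :=
  (forall t : R, t \in `[0, T] ->
    time_derivable T phi t /\ - time_derive T phi t = f t (phi t)) /\
  phi T = phiT.

End classical_solutions.

(* Main.v *)
(** H is bounded and, by the sign of its Hessian in x, concave in x for fixed
    (p, phi); hence it does not depend on x, and the momentum Du is constant along
    characteristics.  For a given path phi and a given final measure m_T, put
    S_t(p) = int_t^T H(p, phi(s)) ds.  Convexity of G(., m_T) and of H in p gives
    the classical solution by Hopf's formula
      u(t, x) = max_p (x . p - G^*(p) - S_t(p)),
    parametrised without conjugates by the foot y of the characteristic through
    (t, x), the solution of y + D S_t(D G(y)) = x, with Du(t, x) = D G(y).
    The continuity equation is solved by pushing m_0 along the characteristics.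

    What remains is the coupling: m_T is the image of m_0 under the map
    x |-> foot of the characteristic through (0, x), where phi solves the ODE
    backward from g(m_T).  Brouwer's theorem (from a cubical Sperner lemma) gives a
    fixed point once the initial positions are rounded to finitely many nodes.
    The limit in the rounding uses only pointwise limits of D G(., m_n), taken along
    an ultrafilter; they are locally uniform because the a.e. bound on D^2 G makes
    these gradients locally equi-Lipschitz.  Feet grow at most linearly, so the
    moments of m_0 dominate all integrals and d_gamma-convergence follows by
    dominated convergence. *)

Require Import Defs.
From HB Require Import structures.
From mathcomp Require Import all_boot all_order all_algebra.
From mathcomp Require Import all_classical all_reals all_analysis.
From mathcomp Require Import measurable_realfun ring lra.

Set Implicit Arguments.
Unset Strict Implicit.
Unset Printing Implicit Defensive.

Import Order.TTheory GRing.Theory Num.Theory.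
Import numFieldNormedType.Exports.

Local Open Scope ring_scope.

(** * Brouwer's fixed point theorem *)

(** Neither G(., m) nor H in p need be strictly convex, so feet of characteristics are unique only
    through monotonicity, and limits are found by compactness and uniqueness, not by contraction.
    Compactness of measures is never invoked: the final law enters the characteristics only through
    the function [DG] and the vector [terminal_phi]. One passes to the limit in these two, builds
    the limiting foot map from them, takes m to be its law, and only then recognises the limits as
    the values at m, by the modulus of continuity of G. A subsequence is extracted from the
    ultrafilter because dominated convergence is about sequences. The drift A(t, phi) phi + B is
    only locally Lipschitz in phi, but of linear growth: it is clipped at a level that the solution
    cannot exceed, read off from a bound on the terminal value uniform over all candidate laws.
    Almost everywhere bounds on Hessians reach every segment through a nearby parallel one that
    meets little of a small cover of the exceptional set. *)

Section cubical_sperner.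
Variable n : nat.
Local Notation vec := {ffun 'I_n -> nat}.
Local Notation F2 := 'F_2.

Lemma addF2K (x : F2) : x + x = 0.
Proof. by apply: addrr_pchar2; apply: pchar_Fp. Qed.

Definition step (b : vec) (j : 'I_n) : vec := [ffun i => (b i + (i == j))%N].

Lemma stepC b i j : step (step b i) j = step (step b j) i.
Proof. by apply/ffunP => l; rewrite !ffunE addnAC. Qed.

(* The value on the cube b + [0,1]^J of the cup product, over F_2, of the
   coboundaries of the functions in the list: a discrete df_1 /\ ... /\ df_m. *)
Fixpoint cup (fs : seq (vec -> F2)) (b : vec) (J : {set 'I_n}) : F2 :=
  if fs is f :: fs' then
    \sum_(j in J) (f (step b j) + f b) * cup fs' (step b j) (J :\ j)
  else (J == finset.set0)%:R.

(** Off-diagonal terms come in equal pairs (i, j) and (j, i), which cancel in characteristic 2. *)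
Lemma sym_sum_F2 (J : {set 'I_n}) (A : 'I_n -> 'I_n -> F2) :
  (forall i j, A i j = A j i) -> \sum_(j in J) \sum_(i in J :\ j) A i j = 0.
Proof.
move=> Asym; rewrite pair_big_dep /=.
rewrite (bigID (fun p : 'I_n * 'I_n => (p.1 < p.2)%N)) /=.
rewrite [X in _ + X](reindex_inj (h := fun p : 'I_n * 'I_n => (p.2, p.1))) /=; last first.
  by move=> [a b] [c e] /= [-> ->].
rewrite -[RHS](addF2K (\sum_(p | [&& p.1 \in J, p.2 \in J :\ p.1 & (p.1 < p.2)%N]) A p.2 p.1)).
congr (_ + _).
  by apply: eq_bigl => -[a b] /=; rewrite andbA.
apply: eq_big => [[a b]|[a b] _] /=; last exact: Asym.
rewrite !inE -leqNgt leq_eqVlt.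
case: (altP (a =P b)) => [->|ab]; first by rewrite ltnn eqxx !andbF.
have -> : (nat_of_ord a == nat_of_ord b) = false by apply/negbTE.
by rewrite eq_sym ab /=; do !case: (_ \in _) => //=.
Qed.

(* The coboundary of the cup product vanishes. *)
Lemma cup_closed fs (b : vec) (J : {set 'I_n}) : #|J| = (size fs).+1 ->
  \sum_(j in J) (cup fs (step b j) (J :\ j) + cup fs b (J :\ j)) = 0.
Proof.
elim: fs b J => [|f fs IH] b J cJ /=.
  rewrite big1 // => j _; exact: addF2K.
(* The identity d(df /\ w) = 0: expanding leaves the symmetric sum of [A], coboundaries of the
   shorter product, zero by induction, and one more symmetric sum. *)
pose A i j := f (step (step b j) i) * cup fs (step (step b j) i) (J :\ j :\ i).
have DC i j : J :\ j :\ i = J :\ i :\ j.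
  by apply/setP => l; rewrite !inE; do 2 case: (l == _).
have -> : \sum_(j in J) (\sum_(i in J :\ j)
     (f (step (step b j) i) + f (step b j)) * cup fs (step (step b j) i) (J :\ j :\ i) +
    \sum_(i in J :\ j) (f (step b i) + f b) * cup fs (step b i) (J :\ j :\ i))
  = \sum_(j in J) \sum_(i in J :\ j) A i j
  + (\sum_(j in J) f (step b j) * \sum_(i in J :\ j)
        (cup fs (step (step b j) i) (J :\ j :\ i) + cup fs (step b j) (J :\ j :\ i))
  + f b * \sum_(j in J) \sum_(i in J :\ j)
       ((cup fs (step b i) (J :\ j :\ i) + cup fs b (J :\ j :\ i)) + cup fs b (J :\ j :\ i))).
  have swap : \sum_(j in J) \sum_(i in J :\ j) f (step b i) * cup fs (step b i) (J :\ j :\ i)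
     = \sum_(j in J) \sum_(i in J :\ j) f (step b j) * cup fs (step b j) (J :\ j :\ i).
    rewrite (exchange_big_dep (mem J)) /=; last by move=> i j _; rewrite !inE => /andP[].
    apply: eq_bigr => j jJ; apply: eq_big => [i|i _]; last by rewrite DC.
    by rewrite !inE jJ eq_sym andbC andbT.
  rewrite mulr_sumr -!big_split /=.
  under eq_bigr => j _ do rewrite -big_split /=.
  under [in RHS]eq_bigr => j _ do rewrite !mulr_sumr -!big_split /=.
  apply/eqP; rewrite -subr_eq0 -sumrB /=.
  under eq_bigr => j _ do rewrite -sumrB /=.
  apply/eqP.
  transitivity (\sum_(j in J) \sum_(i in J :\ j) (f (step b i) * cup fs (step b i) (J :\ j :\ i) -
      f (step b j) * cup fs (step b j) (J :\ j :\ i))).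
    apply: eq_bigr => j _; apply: eq_bigr => i _; rewrite /A.
    by rewrite -[cup fs (step b i) _ + _ + _]addrA addF2K addr0; ring.
  under eq_bigr => j _ do rewrite sumrB.
  by rewrite sumrB swap subrr.
have Asym i j : A i j = A j i by rewrite /A stepC DC.
rewrite (sym_sum_F2 _ Asym) add0r.
have cJ' j : j \in J -> #|J :\ j| = (size fs).+1.
  by move=> jJ; move: cJ; rewrite (cardsD1 j) jJ add1n => -[].
rewrite big1 ?add0r; last by move=> j jJ; rewrite IH ?mulr0 // cJ'.
have -> : \sum_(j in J) \sum_(i in J :\ j)
     (cup fs (step b i) (J :\ j :\ i) + cup fs b (J :\ j :\ i) + cup fs b (J :\ j :\ i))
    = \sum_(j in J) \sum_(i in J :\ j) cup fs b (J :\ j :\ i).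
  by apply: eq_bigr => j jJ; rewrite big_split /= IH ?add0r // cJ'.
by rewrite sym_sum_F2 ?mulr0 // => i j; rewrite DC.
Qed.

(** Since j is not a direction of the cube, the cube stays in the face through b orthogonal to j;
    there the factor f is constant, and its coboundary vanishes wherever it stands in the list. *)
Lemma cup_face fs f (b : vec) (J : {set 'I_n}) (j : 'I_n) :
  List.In f fs -> j \notin J -> (forall b' : vec, b' j = b j -> f b' = f b) ->
  cup fs b J = 0.
Proof.
elim: fs b J => [//|g fs IH] b J /= fin jJ fc.
have stepj i : i \in J -> step b i j = b j.
  move=> iJ; rewrite ffunE; case: eqP => [e|_]; last by rewrite addn0.
  by move: jJ; rewrite e iJ.
case: fin => [gf|fin].
  by rewrite big1 // => i iJ; rewrite gf (fc (step b i)) ?stepj // addF2K mul0r.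
rewrite big1 // => i iJ; rewrite (IH (step b i)) ?mulr0 //.
  by rewrite !inE (negbTE jJ) andbF.
by move=> b'; rewrite stepj // => b'j; rewrite (fc (step b i)) ?stepj // fc.
Qed.

(** A nonzero product has a nonzero summand, in which each factor is the increment of its f along an
    edge of the cube. *)
Lemma cup_neq0 fs (b : vec) (J : {set 'I_n}) : cup fs b J != 0 ->
  forall f, List.In f fs -> exists b1 b2 : vec,
    [/\ forall i, (b i <= b1 i <= b i + (i \in J))%N,
        forall i, (b i <= b2 i <= b i + (i \in J))%N & f b1 != f b2].
Proof.
elim: fs b J => [//|g fs IH] b J /= nz f fin.
have [j jJ] : exists2 j, j \in J & (g (step b j) + g b) * cup fs (step b j) (J :\ j) != 0.
  apply: contrapT => h; move/eqP: nz; apply; apply: big1 => j jJ.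
  by apply/eqP; apply: contrapT => /negP hh; apply: h; exists j.
rewrite mulf_eq0 negb_or => /andP[gnz cnz].
have le1 : forall i, (b i <= step b j i <= b i + (i \in J))%N.
  by move=> i; rewrite ffunE leq_addr leq_add2l; case: eqP => // ->; rewrite jJ.
case: fin => [<-|fin].
  exists b, (step b j); split => // [i|]; first by rewrite leqnn leq_addr.
  by apply: contra gnz => /eqP ->; rewrite addF2K.
have [b1 [b2 [h1 h2 h]]] := IH _ _ cnz _ fin.
have aux i (c : nat) : (step b j i <= c <= step b j i + (i \in J :\ j))%N ->
  (b i <= c <= b i + (i \in J))%N.
  rewrite !inE ffunE; case: eqP => [->|_] /=; last by rewrite addn0.
  by rewrite jJ addn0 => /andP[h3 h4]; rewrite h4 andbT (leq_trans _ h3) ?leq_addr.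
by exists b1, b2; split => // i; apply: aux.
Qed.

Variables (N : nat) (l : 'I_n -> vec -> F2).
Hypothesis l0 : forall i (b : vec), b i = 0%N -> l i b = 0.
Hypothesis lN : forall i (b : vec), b i = N.+1 -> l i b = 1.

Let C (k : nat) (c : {ffun 'I_n -> 'I_N.+1}) := [forall i : 'I_n, (i < k)%N ==> (c i == ord0)].
Let v (k : nat) (c : {ffun 'I_n -> 'I_N.+1}) : vec :=
  [ffun i : 'I_n => if (i < k)%N then N.+1 else c i : nat].
Let J (k : nat) := [set i : 'I_n | (k <= i)%N].
Let fs (k : nat) := map l (drop k (enum 'I_n)).

Let upd (b : vec) (j : 'I_n) (a : nat) : vec := [ffun i => if i == j then a else b i].

(** Along a grid line in direction j each interior vertex occurs twice and cancels modulo 2. The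
    line is represented by its cell with c j = 0. *)
Lemma telescope_F2 (k : nat) (j : 'I_n) (g : vec -> F2) : (k <= j)%N ->
  \sum_(c | C k c) (g (step (v k c) j) + g (v k c)) =
  \sum_(c | C k c && (c j == ord0)) (g (upd (v k c) j N.+1) + g (v k c)).
Proof.
move=> kj.
pose z (c : {ffun 'I_n -> 'I_N.+1}) (a : 'I_N.+1) : {ffun 'I_n -> 'I_N.+1} :=
  [ffun i => if i == j then a else c i].
have jk : (j < k)%N = false by rewrite ltnNge kj.
rewrite (partition_big (fun c => z c ord0) (fun c => C k c && (c j == ord0))) /=; last first.
  move=> c /forallP Cc; apply/andP; split; last by rewrite ffunE eqxx.
  by apply/forallP => i; rewrite ffunE; case: (i =P j) => [->|_]; rewrite ?jk //; apply: Cc.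
apply: eq_bigr => c /andP[/forallP Cc /eqP cj].
rewrite (reindex_onto (z c) (fun c' => c' j)) /=; last first.
  move=> c' /andP[_ /eqP <-]; apply/ffunP => i; rewrite !ffunE.
  by case: eqP => [->|]//.
under eq_bigl => a.
  have -> : C k (z c a) && (z (z c a) ord0 == c) && (z c a j == a).
    apply/andP; split; last by rewrite ffunE eqxx.
    apply/andP; split.
      by apply/forallP => i; rewrite ffunE; case: (i =P j) => [->|_]; rewrite ?jk //; apply: Cc.
    apply/eqP/ffunP => i; rewrite !ffunE; case: eqP => [->|]//.
  over.
have vz a : v k (z c a) = upd (v k c) j a.
  by apply/ffunP => i; rewrite !ffunE; case: eqP => [->|]//; rewrite jk.
have sz a : step (v k (z c a)) j = upd (v k c) j a.+1.
  rewrite vz; apply/ffunP => i; rewrite !ffunE; case: (i =P j) => _; by rewrite ?addn0 ?addn1.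
under eq_bigr => a _ do rewrite sz vz.
have v0 : v k c = upd (v k c) j 0.
  by apply/ffunP => i; rewrite !ffunE; case: eqP => [->|]//; rewrite jk cj.
rewrite [in RHS]v0.
rewrite (_ : upd (upd _ _ _) _ _ = upd (v k c) j N.+1); last first.
  by apply/ffunP => i; rewrite !ffunE; case: eqP.
rewrite -(big_mkord predT (fun a => g (upd (v k c) j a.+1) + g (upd (v k c) j a))).
elim: N => [|M IH]; first by rewrite big_nat1.
by rewrite big_nat_recr //= IH addrACA addrC -[in LHS]addrA addrC [g _ + (_ + _)]addrA
  [X in X + _ + _](_ : _ = 0) ?add0r //; rewrite ?addF2K //.
Qed.

(* Stokes, one coordinate at a time: the sum over the face b_i = N + 1 for i < k
   does not depend on k, the other faces contributing 0. *)
Lemma cup_total (k : nat) : (k <= n)%N -> \sum_(c | C k c) cup (fs k) (v k c) (J k) = 1.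
Proof.
move=> kn; rewrite -(subKn kn); move: (n - k)%N (leq_subr k n) => m.
elim: m => [_|m IH mn].
  rewrite subn0 (big_pred1 [ffun => ord0]) => [|c].
    rewrite /fs drop_oversize ?size_enum_ord //=.
    by rewrite (_ : J n == _) //; apply/eqP/setP => i; rewrite !inE leqNgt ltn_ord.
  apply/forallP/eqP => [h|-> i]; last by rewrite ffunE eqxx implybT.
  by apply/ffunP => i; rewrite ffunE; have /implyP := h i; rewrite ltn_ord => /(_ isT)/eqP.
have {}IH := IH (ltnW mn).
set k' := (n - m.+1)%N.
have ek : (n - m)%N = k'.+1 by rewrite /k' subnSK.
rewrite ek in IH.
have kn' : (k' < n)%N by rewrite -ek leq_subr.
pose ko := Ordinal kn'.
have fsE : fs k' = l ko :: fs k'.+1.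
  by rewrite /fs (drop_nth ko) ?size_enum_ord // (_ : nth ko (enum 'I_n) k' = ko) //; apply: val_inj; rewrite /= nth_enum_ord.
rewrite fsE /=.
have cJ : #|J k'| = (size (fs k'.+1)).+1.
  rewrite /fs size_map size_drop size_enum_ord -subSn // subSS.
  rewrite cardsE -sum1_card.
  rewrite (eq_bigl (fun i : 'I_n => (k' <= i)%N)) //.
  rewrite -(big_mkord (fun i => k' <= i)%N (fun=> 1%N)).
  rewrite (@big_cat_nat _ _ _ k') //=; last exact: ltnW.
  rewrite big_nat_cond big_pred0 ?add0n; last first.
    by move=> i; apply/negP => /andP[/andP[_ h1] h2]; rewrite ltnNge h2 in h1.
  rewrite big_nat_cond (eq_bigl (fun i => (k' <= i < n)%N)); last by move=> i; case: (k' <= i)%N; rewrite ?andbT ?andbF.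
  by rewrite -big_nat sum_nat_const_nat muln1.
pose W j b := cup (fs k'.+1) b (J k' :\ j).
pose g j b := l ko b * W j b.
(* Discrete product rule: the shorter product w is closed, so df /\ w = d(f w), and the sum becomes
   one of increments, ready to telescope. *)
transitivity (\sum_(j in J k') \sum_(c | C k' c) (g j (step (v k' c) j) + g j (v k' c))).
  rewrite [RHS]exchange_big /=; apply: eq_bigr => c _.
  apply/eqP; rewrite -subr_eq0 -sumrB; apply/eqP.
  transitivity (\sum_(j in J k') l ko (v k' c) * (cup (fs k'.+1) (step (v k' c) j) (J k' :\ j) - cup (fs k'.+1) (v k' c) (J k' :\ j))).
    by apply: eq_bigr => j _; rewrite /g /W; ring.
  rewrite -mulr_sumr.
  under eq_bigr => j _.
    rewrite (_ : - cup _ (v k' c) _ = cup (fs k'.+1) (v k' c) (J k' :\ j)); last first.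
      by apply/eqP; rewrite eq_sym -subr_eq0 opprK addF2K.
    over.
  by rewrite cup_closed ?mulr0.
rewrite (bigD1 ko) /=; last by rewrite inE /=.
(* For j > k' the label [l j] is a factor of the remaining product and is constant on both faces
   orthogonal to j. *)
rewrite [X in _ + X]big1 ?addr0; last first.
  move=> j; rewrite inE => /andP[kj jne].
  have kj' : (k' < j)%N by rewrite ltn_neqAle kj andbT; apply: contra jne => /eqP h; apply/eqP/val_inj.
  rewrite telescope_F2 // big1 // => c /andP[_ /eqP cj].
  have inl : List.In (l j) (fs k'.+1).
    apply: List.in_map.
    have : j \in drop k'.+1 (enum 'I_n).
      have e : nth j (drop k'.+1 (enum 'I_n)) (j - k'.+1) = j.
        by rewrite nth_drop subnKC // nth_ord_enum.
      rewrite -[X in X \in _]e mem_nth //.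
      by rewrite size_drop size_enum_ord ltn_sub2r // (leq_ltn_trans kj').
    elim: (drop _ _) => //= a s IHs; rewrite inE => /orP[/eqP ->|/IHs]; [by left|by right].
  have z1 : g j (upd (v k' c) j N.+1) = 0.
    rewrite /g /W (cup_face (f := l j) (j := j)) ?mulr0 //; first by rewrite !inE eqxx.
    by move=> b'; rewrite ffunE eqxx => b'j; rewrite !lN // ffunE eqxx.
  have z2 : g j (v k' c) = 0.
    rewrite /g /W (cup_face (f := l j) (j := j)) ?mulr0 //; first by rewrite !inE eqxx.
    have vj : v k' c j = 0%N by rewrite ffunE ltnNge kj cj.
    by move=> b'; rewrite vj => b'j; rewrite !l0.
  by rewrite z1 z2 addr0.
rewrite telescope_F2 //= -IH; apply: eq_big => [c|c /andP[_ /eqP ck]].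
  apply/andP/forallP => [[/forallP h ck] i|h].
    apply/implyP; rewrite ltnS leq_eqVlt => /orP[/eqP e|ik]; last exact: (implyP (h i)).
    by rewrite (_ : i = ko) //; apply: val_inj.
  split; last by apply: (implyP (h ko)) => /=.
  by apply/forallP => i; apply/implyP => ik; apply: (implyP (h i)); apply: ltnW.
have -> : upd (v k' c) ko N.+1 = v k'.+1 c.
  apply/ffunP => i; rewrite !ffunE ltnS (leq_eqVlt i).
  by rewrite -val_eqE /=; case: eqP.
rewrite /g [l ko (v k' c)]l0 ?mul0r ?addr0; last by rewrite ffunE ltnn ck.
rewrite lN ?mul1r /W; last by rewrite ffunE ltnSn.
congr cup; apply/setP => i; rewrite !inE -val_eqE /= ltn_neqAle; congr (_ && _).
by rewrite eq_sym.
Qed.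

(** The products over all cubes add up to 1, so one of them is nonzero, and on its cube every label
    takes both values. *)
Lemma cubical_sperner : exists b : vec, (forall i, (b i <= N)%N) /\
  forall i, exists b1 b2 : vec, [/\ forall j, (b j <= b1 j <= (b j).+1)%N,
     forall j, (b j <= b2 j <= (b j).+1)%N & l i b1 != l i b2].
Proof.
have [c Cc nz] : exists2 c, C 0 c & cup (fs 0) (v 0 c) (J 0) != 0.
  apply: contrapT => h.
  have := cup_total (leq0n n); rewrite big1; first by move/esym/eqP; rewrite oner_eq0.
  by move=> c Cc; apply/eqP; apply: contrapT => /negP nz; apply: h; exists c.
exists (v 0 c); split => [i|i].
  by rewrite ffunE ltn0 -ltnS.
have inl : List.In (l i) (fs 0).
  apply: List.in_map; rewrite drop0.
  have : i \in enum 'I_n by rewrite mem_enum.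
  elim: (enum _) => //= a s IHs; rewrite inE => /orP[/eqP ->|/IHs]; [by left|by right].
have [b1 [b2 [h1 h2 h]]] := cup_neq0 nz inl.
exists b1, b2; split => // j; [have := h1 j|have := h2 j]; by rewrite inE leq0n addn1.
Qed.

End cubical_sperner.

Local Open Scope classical_set_scope.

Section brouwer.
Variables (R : realType) (n : nat).

Lemma rV_norm_le (x : 'rV[R]_n) (M : R) : 0 <= M ->
  (forall i, `|x 0 i| <= M) -> `|x| <= M.
Proof.
move=> M0 h; rewrite [leLHS]/Num.norm /= mx_normrE.
by apply: bigmax_le => // -[i j] _ /=; rewrite ord1.
Qed.

Lemma rV_coord_le (x : 'rV[R]_n) i : `|x 0 i| <= `|x|.
Proof.
rewrite [leRHS]/Num.norm /= mx_normrE.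
by rewrite (bigD1 (ord0, i)) //= le_max; apply/orP; left; rewrite (_ : ord0 = 0).
Qed.

Lemma rV_ball_compact (M : R) : compact [set x : 'rV[R]_n | `|x| <= M].
Proof.
apply: bounded_closed_compact.
  exists M; split; first exact: num_real.
  by move=> N MN x /= xM; rewrite (le_trans xM) // ltW.
rewrite (_ : [set x | _] = (fun x : 'rV[R]_n => `|x|) @^-1` [set y | y <= M]) //.
apply: preimage_closed; first by move=> x _; exact: norm_continuous.
exact: closed_le.
Qed.

Lemma cvg_coord (T : Type) (FF : set_system T) {FFF : Filter FF} (f : T -> 'rV[R]_n) (l : 'rV[R]_n) i :
  f t @[t --> FF] --> l -> f t 0 i @[t --> FF] --> l 0 i.
Proof.
move=> h; apply/cvgrPdist_lt => e e0; have /cvgrPdist_lt/(_ e e0) := h.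
apply: filterS => t; apply: le_lt_trans.
by have := rV_coord_le (l - f t) i; rewrite !mxE.
Qed.

Lemma cvg_rV (T : Type) (FF : set_system T) {FFF : Filter FF} (f : T -> 'rV[R]_n) (l : 'rV[R]_n) :
  (forall i, f t 0 i @[t --> FF] --> l 0 i) -> f t @[t --> FF] --> l.
Proof.
move=> h; apply/cvgrPdist_le => e e0.
have : \forall t \near FF, forall i : 'I_n, `|l 0 i - f t 0 i| <= e.
  apply: filter_forall => i; have /cvgrPdist_le := h i; exact.
apply: filterS => t ht; apply: rV_norm_le => [|i]; first exact: ltW.
by have := ht i; rewrite !mxE.
Qed.

(** Label i tells whether F fails to increase coordinate i at a grid point of mesh 2 M / (N + 1);
    the values forced on the boundary agree with this because |F| <= M. A cube where every label
    changes has, for each i, points where F - id has either sign in coordinate i; at a cluster point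
    of such cubes F - id vanishes. *)
Theorem brouwer (F : 'rV[R]_n -> 'rV[R]_n) (M : R) : 0 < M ->
  continuous F -> (forall x, `|F x| <= M) -> exists x, F x = x.
Proof.
move=> M0 cF FM.
pose pt N (b : {ffun 'I_n -> nat}) : 'rV[R]_n := \row_i (- M + 2 * M * (b i)%:R / N.+1%:R).
pose l N (i : 'I_n) (b : {ffun 'I_n -> nat}) : 'F_2 :=
  if b i == 0%N then 0 else if b i == N.+1 then 1 else if (F (pt N b) 0 i <= pt N b 0 i)%R then 1 else 0.
have FMi x i : - M <= F x 0 i <= M by rewrite -ler_norml (le_trans (rV_coord_le _ _)).
have approx N : exists x : 'rV[R]_n, `|x| <= M /\ forall i, exists y z : 'rV[R]_n,
   [/\ `|x - y| <= 2 * M / N.+1%:R, `|x - z| <= 2 * M / N.+1%:R, y 0 i <= F y 0 i & F z 0 i <= z 0 i].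
  have [|i b bN|b [bN hb]] := @cubical_sperner n N (l N).
  - by move=> i b b0; rewrite /l b0.
  - by rewrite /l bN eqxx.
  exists (pt N b); split.
    apply: rV_norm_le => [|i]; first exact: ltW.
    rewrite mxE ler_norml lerDl; apply/andP; split.
      by rewrite divr_ge0 ?mulr_ge0 // ltW.
    rewrite addrC lerBlDr ler_pdivrMr ?ltr0n //.
    rewrite (_ : M + M = 2 * M); last by ring.
    by rewrite ler_pM2l ?ler_nat ?mulr_gt0 // (leq_trans (bN i)).
  have dist (b' : {ffun 'I_n -> nat}) : (forall j, (b j <= b' j <= (b j).+1)%N) ->
      `|pt N b - pt N b'| <= 2 * M / N.+1%:R.
    move=> h; apply: rV_norm_le => [|j]; first by rewrite divr_ge0 ?mulr_ge0 // ltW.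
    rewrite !mxE (_ : _ - _ = 2 * M / N.+1%:R * ((b j)%:R - (b' j)%:R)); last by move: (N.+1%:R^-1) => w; ring.
    rewrite normrM ger0_norm ?divr_ge0 ?mulr_ge0 // ?(ltW M0) // ler_piMr ?divr_ge0 ?mulr_ge0 // ?(ltW M0) //.
    rewrite distrC ger0_norm ?subr_ge0 ?ler_nat; last by case/andP: (h j).
    by rewrite lerBlDr nat1r ler_nat; case/andP: (h j).
  have l_0 i b' : l N i b' = 0 -> pt N b' 0 i <= F (pt N b') 0 i.
    rewrite /l; case: eqP => [b0 _|_]; first by rewrite mxE b0 mulr0 mul0r addr0; case/andP: (FMi (pt N b') i).
    case: eqP => [_ /eqP|_]; first by rewrite oner_eq0.
    by case: leP => [_ /eqP|/ltW //]; rewrite oner_eq0.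
  have l_1 i b' : l N i b' = 1 -> F (pt N b') 0 i <= pt N b' 0 i.
    rewrite /l; case: eqP => [_ /eqP|_]; first by rewrite eq_sym oner_eq0.
    case: eqP => [b0 _|_].
      rewrite mxE b0 mulfK ?pnatr_eq0 // (_ : - M + 2 * M = M); last by ring.
      by case/andP: (FMi (pt N b') i).
    by case: leP => // _ /eqP; rewrite eq_sym oner_eq0.
  have F2 (a : 'F_2) : a = 0 \/ a = 1.
    by case: a => -[|[|//]] ha; [left|right]; apply: val_inj.
  move=> i; have [b1 [b2 [h1 h2 h]]] := hb i.
  case: (F2 (l N i b1)) (F2 (l N i b2)) => e1 [] e2; rewrite e1 e2 ?eqxx // in h.
    by exists (pt N b1), (pt N b2); split; [exact: dist|exact: dist|exact: l_0|exact: l_1].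
  by exists (pt N b2), (pt N b1); split; [exact: dist|exact: dist|exact: l_0|exact: l_1].
have [x xP] := choice approx.
have [p xp] : exists p : 'rV[R]_n, cluster (x @ \oo) p.
  have [|p [_ xp]] := @rV_ball_compact M (x @ \oo); last by exists p.
  by exists 0%N => //= N _; have [] := xP N.
exists p; apply/rowP => i.
have key (U : set 'rV[R]_n) : nbhs p U -> exists y z, [/\ U y, U z, y 0 i <= F y 0 i & F z 0 i <= z 0 i].
  move=> /nbhs_normP[e /= e0 eU].
  have e2 : 0 < e / 2 by rewrite divr_gt0.
  have h1 : (x @ \oo) [set y | exists N, y = x N /\ 2 * M / N.+1%:R < e / 2].
    have : \forall N \near \oo, 2 * M / N.+1%:R < e / 2.
      have : (fun N => 2 * M * (N.+1%:R)^-1) @ \oo --> 2 * M * 0.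
        by apply: cvgM; [exact: cvg_cst|exact: cvg_harmonic].
      by rewrite mulr0 => /cvgr_lt; apply.
    by apply: filterS => N hN /=; exists N.
  have h2 : nbhs p [set y | `|p - y| < e / 2] by have /cvgr_dist_lt := @cvg_id _ (nbhs p); apply.
  have [_ [[N [-> hN]] xNp]] := xp _ _ h1 h2.
  have [y [z [xy xz hy hz]]] := (xP N).2 i.
  exists y, z; split => //; apply: eU => /=.
    rewrite -(subrKA (x N)) [e]splitr (le_lt_trans (ler_normD _ _)) //.
    by rewrite ltrD // (le_lt_trans xy).
  rewrite -(subrKA (x N)) [e]splitr (le_lt_trans (ler_normD _ _)) //.
  by rewrite ltrD // (le_lt_trans xz).
have cFi : F y 0 i - y 0 i @[y --> p] --> F p 0 i - p 0 i.
  have FFp : Filter (nbhs p) by exact: nbhs_filter.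
  have c1 := @cvg_coord _ (nbhs p) FFp F (F p) i (cF p).
  have c2 := @cvg_coord _ (nbhs p) FFp id p i (@cvg_id _ (nbhs p)).
  exact: (cvgB c1 c2).
apply/eqP; rewrite -subr_eq0; apply/negP => /negP; rewrite neq_lt => /orP[] h.
  have [y [z [Uy _ hy _]]] := key _ (cvgr_lt _ cFi _ h).
  by move: Uy => /=; rewrite subr_lt0 ltNge hy.
have [y [z [_ Uz _ hz]]] := key _ (cvgr_gt _ cFi _ h).
by move: Uz => /=; rewrite subr_gt0 ltNge hz.
Qed.

End brouwer.

Local Open Scope ring_scope.

(** * From almost everywhere bounds on derivatives to global bounds *)

Section one_dim.
Variable R : realType.
Local Notation mu := (@lebesgue_measure R).

Lemma lebesgue_itvcc (a b : R) : a <= b -> mu `[a, b] = (b - a)%:E.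
Proof.
move=> ab; rewrite lebesgue_measure_itv /= lte_fin; case: ltP => // ba.
by rewrite (_ : b - a = 0) //; apply/eqP; rewrite subr_eq0 eq_le ab ba.
Qed.

(* One coordinate of a point avoiding most of a cover by boxes: by Fubini in the
   coordinate x, some x in [z, z + h] sees at most the average mass. *)
Lemma slice_bound (a b W : nat -> R) (E F z h : R) : 0 < h -> E < F * h ->
  (forall j, a j <= b j) -> (forall j, 0 <= W j) ->
  (\sum_(0 <= j <oo) (W j * (b j - a j))%:E <= E%:E)%E ->
  exists2 x, z <= x <= z + h &
    (\sum_(0 <= j <oo) (W j * (a j <= x <= b j)%R%:R)%:E <= F%:E)%E.
Proof.
move=> h0 EF ab W0 sE; apply: contrapT => nex.
pose D : set R := [set` `[z, z + h]].
have mD : measurable D by exact: measurable_itv.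
pose f j (x : measurableTypeR R) : \bar R := ((W j)%:E * (\1_(`[a j, b j] : set R) x)%:E)%E.
have fE j x : f j x = (W j * (a j <= x <= b j)%R%:R)%:E.
  by rewrite /f -EFinM indicE mem_setE /= in_itv.
have f0 j x : (0 <= f j x)%E by rewrite fE lee_fin mulr_ge0.
have mf j : measurable_fun D (f j).
  apply: measurable_funeM; apply/measurable_EFinP.
  by apply: measurable_indic; exact: measurable_itv.
have lb x : D x -> (F%:E < \sum_(0 <= j <oo) f j x)%E.
  move=> Dx; rewrite ltNge; apply/negP => le; apply: nex; exists x.
    by move: Dx; rewrite /D /= in_itv.
  by under eq_eseriesr do rewrite -fE.
have iE : (\int[mu]_(x in D) \sum_(0 <= j <oo) f j x <= E%:E)%E.
  rewrite integral_nneseries //; apply: le_trans sE; apply: lee_nneseries.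
    by move=> j _ _; apply: integral_ge0.
  move=> j _; rewrite /f ge0_integralZl //; last 2 first.
  - by apply/measurable_EFinP; apply: measurable_indic; exact: measurable_itv.
  - by rewrite lee_fin.
  rewrite integral_indic // EFinM; apply: lee_pmul => //; first by rewrite lee_fin.
  by rewrite -lebesgue_itvcc //; apply: le_measure; rewrite ?inE //; apply: measurableI.
have mS : measurable_fun D (fun x => \sum_(0 <= j <oo) f j x)%E.
  by apply: ge0_emeasurable_sum.
have muD : mu D = h%:E by rewrite lebesgue_itvcc ?lerDl ?ltW // addrAC subrr add0r.
have : (E%:E < \int[mu]_(x in D) \sum_(0 <= j <oo) f j x)%E.
  apply: (@lt_le_trans _ _ (\int[mu]_(x in D) (cst F%:E x))%E).
    by rewrite integral_cst //= [X in (_ * X)%E]muD -EFinM lte_fin.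
  apply: ge0_le_integral => //; last by move=> x Dx; exact/ltW/lb.
  have E0 : 0 <= E.
    rewrite -lee_fin; apply: le_trans sE; apply: nneseries_ge0 => j _ _.
    by rewrite lee_fin mulr_ge0 // subr_ge0.
  by move=> x Dx /=; rewrite lee_fin -(pmulr_lge0 _ h0) ltW // (le_lt_trans E0).
by rewrite ltNge iE.
Qed.

Lemma interval_cover (a b : nat -> R) (c e l : R) :
  (forall j, a j <= b j) -> (\sum_(0 <= j <oo) (b j - a j)%:E <= e%:E)%E ->
  `[c, l] `<=` \bigcup_j [set x | a j <= x <= b j] -> l - c <= e.
Proof.
move=> ab se sub; case: (leP c l) => [cl|lc]; last first.
  have e0 : 0 <= e.
    rewrite -lee_fin; apply: le_trans se; apply: nneseries_ge0 => j _ _.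
    by rewrite lee_fin subr_ge0.
  by rewrite (le_trans _ e0) // subr_le0 ltW.
rewrite -lee_fin -lebesgue_itvcc //; apply: le_trans se.
apply: (@le_trans _ _ (\sum_(0 <= j <oo) mu `[a j, b j])%E); last first.
  by apply: lee_nneseries => // j _; rewrite lebesgue_itvcc.
by apply: measure_sigma_subadditive.
Qed.
End one_dim.

#[local] Instance rV_nbhs_filter (R : realType) m n (p : 'M[R]_(m,n)) : Filter (nbhs p) := nbhs_filter p.
#[local] Instance rV_nbhs_pfilter (R : realType) m n (p : 'M[R]_(m,n)) : ProperFilter (nbhs p) := nbhs_pfilter p.

(** [slice_bound] is applied to one coordinate after another: the side lengths of the boxes in the
    chosen coordinates are replaced by indicators of being hit. With [s] all coordinates but one, a
    small cover on a line is left. *)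
Lemma slice_choice (R : realType) (n : nat) (z : 'rV[R]_n) (h : R) (s : seq 'I_n) (e : R) :
  0 < h -> 0 < e -> uniq s -> exists2 e', 0 < e' &
  forall a b : nat -> 'rV[R]_n, (forall j l, a j 0 l <= b j 0 l) ->
  (\sum_(0 <= j <oo) (\prod_l (b j 0 l - a j 0 l))%:E <= e'%:E)%E ->
  exists x : 'rV[R]_n, [/\ forall l, z 0 l <= x 0 l <= z 0 l + h,
    forall l, l \notin s -> x 0 l = z 0 l &
    (\sum_(0 <= j <oo) (\prod_l (if l \in s then (a j 0 l <= x 0 l <= b j 0 l)%R%:R
        else b j 0 l - a j 0 l))%:E <= e%:E)%E].
Proof.
move=> h0; elim: s e => [|l s IH] e e0 /=.
  move=> _; exists e => // a b ab le; exists z; split => // l.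
  by rewrite lexx lerDl ltW.
move=> /andP[ls us].
(* The average over an interval of length h is to stay below e; the factor 1/2 makes the inequality
   of [slice_bound] strict. *)
have eh0 : 0 < e * h / 2 by rewrite divr_gt0 ?mulr_gt0.
have [e' e'0 he'] := IH _ eh0 us.
exists e' => // a b ab le; have [x [xz xs xe]] := he' a b ab le.
pose w j m : R := if m \in s then (a j 0 m <= x 0 m <= b j 0 m)%R%:R else b j 0 m - a j 0 m.
have w0 j m : 0 <= w j m by rewrite /w; case: ifP => // _; rewrite subr_ge0.
pose W j := \prod_(m | m != l) w j m.
have W0 j : 0 <= W j by apply: prodr_ge0.
have [|||y zy ye] := @slice_bound R (fun j => a j 0 l) (fun j => b j 0 l) W (e * h / 2) e (z 0 l) h h0 _ _ W0.
- by rewrite ltr_pdivrMr // ltr_pMr ?mulr_gt0 // ltr1n.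
- by move=> j.
- apply: le_trans xe; apply: lee_nneseries => j _; first by move=> _; rewrite lee_fin mulr_ge0 ?subr_ge0.
  by rewrite lee_fin [leRHS](bigD1 l) //= (negbTE ls) mulrC.
exists (\row_m (if m == l then y else x 0 m)); split => [m|m|].
- by rewrite mxE; case: eqP => [->|].
- by rewrite inE negb_or mxE => /andP[/negbTE -> /xs].
apply: le_trans ye; apply: lee_nneseries => j _.
  move=> _; rewrite lee_fin; apply: prodr_ge0 => m _; rewrite mxE.
  by case: (m \in l :: s) => //; rewrite subr_ge0.
rewrite lee_fin (bigD1 l) //= !mxE !inE eqxx /= mulrC ler_wpM2r //.
rewrite /W le_eqVlt; apply/orP; left; apply/eqP; apply: eq_bigr => m ml.
by rewrite /w inE (negbTE ml) /= mxE (negbTE ml).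
Qed.

(** Tilt psi by the slope M + e to get f. The image of the cover under f has length at most 2 L' d,
    so a larger increase of f would leave a level c between f 0 and f s that f does not take on the
    cover. At the last point where f <= c the value is c, and the hypothesis on psi yields a later
    such point: a contradiction. *)
Lemma growth_off_cover (R : realType) (psi : R -> R) (s L M d : R) (a b : nat -> R) :
  0 <= s -> 0 <= L ->
  (forall t t', 0 <= t <= s -> 0 <= t' <= s -> `|psi t - psi t'| <= L * `|t - t'|) ->
  (forall j, a j <= b j) -> (\sum_(0 <= j <oo) (b j - a j)%:E <= d%:E)%E ->
  (forall t e, 0 <= t < s -> (forall j, ~ (a j <= t <= b j)) -> 0 < e ->
    exists2 t', t < t' <= s & psi t' - psi t <= (M + e) * (t' - t)) ->
  psi s - psi 0 <= M * s + 2 * (L + `|M| + 1) * d.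
Proof.
move=> s0 L0 psiL ab sd dpsi.
have d0 : 0 <= d.
  rewrite -lee_fin; apply: le_trans sd; apply: nneseries_ge0 => j _ _.
  by rewrite lee_fin subr_ge0.
apply/ler_addgt0Pl => e' e'0.
(* [e <= 1] makes L' a Lipschitz constant of f, and e s <= e' absorbs the extra slope. *)
pose e := Num.min 1 (e' / (s + 1)).
have s10 : 0 < s + 1 by rewrite ltr_pwDr.
have e0 : 0 < e by rewrite lt_min ltr01 divr_gt0.
have es : e * s <= e'.
  apply: (@le_trans _ _ (e' / (s + 1) * s)).
    by rewrite ler_wpM2r // ge_min lexx orbT.
  by rewrite mulrAC ler_pdivrMr // ler_pM2l // lerDl.
pose L' := L + `|M| + 1.
have L'0 : 0 < L' by rewrite ltr_pwDr // addr_ge0.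
pose f t := psi t - (M + e) * t.
have fL t t' : 0 <= t <= s -> 0 <= t' <= s -> `|f t - f t'| <= L' * `|t - t'|.
  move=> ts ts'; rewrite /f (_ : _ - _ = psi t - psi t' - (M + e) * (t - t')); last by ring.
  apply: (@le_trans _ _ (L * `|t - t'| + (`|M| + 1) * `|t - t'|)); last by rewrite -mulrDl addrA.
  apply: (le_trans (ler_normB _ _)); apply: lerD; first exact: psiL.
  rewrite normrM ler_wpM2r // (le_trans (ler_normD _ _)) // lerD2l gtr0_norm //.
  by rewrite ge_min lexx.
suff: f s - f 0 <= 2 * L' * d.
  rewrite /f mulr0 subr0 => h; rewrite -/L'.
  have := lerD h es; move: (2 * L' * d) => X; lra.
rewrite leNgt; apply/negP => big.
(* One third of the excess is cut off at either end: [c0, c1] stays strictly inside (f 0, f s) and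
   is still longer than 2 L' d. *)
pose c0 := f 0 + (f s - f 0 - 2 * L' * d) / 3.
pose c1 := f s - (f s - f 0 - 2 * L' * d) / 3.
pose I j := [set t | [/\ a j <= t <= b j & 0 <= t <= s]].
(* A point of the j-th interval in [0, s]; the default 0 is harmless, as an interval missing [0, s]
   has no value of f to cover. *)
pose p j := if pselect (exists t, I j t) is left ex then projT1 (cid ex) else 0.
have pP j t : I j t -> I j (p j).
  move=> It; rewrite /p; case: pselect => [ex|]; last by case; exists t.
  exact: projT2 (cid ex).
pose a' j := f (p j) - L' * (b j - a j).
pose b' j := f (p j) + L' * (b j - a j).
have [c [cc cN]] : exists c, c0 <= c <= c1 /\ forall t, 0 <= t <= s -> f t = c -> forall j, ~ (a j <= t <= b j).
  apply: contrapT => nex.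
  have : c1 - c0 <= 2 * L' * d.
    apply: (@interval_cover R a' b') => [j||c /=].
    - have : 0 <= L' * (b j - a j) by rewrite mulr_ge0 ?subr_ge0 // ltW.
      rewrite /a' /b'; lra.
    - have -> : (\sum_(0 <= j <oo) (b' j - a' j)%:E = (2 * L')%:E * \sum_(0 <= j <oo) (b j - a j)%:E)%E.
        rewrite -nneseriesZl; last by move=> j _; rewrite lee_fin subr_ge0.
        by apply: eq_eseriesr => j _; rewrite -EFinM /a' /b'; congr EFin; ring.
      by rewrite [leRHS]EFinM lee_wpmul2l // lee_fin mulr_ge0 // ltW.
    rewrite in_itv /= => cc; apply: contrapT => nj; apply: nex; exists c; split=> // t ts ftc j tj.
    apply: nj; exists j => //=.
    have [h1 h2] := pP j t (conj tj ts); rewrite /a' /b' -ler_distl -ftc.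
    apply: (le_trans (fL _ _ ts h2)); rewrite ler_pM2l // ler_norml.
    case/andP: h1 => h3 h4; case/andP: tj => h5 h6.
    apply/andP; split; lra.
  rewrite /c0 /c1; move: big; move: (2 * L' * d) => X; lra.
have cf0 : f 0 < c by case/andP: cc => + _; rewrite /c0; move: big; move: (2 * L' * d) => X; lra.
have cfs : c < f s by case/andP: cc => _; rewrite /c1; move: big; move: (2 * L' * d) => X; lra.
pose S := [set t | 0 <= t <= s /\ f t <= c].
have S0 : S 0 by split; rewrite ?lexx ?s0 // ltW.
have hS : has_sup S by split; [exists 0|exists s => t [/andP[]]].
pose t0 := sup S.
have t0s : 0 <= t0 <= s.
  apply/andP; split; first exact: ub_le_sup hS.2 _ S0.
  by apply: ge_sup => [|t [/andP[]]//]; exists 0.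
have ft0 : f t0 <= c.
  apply/ler_addgt0Pl => x x0.
  have [t St tt0] := @sup_adherent R S (x / L') (divr_gt0 x0 L'0) hS.
  have [ts ftc] := St.
  have tle : t <= t0 by apply: ub_le_sup => //; exact: hS.2.
  have := fL _ _ t0s ts; rewrite (ger0_norm (_ : 0 <= t0 - t)) ?subr_ge0 // => /(le_trans (ler_norm _)) h.
  have : L' * (t0 - t) <= x.
    by rewrite mulrC -ler_pdivlMr // lerBlDr -lerBlDl ltW.
  lra.
have t0lt : t0 < s.
  rewrite lt_neqAle; case/andP: (t0s) => _ ->; rewrite andbT.
  by apply/eqP => e1; move: ft0; rewrite e1 leNgt cfs.
have nS t : t0 < t <= s -> c < f t.
  move=> /andP[h1 h2]; rewrite ltNge; apply/negP => h3.
  have : S t by split=> //; rewrite h2 (le_trans _ (ltW h1)) //; case/andP: t0s.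
  by move/(ub_le_sup hS.2); rewrite leNgt h1.
have ft0c : f t0 = c.
  apply/eqP; rewrite eq_le ft0 /= leNgt; apply/negP => lt.
  pose t := Num.min s (t0 + (c - f t0) / L').
  have q0 : 0 < (c - f t0) / L' by rewrite divr_gt0 // subr_gt0.
  have tt : t0 < t <= s by rewrite lt_min t0lt ltrDl q0 ge_min lexx.
  have ts : 0 <= t <= s.
    case/andP: tt => h1 ->; rewrite andbT (le_trans _ (ltW h1)) //; by case/andP: t0s.
  have := fL _ _ ts t0s; rewrite (gtr0_norm (_ : 0 < t - t0)); last by rewrite subr_gt0; case/andP: tt.
  move=> /(le_trans (ler_norm _)) h4.
  have : L' * (t - t0) <= c - f t0.
    by rewrite mulrC -ler_pdivlMr // lerBlDl ge_min lexx orbT.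
  have := nS _ tt; lra.
have [||t' tt' ht'] := dpsi t0 e _ _ e0.
- by rewrite t0lt andbT; case/andP: t0s.
- by move=> j; apply: cN.
by have := nS _ tt'; rewrite -ft0c /f; lra.
Qed.

Section local_lipschitz.
Variables (R : realType).

Definition locally_lipschitz (V W : normedModType R) (g : V -> W) :=
  forall x : V, exists2 U : set V, nbhs x U & [lipschitz g y | y in U].

Lemma lipschitz_inP (V W : normedModType R) (g : V -> W) (U : set V) :
  [lipschitz g y | y in U] ->
  \forall L \near +oo, forall x y, U x -> U y -> `|g x - g y| <= L * `|x - y|.
Proof.
move=> [M [Mr h]]; exists M; split => // L ML x y Ux Uy.
by have := h L ML (x, y) (conj Ux Uy).
Qed.

Lemma locally_lipschitz_continuous (V W : normedModType R) (g : V -> W) :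
  locally_lipschitz g -> continuous g.
Proof.
move=> gL x; have [U Ux /lipschitz_inP[M [Mr h]]] := gL x.
pose L := Num.max (M + 1) 1.
have L0 : 0 < L by rewrite lt_max ltr01 orbT.
have {}h y z := h L (_ : M < L) y z.
apply/cvgrPdist_lt => e e0; near=> y.
have xy : `|x - y| < e / L.
  near: y; apply: cvgr_dist_lt; [exact: cvg_id|exact: divr_gt0].
apply: (@le_lt_trans _ _ (L * `|x - y|)).
  apply: h; first by rewrite lt_max ltrDl ltr01.
    exact: nbhs_singleton.
  by near: y.
by rewrite mulrC -ltr_pdivlMr.
Unshelve. all: by end_near. Qed.

(* Uniformity over a compact set: one constant serves both as the Lipschitz
   constant and, inverted, as the scale. *)
Lemma locally_lipschitz_compact (V W : normedModType R) (g : V -> W) (K : set V) :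
  locally_lipschitz g -> compact K ->
  exists2 L, 0 < L & forall x y, K x -> `|y - x| <= L^-1 -> `|g y - g x| <= L * `|y - x|.
Proof.
move=> gL /compact_near_coveringP cK.
have [] := cK R (pinfty_nbhs R) (fun L x => forall y, `|y - x| <= L^-1 -> `|g y - g x| <= L * `|y - x|) _ _.
  move=> x Kx; have [U /nbhs_normP[r /= r0 rU] /lipschitz_inP[M [Mr h]]] := gL x.
  near=> z L => y /= yz.
  have L0 : 0 < L by near: L; exact: nbhs_pinfty_gt.
  have xz : `|x - z| < r / 2.
    near: z; apply: cvgr_dist_lt; [exact: cvg_id|exact: divr_gt0].
  apply: h; first by near: L; exact: nbhs_pinfty_gt.
    apply: rU => /=; rewrite -(subrKA z) [r]splitr (le_lt_trans (ler_normD _ _)) //.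
    rewrite ltrD // distrC (le_lt_trans yz) // invf_plt ?posrE ?divr_gt0 //.
    by near: L; apply: nbhs_pinfty_gt; exact: num_real.
  by apply: rU => /=; rewrite (lt_trans xz) // ltr_pdivrMr // ltr_pMr // ltr1n.
move=> M [Mr h]; exists (Num.max 1 (M + 1)).
  by rewrite lt_max ltr01.
by move=> x y Kx; apply: h => //; rewrite lt_max ltrDl ltr01 orbT.
Unshelve. all: by end_near. Qed.

(** Steps shorter than 1/L are chained; on a line their lengths add up, so the constant is kept. *)
Lemma lipschitz_chain (psi : R -> R) (s L : R) : 0 < L -> 
  (forall t t', 0 <= t <= s -> 0 <= t' <= s -> `|t - t'| <= L^-1 -> `|psi t - psi t'| <= L * `|t - t'|) ->
  forall t t', 0 <= t <= s -> 0 <= t' <= s -> `|psi t - psi t'| <= L * `|t - t'|.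
Proof.
move=> L0 h t t' ts ts'.
wlog tt : t t' ts ts' / t <= t'.
  move=> H; case/orP: (le_total t t') => tt; first exact: H.
  by rewrite distrC [`|t - _|]distrC; apply: H.
case/andP: ts => t0 _; case/andP: ts' => _ ts'.
pose N := (Num.truncn ((t' - t) * L)).+1.
have N0 : 0 < N%:R :> R by rewrite ltr0n.
pose d := (t' - t) / N%:R.
have d0 : 0 <= d by rewrite divr_ge0 ?subr_ge0.
have dL : d <= L^-1.
  rewrite ler_pdivrMr // mulrC -ler_pdivrMr ?invr_gt0 // invrK.
  by rewrite ltW // truncnS_gt.
have ht : t + N%:R * d = t' by rewrite /d mulrCA divff ?gt_eqF // mulr1 addrC subrK.
have step k : (k <= N)%N -> `|psi t - psi (t + k%:R * d)| <= L * (k%:R * d).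
  elim: k => [_|k IH kN]; first by rewrite mul0r addr0 subrr normr0 mulr0.
  rewrite -(subrKA (psi (t + k%:R * d))) (le_trans (ler_normD _ _)) //.
  have rg m : (m <= N)%N -> 0 <= t + m%:R * d <= s.
    move=> mN; apply/andP; split; first by rewrite (addr_ge0 t0) // mulr_ge0 // ler0n.
    by rewrite (le_trans _ ts') // -ht lerD2l ler_wpM2r // ler_nat.
  have e : t + k%:R * d - (t + k.+1%:R * d) = - d by rewrite -natr1; ring.
  have -> : L * (k.+1%:R * d) = L * (k%:R * d) + L * d by rewrite -natr1; ring.
  rewrite lerD ?IH ?(ltnW kN) //.
  apply: (le_trans (h _ _ (rg _ (ltnW kN)) (rg _ kN) _)).
    by rewrite e normrN ger0_norm.
  by rewrite e normrN ger0_norm.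
have := step N (leqnn N); rewrite ht => /le_trans; apply.
have -> : N%:R * d = t' - t by rewrite -ht addrAC subrr add0r.
by rewrite distrC ger0_norm ?subr_ge0.
Qed.

End local_lipschitz.

(** A line parallel to e_i within distance d of z is chosen on which the null set is covered by
    intervals of total length at most d. [growth_off_cover] applies on it, the Lipschitz bound pays
    for moving both end points, and d is arbitrarily small. *)
Lemma ae_partial_le (R : realType) (n : nat) (g : 'rV[R]_n -> R) (N : set 'rV[R]_n)
    (i : 'I_n) (M : R) (z : 'rV[R]_n) (s : R) :
  lebesgue_null N -> 0 <= s -> locally_lipschitz g ->
  (forall x, `|x| <= `|z| + s + 1 -> ~ N x ->
    derivable g x (delta_mx 0 i) /\ 'D_(delta_mx 0 i) g x <= M) ->
  g (z + s *: delta_mx 0 i) - g z <= M * s.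
Proof.
move=> N0 s0 gL gN; set ei := delta_mx 0 i.
have eiE j : ei 0 j = (j == i)%:R by rewrite mxE eqxx.
have [L L0 hL] := locally_lipschitz_compact gL (@rV_ball_compact R n (`|z| + s + 1)).
apply/ler_addgt0Pl => e e0.
(* 2 L d is the cost of moving the two end points, the rest is the loss on the cover. Below,
   [d <= 1] keeps the line where the derivative is controlled, and [d <= L^-1] keeps displacements
   within the scale of the Lipschitz bound. *)
pose C := 2 * L + 2 * (L + `|M| + 1).
have C0 : 0 < C by rewrite ltr_pwDl ?mulr_gt0 // mulr_ge0 // addr_ge0 // addr_ge0 // ltW.
pose d := Num.min (Num.min 1 L^-1) (e / C).
have d0 : 0 < d by rewrite !lt_min ltr01 invr_gt0 L0 divr_gt0.
have d1 : d <= 1 by rewrite !ge_min lexx.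
have dL : d <= L^-1 by rewrite !ge_min lexx orbT.
have dC : C * d <= e by rewrite mulrC -ler_pdivlMr // ge_min lexx orbT.
pose sq := [seq j <- enum 'I_n | j != i].
have usq : uniq sq by rewrite filter_uniq // enum_uniq.
have msq j : (j \in sq) = (j != i) by rewrite mem_filter mem_enum andbT.
have [e' e'0 he'] := slice_choice z d0 d0 usq.
have [a [b [ab Ncov sab]]] := N0 e' e'0.
have [x [xz xs xd]] := he' a b ab sab.
have xzd : `|x - z| <= d.
  apply: rV_norm_le => [|j]; first exact: ltW.
  have /andP[h1 h2] := xz j; rewrite !mxE ger0_norm ?subr_ge0 // lerBlDr addrC //.
have nei : `|ei| <= 1.
  by apply: rV_norm_le => // j; rewrite eiE; case: (j == i); rewrite ?normr1 ?normr0.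
have line t : 0 <= t <= s -> `|x + t *: ei| <= `|z| + s + 1.
  case/andP=> t0 ts; rewrite -(subrK z x) -addrA addrC -addrA.
  apply: (le_trans (ler_normD _ _)); rewrite -addrA lerD // addrC.
  apply: (le_trans (ler_normD _ _)); rewrite addrC lerD ?(le_trans xzd) //.
  by rewrite normrZ ger0_norm // (le_trans _ ts) // ler_piMr.
pose psi t := g (x + t *: ei).
have psiL : forall t t', 0 <= t <= s -> 0 <= t' <= s -> `|psi t - psi t'| <= L * `|t - t'|.
  apply: lipschitz_chain => // t t' ts ts' tt.
  have e1 : `|(x + t *: ei) - (x + t' *: ei)| <= `|t - t'|.
    by rewrite opprD addrACA subrr add0r -scalerBl normrZ ler_piMr.
  apply: (le_trans (hL _ _ (line _ ts') (le_trans e1 tt))).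
  by rewrite ler_pM2l.
(* [ok j] says that the line meets the j-th box in the transversal coordinates; the other boxes
   leave the degenerate interval [0, 0]. *)
pose ok j := [forall l, (l != i) ==> (a j 0 l <= x 0 l <= b j 0 l)].
pose al j := if ok j then a j 0 i - x 0 i else 0.
pose be j := if ok j then b j 0 i - x 0 i else 0.
have albe j : al j <= be j by rewrite /al /be; case: ifP => // _; rewrite lerD2r.
have sl : (\sum_(0 <= j <oo) (be j - al j)%:E <= d%:E)%E.
  apply: le_trans xd; apply: lee_nneseries => j _; first by move=> _; rewrite lee_fin subr_ge0.
  rewrite lee_fin (bigD1 i) //= msq eqxx /=.
  have P0 : 0 <= \prod_(l | l != i) (if l \in sq then (a j 0 l <= x 0 l <= b j 0 l)%R%:R else b j 0 l - a j 0 l) :> R.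
    by apply: prodr_ge0 => l _; case: ifP => // _; rewrite subr_ge0.
  rewrite /al /be; case: ifP => [/forallP okj|_]; last by rewrite subrr mulr_ge0 ?subr_ge0.
  rewrite big1 ?mulr1 => [|l li]; last by rewrite msq li (implyP (okj l) li).
  by rewrite opprB addrA subrK.
have s1 : psi s - psi 0 <= M * s + 2 * (L + `|M| + 1) * d.
  apply: (@growth_off_cover R psi s L M d al be) => //; first exact: ltW.
  move=> t eps /andP[t0 ts] tN eps0.
  have ts' : 0 <= t <= s by rewrite t0 ltW.
  have nN : ~ N (x + t *: ei).
    move=> /Ncov[j _ /= xj]; apply: (tN j).
    have okj : ok j.
      apply/forallP => l; apply/implyP => li; have := xj l.
      by rewrite !mxE (negbTE li) andbF mulr0 addr0.
    by rewrite /al /be okj lerBlDr lerBrDr; have := xj i; rewrite !mxE !eqxx mulr1 addrC.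
  have [dg Dg] := gN _ (line _ ts') nN.
  have : \forall h \near 0^'+, h^-1 *: (g (h *: ei + (x + t *: ei)) - g (x + t *: ei)) <= M + eps.
    have : h^-1 *: ((g \o shift (x + t *: ei)) (h *: ei) - g (x + t *: ei)) @[h --> 0^'+] --> 'D_ei g (x + t *: ei).
      by apply: cvg_dnbhs_at_right; exact: dg.
    move=> /cvgr_le; apply; rewrite (le_lt_trans Dg) // ltrDl //.
  move=> hh.
  have [h [h0 hs hg]] : exists h, [/\ 0 < h, h <= s - t & h^-1 *: (g (h *: ei + (x + t *: ei)) - g (x + t *: ei)) <= M + eps].
    near (0 : R)^'+ => h; exists h; split; near: h => //.
      exact: nbhs_right_gt.
    by apply: nbhs_right_le; rewrite subr_gt0.
  exists (t + h); first by rewrite ltrDl h0 -lerBrDl.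
  rewrite addrAC subrr add0r -ler_pdivrMr // mulrC /psi.
  by rewrite (_ : x + (t + h) *: ei = h *: ei + (x + t *: ei)) // scalerDl addrA addrC.
have z0 : `|z| <= `|z| + s + 1 by rewrite -addrA lerDl addr_ge0.
have zs : `|z + s *: ei| <= `|z| + s + 1.
  apply: (le_trans (ler_normD _ _)); rewrite normrZ (ger0_norm s0) -addrA lerD2l.
  by rewrite (@le_trans _ _ s) ?lerDl // ler_piMr.
have k0 : g x - g z <= L * d.
  apply: (le_trans (ler_norm _)); apply: (le_trans (hL _ _ z0 (le_trans xzd dL))).
  by rewrite ler_pM2l.
have e2 : `|(x + s *: ei) - (z + s *: ei)| <= d.
  by rewrite opprD addrACA subrr addr0.
have k1 : g (z + s *: ei) - g (x + s *: ei) <= L * d.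
  apply: (le_trans (ler_norm _)); rewrite distrC.
  apply: (le_trans (hL _ _ zs (le_trans e2 dL))).
  by rewrite ler_pM2l.
move: s1 k0 k1 dC; rewrite /psi scale0r addr0 /C.
rewrite !mulrDl; lra.
Unshelve. all: by end_near. Qed.

(** * Norms, inner products and powers *)

Section norms.
Variable R : realType.

Lemma enorm_coord m n (A : 'M[R]_(m, n)) i j : `|A i j| <= enorm A.
Proof.
rewrite /enorm -sqrtr_sqr ler_sqrt ?sumr_ge0 //; last first.
  by move=> i' _; apply: sumr_ge0 => j' _; exact: sqr_ge0.
rewrite (bigD1 i) //= (bigD1 j) //= -addrA lerDl addr_ge0 ?sumr_ge0 // => [? _|? _].
  exact: sqr_ge0.
by apply: sumr_ge0 => ? _; exact: sqr_ge0.
Qed.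

Lemma enorm_ge0 m n (A : 'M[R]_(m, n)) : 0 <= enorm A.
Proof. exact: sqrtr_ge0. Qed.

Variable n : nat.
Implicit Types x v w : 'rV[R]_n.

Lemma norm_le_enorm x : `|x| <= enorm x.
Proof. by apply: rV_norm_le => [|i]; [exact: enorm_ge0|exact: enorm_coord]. Qed.

Lemma enorm_le_norm x : enorm x <= n.+1%:R * `|x|.
Proof.
rewrite /enorm big_ord1 -[leRHS]ger0_norm ?mulr_ge0 // -sqrtr_sqr ler_sqrt; last exact: sqr_ge0.
apply: (@le_trans _ _ (\sum_(j < n) `|x| ^+ 2)).
  apply: ler_sum => i _; rewrite -[leLHS]ger0_norm ?sqr_ge0 //.
  by rewrite normrX ler_pXn2r ?nnegrE //; exact: rV_coord_le.
rewrite sumr_const card_ord -[leLHS]mulr_natl exprMn ler_wpM2r ?sqr_ge0 //.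
by rewrite -natrX ler_nat (leq_trans (leqnSn n)) // leq_pmulr.
Qed.

Lemma dotC v w : dot v w = dot w v.
Proof. by apply: eq_bigr => i _; rewrite mulrC. Qed.

Lemma dotDr v w x : dot v (w + x) = dot v w + dot v x.
Proof. by rewrite /dot -big_split; apply: eq_bigr => i _; rewrite mxE mulrDr. Qed.

Lemma dotZr a v w : dot v (a *: w) = a * dot v w.
Proof. by rewrite /dot mulr_sumr; apply: eq_bigr => i _; rewrite mxE mulrCA. Qed.

Lemma dotNr v w : dot v (- w) = - dot v w.
Proof. by rewrite -scaleN1r dotZr mulN1r. Qed.

Lemma dotBr v w x : dot v (w - x) = dot v w - dot v x.
Proof. by rewrite dotDr dotNr. Qed.

Lemma dotDl v w x : dot (w + x) v = dot w v + dot x v.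
Proof. by rewrite !(dotC _ v) dotDr. Qed.

Lemma dotBl v w x : dot (w - x) v = dot w v - dot x v.
Proof. by rewrite !(dotC _ v) dotBr. Qed.

Lemma dotZl a v w : dot (a *: v) w = a * dot v w.
Proof. by rewrite dotC dotZr dotC. Qed.

Lemma dot0r v : dot v 0 = 0.
Proof. by rewrite -(scale0r 0) dotZr mul0r. Qed.

Lemma dot_delta v i : dot v (delta_mx 0 i) = v 0 i.
Proof.
rewrite /dot (bigD1 i) //= big1 ?addr0 => [|j ji]; first by rewrite mxE !eqxx mulr1.
by rewrite mxE (negbTE ji) andbF mulr0.
Qed.

Lemma dot_le v w : `|dot v w| <= n.+1%:R * `|v| * `|w|.
Proof.
apply: (le_trans (ler_norm_sum _ _ _)).
apply: (@le_trans _ _ (\sum_(i < n) `|v| * `|w|)).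
  by apply: ler_sum => i _; rewrite normrM ler_pM // rV_coord_le.
rewrite sumr_const card_ord -[leLHS]mulr_natl -mulrA; apply: ler_wpM2r; first exact: mulr_ge0.
by rewrite ler_nat.
Qed.

Lemma dot_cvg (T : Type) (F : set_system T) {FF : Filter F} (f g : T -> 'rV[R]_n) v w :
  f t @[t --> F] --> v -> g t @[t --> F] --> w -> dot (f t) (g t) @[t --> F] --> dot v w.
Proof.
move=> fv gw; apply: cvg_big => [|i _]; first exact: add_continuous.
by apply: cvgM; exact: cvg_coord.
Qed.

Lemma dot_eq0 v : (forall w, dot v w = 0) -> v = 0.
Proof. by move=> h; apply/rowP => i; rewrite -dot_delta h mxE. Qed.

End norms.

Section powers.
Variable R : realType.

Lemma powR_le (a b r : R) : 0 <= r -> 0 <= a <= b -> a `^ r <= b `^ r.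
Proof.
by move=> r0 /andP[a0 ab]; apply: ge0_ler_powR => //; rewrite nnegrE // (le_trans a0).
Qed.

Lemma powR_le_exp (a r s : R) : 0 <= a -> 0 <= r <= s -> a `^ r <= 1 + a `^ s.
Proof.
move=> a0 /andP[r0 rs]; case: (leP 1 a) => a1.
  by apply: (le_trans (ler_powR a1 rs)); rewrite lerDr.
apply: (@le_trans _ _ 1); last by rewrite lerDl powR_ge0.
have := powR_le r0 (_ : 0 <= a <= 1); rewrite powR1; apply.
by rewrite a0 ltW.
Qed.

Lemma powR_add_le (a b r : R) : 0 <= r -> 0 <= a -> 0 <= b ->
  (a + b) `^ r <= 2 `^ r * (a `^ r + b `^ r).
Proof.
move=> r0; wlog ab : a b / a <= b.
  move=> H a0 b0; case/orP: (le_total a b) => ab; first exact: H.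
  by rewrite addrC [a `^ r + _]addrC; apply: H.
move=> a0 b0; apply: (@le_trans _ _ ((2 * b) `^ r)).
  by apply: powR_le => //; rewrite addr_ge0 //= mulr_natl mulr2n lerD2r.
by rewrite powRM // ler_wpM2l ?powR_ge0 // lerDr powR_ge0.
Qed.

End powers.

Lemma cvg_pair_nbhs (T : Type) (F : set_system T) {FF : Filter F} (V W : topologicalType)
    (f : T -> V) (g : T -> W) (a : V) (b : W) :
  f t @[t --> F] --> a -> g t @[t --> F] --> b -> (f t, g t) @[t --> F] --> (a, b).
Proof. exact: (@cvg_pair _ _ _ F (nbhs a) (nbhs b) FF (nbhs_filter a) (nbhs_filter b)). Qed.

(** * Derivatives along lines and convexity *)

Section line_derivative.
Variable R : realType.

(** Difference quotients see only values on a line, so partial derivatives of H can be read as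
    directional derivatives on a product space or on R^(d + d + k). *)
Lemma derive_slice (V W U : normedModType R) (f : V -> U) (f' : W -> U) v v' a a' :
  (forall h : R, f (h *: v + a) = f' (h *: v' + a')) ->
  'D_v f a = 'D_v' f' a' /\ (derivable f a v -> derivable f' a' v').
Proof.
move=> h; suff e : (fun h0 : R => h0^-1 *: ((f \o shift a) (h0 *: v) - f a)) =
    (fun h0 : R => h0^-1 *: ((f' \o shift a') (h0 *: v') - f' a')).
  by rewrite /derive /derivable e.
apply/funext => t /=; have := h 0; rewrite !scale0r !add0r => ->.
by rewrite h.
Qed.

Lemma derive_coord (V : normedModType R) n (f : V -> 'rV[R]_n) v a i :
  derivable f a v ->
  derivable (fun x => f x 0 i) a v /\ 'D_v (fun x => f x 0 i) a = 'D_v f a 0 i.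
Proof.
move=> df.
have c : h^-1 *: (((fun x => f x 0 i) \o shift a) (h *: v) - f a 0 i) @[h --> 0^'] --> 'D_v f a 0 i.
  have c : (h^-1 *: ((f \o shift a) (h *: v) - f a)) 0 i @[h --> 0^'] --> 'D_v f a 0 i.
    by apply: cvg_coord; exact: df.
  by apply: cvg_trans c; apply: near_eq_cvg; apply: nearW => t; rewrite !mxE.
by split; [apply/cvg_ex; exists ('D_v f a 0 i)|exact: cvg_lim].
Qed.

Lemma is_derive_line (V : normedModType R) (f : V -> R) (x v : V) (t : R) :
  differentiable f (x + t *: v) ->
  is_derive t 1 (fun s => f (x + s *: v)) ('D_v f (x + t *: v)).
Proof.
move=> df.
have h (s : R) : f (s *: v + (x + t *: v)) = (fun s => f (x + s *: v)) (s *: (1 : R) + t).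
  by rewrite [s *: (1 : R)]mulr1 scalerDl addrCA.
have [e c] := @derive_slice V R R f (fun s => f (x + s *: v)) v 1 (x + t *: v) t h.
by split; [apply: c; exact: diff_derivable|rewrite e].
Qed.

Lemma line_mvt (V : normedModType R) (f : V -> R) (x v : V) (a b : R) : a <= b ->
  (forall z, differentiable f z) ->
  exists2 c, a <= c <= b & f (x + b *: v) - f (x + a *: v) = 'D_v f (x + c *: v) * (b - a).
Proof.
move=> ab df.
have der (t : R) := @is_derive_line V f x v t (df _).
have cf : {within `[a, b], continuous (fun s => f (x + s *: v))}.
  apply: continuous_subspaceT => t.
  by apply: differentiable_continuous; apply/derivable1_diffP; have [] := der t.
have [c ic e] := @MVT_segment R (fun s => f (x + s *: v)) (fun t => 'D_v f (x + t *: v)) a b ab (fun t _ => der t) cf.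
by exists c => //; move: ic; rewrite in_itv.
Qed.

Lemma derive_grad n (f : 'rV[R]_n -> R) (x v : 'rV[R]_n) :
  differentiable f x -> 'D_v f x = dot (grad f x) v.
Proof.
move=> df; rewrite deriveE // {1}(row_sum_delta v) linear_sum /dot.
by apply: eq_bigr => i _; rewrite linearZ /= !mxE deriveE // mulrC.
Qed.

Lemma convex_subgradient (V : normedModType R) (f : V -> R) (x z : V) :
  convex_function setT f -> differentiable f x -> f x + 'D_(z - x) f x <= f z.
Proof.
move=> cf df; rewrite -lerBrDl.
have dd : derivable f x (z - x) by exact: diff_derivable.
have c : h^-1 *: ((f \o shift x) (h *: (z - x)) - f x) @[h --> 0^'+] --> 'D_(z - x) f x.
  by apply: cvg_dnbhs_at_right; exact: dd.
apply: (cvgr_to_le c); near=> h.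
have h0 : 0 < h by near: h; exact: nbhs_right_gt.
have h1 : h <= 1 by near: h; exact: nbhs_right_le.
have := cf (Itv01 (ltW h0) h1) z x; rewrite !inE => /(_ I I).
rewrite /= /conv /= => hc.
rewrite [X in X <= _]mulrC ler_pdivrMr // lerBlDr.
have -> : h *: (z - x) + x = h *: z + (1 - h) *: x.
  by rewrite scalerBr scalerBl scale1r addrAC addrA.
apply: (le_trans hc).
change (h * f z + (1 - h) * f x <= (f z - f x) * h + f x).
by rewrite le_eqVlt; apply/orP; left; apply/eqP; ring.
Unshelve. all: by end_near. Qed.

End line_derivative.

(** * Propagation along coordinate directions *)

Section coordinate_paths.
Variable R : realType.

(** The coordinates of y are replaced by those of y' one at a time; the intermediate points stay in
    the ball because the norm is the sup norm. *)
Lemma coord_path_le n (g : 'rV[R]_n -> R) (M r : R) : 0 <= M ->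
  (forall z i s, 0 <= s -> `|z| <= r -> `|z + s *: delta_mx 0 i| <= r ->
     `|g (z + s *: delta_mx 0 i) - g z| <= M * s) ->
  forall y y', `|y| <= r -> `|y'| <= r -> `|g y - g y'| <= n%:R * M * `|y - y'|.
Proof.
move=> M0 h y y' yr y'r.
pose w k : 'rV[R]_n := \row_i (if (i < k)%N then y' 0 i else y 0 i).
have r0 : 0 <= r by exact: le_trans yr.
have wr k : `|w k| <= r.
  apply: rV_norm_le => // i; rewrite mxE; case: ifP => _.
    by rewrite (le_trans (rV_coord_le _ _)).
  by rewrite (le_trans (rV_coord_le _ _)).
have h2 z z' i s : `|z| <= r -> `|z'| <= r -> z' = z + s *: delta_mx 0 i -> `|g z - g z'| <= M * `|s|.
  move=> zr z'r e; case: (leP 0 s) => s0.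
    by rewrite distrC e (ger0_norm s0) h // -e.
  have e' : z = z' + (- s) *: delta_mx 0 i by rewrite e scaleNr addrK.
  by rewrite [in leLHS]e' (ltr0_norm s0) h // -?e' // oppr_ge0 ltW.
have key k : (k <= n)%N -> `|g y - g (w k)| <= k%:R * M * `|y - y'|.
  elim: k => [_|k IH kn].
    rewrite (_ : w 0 = y) ?subrr ?normr0 ?mul0r //.
    by apply/rowP => i; rewrite mxE.
  rewrite -(subrKA (g (w k))) -natr1 2!mulrDl (le_trans (ler_normD _ _)) // lerD ?IH ?(ltnW kn) //.
  pose i := Ordinal kn.
  have e : w k.+1 = w k + (y' 0 i - y 0 i) *: delta_mx 0 i.
    apply/rowP => j; rewrite !mxE eqxx /= ltnS leq_eqVlt.
    have -> : (nat_of_ord j == k) = (j == i) by rewrite -val_eqE.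
    case: eqP => [->|_] /=; last by rewrite mulr0 addr0.
    by rewrite ltnn mulr1 addrC subrK.
  apply: (le_trans (h2 _ _ _ _ (wr _) (wr _) e)).
  rewrite mul1r ler_wpM2l // distrC.
  by have := rV_coord_le (y - y') i; rewrite !mxE.
have -> : y' = w n by apply/rowP => i; rewrite mxE ltn_ord.
rewrite [in leRHS](_ : w n = y'); first exact: key.
by apply/rowP => i; rewrite mxE ltn_ord.
Qed.

(* A nonzero slope would persist along a half-line. *)
Lemma bounded_concave_const (f df : R -> R) (B : R) :
  (forall t : R, is_derive t (1 : R) f (df t)) -> (forall t s : R, t <= s -> df s <= df t) ->
  (forall t, `|f t| <= B) -> forall t, f t = f 0.
Proof.
move=> fdf dfle fB.
have mvt a b : a <= b -> exists2 c, a <= c <= b & f b - f a = df c * (b - a).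
  move=> ab; have [|c ic e] := @MVT_segment R f df a b ab (fun t _ => fdf t).
    apply: continuous_subspaceT => t.
    by apply: differentiable_continuous; apply/derivable1_diffP; have [] := fdf t.
  by exists c => //; move: ic; rewrite in_itv.
have B0 : 0 <= B by exact: le_trans (fB 0).
have fBB a b : f b - f a <= 2 * B.
  have := fB a; have := fB b; rewrite !ler_norml => /andP[h1 h2] /andP[h3 h4]; lra.
have df0 t : df t = 0.
  case: (ltgtP (df t) 0) => // dt.
  (* Over this length the slope forces a change of 2 B + 1, while |f| <= B allows at most 2 B. *)
  - pose s := (2 * B + 1) / - df t.
    have s0 : 0 <= s by rewrite divr_ge0 ?oppr_ge0 ?(ltW dt) // addr_ge0 // mulr_ge0.
    have [c /andP[tc _] e] := mvt t (t + s) (ltac:(by rewrite lerDl)).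
    have : f (t + s) - f t <= - (2 * B + 1).
      rewrite e addrAC subrr add0r (@le_trans _ _ (df t * s)) //.
        by rewrite ler_wpM2r // dfle.
      by rewrite /s invrN mulrN mulrN mulrCA divff ?mulr1 // lt_eqF.
    by have := fBB (t + s) t; move=> h1 h2; lra.
  - pose s := (2 * B + 1) / df t.
    have s0 : 0 <= s by rewrite divr_ge0 ?(ltW dt) // addr_ge0 // mulr_ge0.
    have [c /andP[_ ct] e] := mvt (t - s) t (ltac:(by rewrite gerDl oppr_le0)).
    have : 2 * B + 1 <= f t - f (t - s).
      have -> : 2 * B + 1 = df t * s by rewrite /s mulrCA divff ?mulr1 // gt_eqF.
      have ts : t - (t - s) = s by ring.
      by rewrite e ts ler_wpM2r // dfle.
    by have := fBB (t - s) t; move=> h1 h2; lra.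
move=> t; case/orP: (le_total 0 t) => t0.
  by have [c _] := mvt _ _ t0; rewrite df0 mul0r => /eqP; rewrite subr_eq0 => /eqP.
by have [c _] := mvt _ _ t0; rewrite df0 mul0r => /eqP; rewrite subr_eq0 => /eqP.
Qed.

End coordinate_paths.

(** * The Hamiltonian does not depend on the state *)

Section hamiltonian_independent_of_state.
Variables (R : realType) (d k : nat).
Variable H : 'rV[R]_d -> 'rV[R]_d -> 'rV[R]_k -> R.
Let F (z : 'rV[R]_d * 'rV[R]_d * 'rV[R]_k) := H z.1.1 z.1.2 z.2.
Hypothesis HC11 : C11 F.

Let dx (v : 'rV[R]_d) : 'rV[R]_d * 'rV[R]_d * 'rV[R]_k := (v, 0, 0).
Let dp (v : 'rV[R]_d) : 'rV[R]_d * 'rV[R]_d * 'rV[R]_k := (0, v, 0).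

Let dxE h v x p phi : F (h *: dx v + (x, p, phi)) = H (h *: v + x) p phi.
Proof. by rewrite /F /= !scaler0 !add0r. Qed.

Let dpE h v x p phi : F (h *: dp v + (x, p, phi)) = H x (h *: v + p) phi.
Proof. by rewrite /F /= !scaler0 !add0r. Qed.

Lemma DxH_coord x p phi i : DxH H x p phi 0 i = 'D_(dx (delta_mx 0 i)) F (x, p, phi).
Proof.
rewrite mxE; symmetry.
by apply: (@derive_slice R _ _ _ F (fun y => H y p phi) (dx _) (delta_mx 0 i) (x, p, phi) x (fun h => dxE h _ _ _ _)).1.
Qed.

Lemma DpH_coord x p phi i : DpH H x p phi 0 i = 'D_(dp (delta_mx 0 i)) F (x, p, phi).
Proof.
rewrite mxE; symmetry.
by apply: (@derive_slice R _ _ _ F (H x ^~ phi) (dp _) (delta_mx 0 i) (x, p, phi) p (fun h => dpE h _ _ _ _)).1.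
Qed.

Lemma H_continuous : continuous F.
Proof. by move=> z; apply: differentiable_continuous; exact: HC11.1. Qed.

Lemma DpH_cvg (T : Type) (FF : set_system T) {FFF : Filter FF} (x p : T -> 'rV[R]_d) (phi : T -> 'rV[R]_k) x0 p0 phi0 :
  x t @[t --> FF] --> x0 -> p t @[t --> FF] --> p0 -> phi t @[t --> FF] --> phi0 ->
  DpH H (x t) (p t) (phi t) @[t --> FF] --> DpH H x0 p0 phi0.
Proof.
move=> hx hp hphi; apply: cvg_rV => i; under eq_fun do rewrite DpH_coord.
rewrite DpH_coord.
have c : {for (x0, p0, phi0), continuous ('D_(dp (delta_mx 0 i)) F)}.
  by apply: locally_lipschitz_continuous => z; exact: HC11.2.
apply: (@cvg_comp _ _ _ (fun t => (x t, p t, phi t)) ('D_(dp (delta_mx 0 i)) F) FF (nbhs (x0, p0, phi0)) _ _ c).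
by apply: cvg_pair_nbhs => //; apply: cvg_pair_nbhs.
Qed.

Lemma H_cvg (T : Type) (FF : set_system T) {FFF : Filter FF} (x p : T -> 'rV[R]_d) (phi : T -> 'rV[R]_k) x0 p0 phi0 :
  x t @[t --> FF] --> x0 -> p t @[t --> FF] --> p0 -> phi t @[t --> FF] --> phi0 ->
  H (x t) (p t) (phi t) @[t --> FF] --> H x0 p0 phi0.
Proof.
move=> hx hp hphi.
have c : {for (x0, p0, phi0), continuous F} by exact: H_continuous.
apply: (@cvg_comp _ _ _ (fun t => (x t, p t, phi t)) F FF (nbhs (x0, p0, phi0)) _ _ c).
by apply: cvg_pair_nbhs => //; apply: cvg_pair_nbhs.
Qed.

Lemma H_diff_x p phi x : differentiable (fun y => H y p phi) x.
Proof.
apply: (@differentiable_comp _ _ _ _ (fun y : 'rV[R]_d => (y, p, phi)) F); last exact: HC11.1.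
by apply: differentiable_pair => //; apply: differentiable_pair.
Qed.

Lemma H_diff_p x phi p : differentiable (fun p => H x p phi) p.
Proof.
apply: (@differentiable_comp _ _ _ _ (fun p : 'rV[R]_d => (x, p, phi)) F); last exact: HC11.1.
by apply: differentiable_pair => //; apply: differentiable_pair.
Qed.

Variables (C q : R).
Hypothesis HC : forall x p phi, `|H x p phi| + enorm (DxH H x p phi) <= C * (1 + enorm p `^ q).
Hypothesis Hae : lebesgue_ae3 (fun x p phi =>
      [/\ differentiable (fun y => DxH H y p phi) x,
          differentiable (fun y => DpH H y p phi) x,
          forall v : 'rV[R]_d, dot (v *m DxxH H x p phi) v <= 0 &
          enorm (DpxH H x p phi) <= C]).

(** The null set lives in R^(d + d + k) and [F] on a product of three spaces; [split3] passes from
    one to the other without increasing sup norms. *)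
Let split3 (z : 'rV[R]_(d + d + k)) := (lsubmx (lsubmx z), rsubmx (lsubmx z), rsubmx z).
Let join3 x p (phi : 'rV[R]_k) : 'rV[R]_(d + d + k) := row_mx (row_mx x p) phi.

Let split3K x p phi : split3 (join3 x p phi) = (x, p, phi).
Proof. by rewrite /split3 /join3 row_mxKl row_mxKr !row_mxKl row_mxKr. Qed.

Let split3_norm z z' : `|split3 z - split3 z'| <= `|z - z'|.
Proof.
have lN m n (w : 'rV[R]_(m + n)) : `|lsubmx w| <= `|w|.
  by apply: rV_norm_le => // i; rewrite mxE; exact: rV_coord_le.
have rN m n (w : 'rV[R]_(m + n)) : `|rsubmx w| <= `|w|.
  by apply: rV_norm_le => // i; rewrite mxE; exact: rV_coord_le.
rewrite /split3 /Num.norm /= !ge_max.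
apply/andP; split; first (apply/andP; split).
- change (`|lsubmx (lsubmx z) - lsubmx (lsubmx z')| <= `|z - z'|).
  by rewrite -!linearB; apply: (le_trans (lN _ _ _)); exact: lN.
- change (`|rsubmx (lsubmx z) - rsubmx (lsubmx z')| <= `|z - z'|).
  by rewrite -!linearB; apply: (le_trans (rN _ _ _)); exact: lN.
change (`|rsubmx z - rsubmx z'| <= `|z - z'|).
by rewrite -linearB; exact: rN.
Qed.

(** The i-th diagonal entry of D^2_xx H is nonpositive outside a null set, and [ae_partial_le] with
    M = 0 carries this to every segment. *)
Lemma DxH_nonincreasing x p phi i s : 0 <= s ->
  DxH H (x + s *: delta_mx 0 i) p phi 0 i <= DxH H x p phi 0 i.
Proof.
move=> s0; rewrite -subr_le0.
pose g z := 'D_(dx (delta_mx 0 i)) F (split3 z).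
have gE z : g z = DxH H (split3 z).1.1 (split3 z).1.2 (split3 z).2 0 i by rewrite DxH_coord.
pose i' : 'I_(d + d + k) := lshift k (lshift d i).
have eE : delta_mx 0 i' = join3 (delta_mx 0 i) 0 0.
  apply/rowP => j; rewrite /join3 mxE eqxx /=.
  case: (split_ordP j) => j' ->; last by rewrite row_mxEr mxE /i' eq_rlshift.
  rewrite row_mxEl; case: (split_ordP j') => j'' ->.
    by rewrite row_mxEl mxE eqxx /i' !eq_lshift.
  by rewrite row_mxEr mxE /i' eq_lshift eq_rlshift.
have split3D z h : split3 (h *: delta_mx 0 i' + z) = h *: dx (delta_mx 0 i) + split3 z.
  have e : split3 (delta_mx 0 i') = dx (delta_mx 0 i) by rewrite eE split3K.
  by rewrite -e /split3 /= !linearD /= !linearZ.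
have gL : locally_lipschitz g.
  move=> z; have [U /nbhs_normP[r /= r0 rU] UL] := HC11.2 (dx (delta_mx 0 i)) (split3 z).
  exists [set y | `|z - y| < r].
    by have /cvgr_dist_lt := @cvg_id _ (nbhs z); apply.
  move: UL => [M [Mr hM]]; exists (Num.max M 0); split => [|L]; first exact: num_real.
  rewrite gt_max => /andP[ML L0] [y y'] /= [Uy Uy'].
  apply: (@le_trans _ _ (L * `|split3 y - split3 y'|)).
    by apply: (hM L ML (split3 y, split3 y')); split => /=; apply: rU => /=;
      apply: (le_lt_trans (split3_norm _ _)).
  by rewrite ler_wpM2l // ltW.
have := @ae_partial_le R _ g _ i' 0 (join3 x p phi) s Hae s0 gL.
rewrite mul0r => main; have {main}: g (join3 x p phi + s *: delta_mx 0 i') - g (join3 x p phi) <= 0.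
  apply: main => z _ /contrapT [dD _ D2 _].
  have sl h : (fun y => DxH H y (split3 z).1.2 (split3 z).2 0 i) (h *: delta_mx 0 i + (split3 z).1.1) = g (h *: delta_mx 0 i' + z).
    by rewrite gE split3D /= !scaler0 !add0r.
  have [e1 e2] := @derive_slice R _ _ R (fun y => DxH H y (split3 z).1.2 (split3 z).2 0 i) g (delta_mx 0 i) (delta_mx 0 i') (split3 z).1.1 z sl.
  have dD' : derivable (fun y => DxH H y (split3 z).1.2 (split3 z).2) (split3 z).1.1 (delta_mx 0 i).
    exact: diff_derivable.
  have [c1 c2] := derive_coord i dD'.
  split; first exact: e2.
  rewrite -e1 c2; have := D2 (delta_mx 0 i).
  by rewrite dot_delta /DxxH mul_rV_lin1 deriveE.
have e3 : split3 (join3 x p phi + s *: delta_mx 0 i') = (x + s *: delta_mx 0 i, p, phi).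
  rewrite addrC split3D split3K [x + _]addrC.
  change ((s *: delta_mx 0 i + x, s *: 0 + p, s *: 0 + phi) = (s *: delta_mx 0 i + x, p, phi)).
  by rewrite !scaler0 !add0r.
by rewrite !gE e3 split3K.
Qed.

(** Testing the Hessian on basis vectors gives concavity along coordinate lines; being bounded, H is
    constant on them, and they join x to 0. *)
Lemma H_state_free x p phi : H x p phi = H 0 p phi.
Proof.
have step y i s : H (y + s *: delta_mx 0 i) p phi = H y p phi.
  have := @bounded_concave_const R (fun t => H (y + t *: delta_mx 0 i) p phi)
     (fun t => DxH H (y + t *: delta_mx 0 i) p phi 0 i) (C * (1 + enorm p `^ q)).
  move=> /(_ _ _ _ s); rewrite scale0r addr0; apply.
  - move=> t; rewrite mxE; apply: (@is_derive_line _ _ (fun y => H y p phi)).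
    exact: H_diff_x.
  - move=> t t' tt; rewrite -[t'](subrK t) [t' - t + t]addrC scalerDl addrA.
    by apply: DxH_nonincreasing; rewrite subr_ge0.
  - by move=> t; apply: le_trans (HC (y + t *: delta_mx 0 i) p phi); rewrite lerDl enorm_ge0.
apply/eqP; rewrite -subr_eq0 -normr_le0.
have := @coord_path_le R d (fun y => H y p phi) 0 `|x| (lexx 0) _ x 0.
rewrite mulr0 mul0r normr0; apply => //.
by move=> z i s _ _ _; rewrite step subrr normr0 mul0r.
Qed.

End hamiltonian_independent_of_state.

Lemma dot_is_linear (R : realType) n (p : 'rV[R]_n) : linear_for *%R (dot p).
Proof. by move=> a u v; rewrite dotDr dotZr. Qed.

HB.instance Definition _ (R : realType) n (p : 'rV[R]_n) :=
  GRing.isLinear.Build R 'rV[R]_n R *%R (dot p) (@dot_is_linear R n p).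

(** * Convex functions and characteristics *)

Section convex_C1.
Variables (R : realType) (d : nat).
Local Notation V := 'rV[R]_d.

(* g is the gradient of G: a continuous selection of subgradients is one. *)
Definition convex_C1 (G : V -> R) (g : V -> V) :=
  (forall y z, G y + dot (g y) (z - y) <= G z) /\ continuous g.

Implicit Types (G S : V -> R) (g s : V -> V).

Lemma convex_C1_le G g y z : convex_C1 G g -> G z <= G y + dot (g z) (z - y).
Proof.
move=> [h _]; have := h z y; rewrite -(opprB z y) dotNr; lra.
Qed.

Lemma convex_C1_mono G g y z : convex_C1 G g -> 0 <= dot (g y - g z) (y - z).
Proof.
move=> cG; have := convex_C1_le z y cG; have := cG.1 z y.
by rewrite dotBl; lra.
Qed.

(** The subgradient inequalities at x and at x + h trap the remainder between 0 and (g (x + h) - g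
    x) . h, which is o(h) by continuity of g. *)
Lemma convex_C1_diff G g x : convex_C1 G g -> differentiable G x /\ grad G x = g x.
Proof.
move=> cG.
have cd : continuous (dot (g x) : V -> R).
  by move=> y; apply: (@dot_cvg _ _ _ (nbhs y) _ (fun=> g x) id); [exact: cvg_cst|exact: cvg_id].
have e : G \o shift x = cst (G x) + dot (g x) +o_ 0 id.
  apply/eqaddoP => _ /posnumP[e].
  have c : g (h + x) @[h --> (0 : V)] --> g x.
    have c0 : h + x @[h --> (0 : V)] --> 0 + x by apply: cvgD; [exact: cvg_id|exact: cvg_cst].
    rewrite add0r in c0.
    exact: (@cvg_comp _ _ _ (fun h : V => h + x) g _ (nbhs x) _ c0 (cG.2 x)).
  have e0 : 0 < e%:num / d.+1%:R by rewrite divr_gt0.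
  have /cvgr_dist_le/(_ _ e0) := c.
  apply: filterS => h hh /=.
  rewrite !fctE /=.
  have l1 := cG.1 x (h + x); have l2 := convex_C1_le x (h + x) cG.
  rewrite addrK in l1 l2.
  rewrite ger0_norm; last by lra.
  apply: (@le_trans _ _ (dot (g (h + x) - g x) h)); first by rewrite dotBl; lra.
  apply: (le_trans (ler_norm _)); apply: (le_trans (dot_le _ _)).
  rewrite ler_wpM2r // mulrC -ler_pdivlMr // distrC //.
have de := diff_unique cd e.
have dG : differentiable G x by apply/diff_locallyP; rewrite de.
split=> //; apply/rowP => i; rewrite mxE deriveE // de /=.
exact: dot_delta.
Qed.

(** Tested at y + t w with t decreasing to 0, the two subgradient inequalities give (g y - p) . w >=
    0 for every w, in particular for -w. *)
Lemma convex_C1_subgradient_unique G g y p : convex_C1 G g ->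
  (forall z, G y + dot p (z - y) <= G z) -> p = g y.
Proof.
move=> cG h; apply/eqP; rewrite -subr_eq0 -oppr_eq0 opprB; apply/eqP.
have key w : 0 <= dot (g y - p) w.
  have c : dot (g (y + t *: w) - p) w @[t --> (0 : R)^'+] --> dot (g y - p) w.
    apply: dot_cvg; last exact: cvg_cst.
    apply: cvgB; last exact: cvg_cst.
    apply: cvg_at_right_filter.
    have c0 : y + t *: w @[t --> (0 : R)] --> y + 0 *: w.
      by apply: cvgD; [exact: cvg_cst|apply: cvgZr_tmp; exact: cvg_id].
    rewrite scale0r addr0 in c0; exact: (@cvg_comp _ _ _ (fun t : R => y + t *: w) g _ (nbhs y) _ c0 (cG.2 y)).
  apply: (cvgr_to_ge c); near=> t.
  have t0 : 0 < t by near: t; exact: nbhs_right_gt.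
  have l1 := h (y + t *: w); have l2 := convex_C1_le y (y + t *: w) cG.
  rewrite addrAC subrr add0r !dotZr in l1 l2.
  have : 0 <= t * dot (g (y + t *: w) - p) w by rewrite dotBl mulrBr; lra.
  by rewrite pmulr_rge0.
apply: dot_eq0 => w; apply/eqP; rewrite eq_le key andbT.
by have := key (- w); rewrite dotNr oppr_ge0.
Unshelve. all: by end_near. Qed.

(** Monotonicity of s gives (y - z) . (g z - g y) >= 0 and that of g the reverse. Equality makes g z
    a subgradient of G at y, so g z = g y by differentiability, and then y = z. *)
Lemma char_unique G g s y z : convex_C1 G g ->
  (forall p p', 0 <= dot (s p - s p') (p - p')) ->
  y + s (g y) = z + s (g z) -> y = z.
Proof.
move=> cG sm e.
have e1 : y - z = s (g z) - s (g y).
  by apply/eqP; rewrite subr_eq addrAC eq_sym subr_eq addrC e addrC.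
have m1 := sm (g z) (g y); rewrite -e1 in m1.
have gE : g z = g y.
  apply: (convex_C1_subgradient_unique cG) => w.
  have l1 := cG.1 z w; have l2 := cG.1 y z.
  have l3 : dot (g z) (w - z) = dot (g z) (w - y) + dot (g z) (y - z).
    by rewrite -dotDr addrA subrK.
  have l4 : dot (y - z) (g z - g y) = dot (g z) (y - z) + dot (g y) (z - y).
    by rewrite dotC dotBl -(opprB y z) dotNr.
  lra.
by apply: (addIr (s (g y))); rewrite e gE.
Qed.

Lemma coord_norm_dot (p : V) (r M : R) : 0 <= r -> 0 <= M ->
  (forall z, `|z| <= r -> dot p z <= M) -> r * `|p| <= M.
Proof.
move=> r0 M0 h; case: (ltgtP r 0) => [|r0'|->]; [by rewrite ltNge r0| |by rewrite mul0r].
rewrite mulrC -ler_pdivlMr //; apply: rV_norm_le => [|i]; first by rewrite divr_ge0.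
rewrite ler_pdivlMr //.
have nd a : `|a| <= r -> `|a *: delta_mx 0 i : V| <= r.
  move=> ar; rewrite normrZ (le_trans _ ar) // ler_piMr //.
  by apply: rV_norm_le => // j; rewrite mxE; case: (_ && _); rewrite ?normr1 ?normr0.
have h1 := h _ (nd r (ltac:(by rewrite ger0_norm))).
have h2 := h _ (nd (- r) (ltac:(by rewrite normrN ger0_norm))).
rewrite !dotZr !dot_delta in h1 h2.
by rewrite -(ger0_norm r0) -normrM ler_norml; lra.
Qed.

(** The dual problem: maximise x . p - a - S p over the epigraph [E] of the convex conjugate of G. G
    is bounded above on balls, so the conjugate outgrows linear functions and the maximum is
    attained. Optimality at (p, a) says that y = x - s p is a subgradient of the conjugate at p,
    that is, p = g y. *)
Lemma char_exists G g S s x : convex_C1 G g -> convex_C1 S s -> exists y, y + s (g y) = x.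
Proof.
move=> cG cS.
have Gcont : continuous G by move=> z; apply: differentiable_continuous; exact: (convex_C1_diff z cG).1.
have Scont : continuous S by move=> z; apply: differentiable_continuous; exact: (convex_C1_diff z cS).1.
pose E : set (V * R) := [set w | forall z, dot w.1 z - G z <= w.2].
pose J (w : V * R) := dot x w.1 - w.2 - S w.1.
have Jcont : continuous J.
  move=> w; apply: cvgB; first apply: cvgB.
  - apply: dot_cvg; [exact: cvg_cst|exact: cvg_fst].
  - exact: cvg_snd.
  by apply: cvg_comp; [exact: cvg_fst|exact: Scont].
have gE y : E (g y, dot (g y) y - G y).
  by move=> z /=; have := cG.1 y z; rewrite dotBr; lra.
(* The conjugate is at least r |p| - M; this r beats the slopes of x . p and of -S p with one |p| to
   spare. *)
pose r := d.+1%:R * (`|x| + `|s 0|) + 1.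
have r0 : 0 <= r by rewrite addr_ge0 // mulr_ge0 // addr_ge0.
have [M GM] : exists M, forall z, `|z| <= r -> G z <= M.
  have [|||c _ hc] := @compact_EVT_max V R G [set z : V | `|z| <= r].
  - by exists 0; rewrite /= normr0.
  - exact: rV_ball_compact.
  - exact: continuous_subspaceT.
  by exists (G c) => z zr; apply: hc; rewrite inE.
have EP w : E w -> r * `|w.1| <= w.2 + M.
  move=> Ew; apply: coord_norm_dot => // [|z zr].
    have := Ew 0; have := GM 0; rewrite dot0r normr0 => /(_ r0); lra.
  by have := Ew z; have := GM z zr; lra.
pose e0 := (g 0, dot (g 0) 0 - G 0); pose j0 := J e0.
have JP w : E w -> J w <= M - `|w.1| - S 0 /\ w.2 <= (r - 1) * `|w.1| - S 0 - J w.
  move=> /EP h; have := cS.1 0 w.1; rewrite subr0 => l1.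
  have l2 := le_trans (ler_norm _) (dot_le x w.1).
  have l3 := le_trans (ler_norm _) (dot_le (- s 0) w.1).
  have l4 : dot (- s 0) w.1 = - dot (s 0) w.1 by rewrite -scaleN1r dotZl mulN1r.
  rewrite l4 normrN in l3.
  have l5 : r * `|w.1| = d.+1%:R * `|x| * `|w.1| + d.+1%:R * `|s 0| * `|w.1| + `|w.1|.
    by rewrite /r; ring.
  by rewrite /J mulrBl mul1r; split; lra.
pose P := Num.max 0 (M - S 0 - j0).
pose A := Num.max `|G 0| `|r * P + `|S 0| + `|j0| |.
pose K := E `&` ([set p | `|p| <= P] `*` `[- A, A]%classic).
have KJ w : E w -> j0 <= J w -> K w.
  move=> Ew jw; have [h1 h2] := JP w Ew; split => //.
  have wP : `|w.1| <= P by rewrite le_max; apply/orP; right; lra.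
  split => //=; rewrite in_itv /=; apply/andP; split.
    have := Ew 0; rewrite dot0r add0r; apply: le_trans.
    rewrite lerN2 le_max; apply/orP; left; exact: ler_norm.
  rewrite le_max; apply/orP; right; apply: le_trans (ler_norm _).
  have h3 : r * `|w.1| <= r * P by rewrite ler_wpM2l.
  have h4 := ler_norm (- S 0); have h5 := ler_norm (- j0); rewrite !normrN in h4 h5.
  have h6 := normr_ge0 w.1.
  rewrite mulrBl mul1r in h2; lra.
have cE : closed E.
  rewrite (_ : E = \bigcap_(z in setT) ((fun w : V * R => dot w.1 z - G z - w.2) @^-1` [set t | t <= 0])); last first.
    apply/seteqP; split => [w Ew z _ /=|w h z]; first by rewrite subr_le0.
    by have /= := h z I; rewrite subr_le0.
  apply: closed_bigI => z _; apply: preimage_closed; last exact: closed_le.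
  move=> w _; apply: cvgB; last exact: cvg_snd.
  by apply: cvgB; [apply: dot_cvg; [exact: cvg_fst|exact: cvg_cst]|exact: cvg_cst].
have cK : compact K.
  apply: (@subclosed_compact _ _ ([set p | `|p| <= P] `*` `[- A, A]%classic)).
  - apply: closedI => //.
    apply: compact_closed; first exact: norm_hausdorff.
    by apply: compact_setX; [exact: rV_ball_compact|exact: segment_compact].
  - by apply: compact_setX; [exact: rV_ball_compact|exact: segment_compact].
  - by move=> w [].
have [|||w wK wmax] := @compact_EVT_max _ R J K.
- by exists e0; apply: KJ; [exact: gE|].
- exact: cK.
- exact: continuous_subspaceT.
have {wK}Ew : E w by move: wK; rewrite inE => -[].
have jw : j0 <= J w by apply: wmax; rewrite inE; apply: KJ; [exact: gE|].
have {}wmax w' : E w' -> J w' <= J w.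
  move=> Ew'; case: (leP j0 (J w')) => h; first by apply: wmax; rewrite inE; exact: KJ.
  by rewrite (le_trans (ltW h)).
case: w Ew jw wmax => p a Ew _ wmax.
pose y := x - s p.
(* First-order optimality along the segment to (p', a'), which stays in the convex set [E]. *)
have fo p' a' : E (p', a') -> dot y (p' - p) <= a' - a.
  move=> Ew'; rewrite /y dotBl lerBlDr -lerBlDl.
  have c : dot (s (p + t *: (p' - p))) (p' - p) @[t --> (0 : R)^'+] --> dot (s p) (p' - p).
    apply: dot_cvg; last exact: cvg_cst.
    apply: cvg_at_right_filter.
    have c0 : p + t *: (p' - p) @[t --> (0 : R)] --> p + 0 *: (p' - p).
      by apply: cvgD; [exact: cvg_cst|apply: cvgZr_tmp; exact: cvg_id].
    rewrite scale0r addr0 in c0; exact: (@cvg_comp _ _ _ (fun t : R => p + t *: (p' - p)) s _ (nbhs p) _ c0 (cS.2 p)).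
  apply: (cvgr_to_ge c); near=> t.
  have t0 : 0 < t by near: t; exact: nbhs_right_gt.
  have t1 : t <= 1 by near: t; exact: nbhs_right_le.
  have Et : E (p + t *: (p' - p), a + t * (a' - a)).
    move=> z /=; have h1 := Ew z; have h2 := Ew' z; rewrite /= in h1 h2.
    rewrite dotDl dotZl dotBl.
    have := ler_wpM2l (ltW t0) h2; have := ler_wpM2l (_ : 0 <= 1 - t) h1.
    rewrite subr_ge0 => /(_ t1); rewrite !mulrBr !mulrBl !mul1r; lra.
  have := wmax _ Et; rewrite /J /= dotDr dotZr.
  have := convex_C1_le p (p + t *: (p' - p)) cS; rewrite addrAC subrr add0r dotZr.
  move=> h1 h2.
  have : 0 <= t * (dot (s (p + t *: (p' - p))) (p' - p) - (dot x (p' - p) - (a' - a))).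
    by rewrite !mulrBr; lra.
  by rewrite pmulr_rge0 // subr_ge0.
have ay : a + G y <= dot p y.
  have := fo _ _ (gE y); rewrite dotBr (dotC y (g y)) (dotC y p); lra.
have pE : p = g y.
  apply: (convex_C1_subgradient_unique cG) => z.
  by have /= := Ew z; rewrite dotBr; lra.
by exists y; rewrite -pE /y subrK.
Unshelve. all: by end_near. Qed.

End convex_C1.

Lemma cvg_pair_filter (T U V : Type) (F : set_system T) (G : set_system U) (H : set_system V)
    {FF : Filter F} {GG : Filter G} {HH : Filter H} (f : T -> U) (g : T -> V) :
  f @ F `=>` G -> g @ F `=>` H -> (fun t => (f t, g t)) @ F `=>` filter_prod G H.
Proof. exact: cvg_pair. Qed.

(** * Bounds and stability of characteristics *)

Section characteristics.
Variables (R : realType) (d : nat).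
Local Notation V := 'rV[R]_d.

(* A priori bound: the growth of G from above makes its conjugate coercive,
   which turns (g y - g 0) . (x - s (g y)) into an upper bound for |g y|. *)
Lemma char_bound (C B q q' : R) : 0 <= C -> 0 <= B -> 1 < q -> q' = q / (q - 1) ->
  exists2 K, 0 < K & forall (G : V -> R) (g s : V -> V) (x y : V),
    convex_C1 G g -> (forall p p', 0 <= dot (s p - s p') (p - p')) ->
    (forall z, `|G z| <= C * (1 + `|z| `^ q')) -> `|g 0| <= C ->
    (forall p, `|s p| <= B * (1 + `|p| `^ (q - 1))) ->
    y + s (g y) = x ->
    `|g y| `^ (q - 1) <= K * (1 + `|x|) /\ `|y| <= K * (1 + `|x|).
Proof.
move=> C0 B0 q1 q'E.
have q10 : 0 < q - 1 by rewrite subr_gt0.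
have q10' : q - 1 != 0 by rewrite gt_eqF.
have q'1 : (q' - 1) * (q - 1) = 1 by rewrite q'E; field.
have q'1' : 0 < q' - 1 by rewrite -(pmulr_lgt0 _ q10) q'1.
pose n : R := d.+1%:R.
have n0 : 0 < n by rewrite ltr0n.
have n1 : 1 <= n by rewrite ler1n.
pose b := B * (1 + C `^ (q - 1)).
have b0 : 0 <= b by rewrite mulr_ge0 // addr_ge0 // powR_ge0.
pose K1 := (7 * C) `^ (q - 1) * (2 * n * (b + 1)).
have K10 : 0 <= K1 by rewrite mulr_ge0 ?powR_ge0 // !mulr_ge0 ?addr_ge0 // ltW.
exists (K1 + 1 + B * (1 + K1)).
  by rewrite ltr_pwDl ?ltr_pwDr // mulr_ge0 // addr_ge0.
move=> G g s x y cG sm GC gC sB e.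
(* The radius on which the growth of G is tested, chosen so that n (|p| + C) (|x| + b) is at most
   half of si (|p| + C). *)
pose si := 2 * n * (`|x| + b + 1).
have si1 : 1 <= si.
  rewrite /si -mulrA -[leLHS]mulr1 ler_pM // ?ler1n //.
  by rewrite -[leLHS]mul1r ler_pM // lerDr addr_ge0.
have si0 : 0 < si by exact: lt_le_trans si1.
pose p := g y; pose p0 := g 0.
have sp0 : `|s p0| <= b.
  apply: (le_trans (sB _)); rewrite ler_wpM2l // lerD2l.
  by apply: powR_le; [exact: ltW|rewrite normr_ge0].
have low : si * `|p| <= dot p y - G y + C * (1 + si `^ q').
  apply: coord_norm_dot => [||z zs]; first exact: ltW.
    have := cG.1 y 0; rewrite sub0r dotNr -/p => h1.
    have h2 : G 0 <= C * (1 + si `^ q').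
      apply: (le_trans (ler_norm _)); apply: (le_trans (GC _)).
      rewrite ler_wpM2l // lerD2l normr0 powR0 ?powR_ge0 //.
      by rewrite gt_eqF // -[q'](subrK 1) addr_gt0.
    lra.
  have := cG.1 y z; rewrite dotBr -/p => h1.
  have h2 : G z <= C * (1 + si `^ q').
    apply: (le_trans (ler_norm _)); apply: (le_trans (GC _)).
    rewrite ler_wpM2l // lerD2l; apply: powR_le; last by rewrite normr_ge0.
    by rewrite -[q'](subrK 1) addr_ge0 // ltW.
  lra.
have G0C : - C <= G 0.
  have := GC 0; rewrite normr0 powR0 ?addr0 ?mulr1; last by rewrite gt_eqF // -[q'](subrK 1) addr_gt0.
  by rewrite ler_norml => /andP[].
have up : dot (p - p0) y <= n * (`|p| + C) * (`|x| + b).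
  have yE : y = x - s p0 - (s p - s p0).
    by rewrite -e -/p opprB addrA subrK addrK.
  rewrite [in leLHS]yE dotBr.
  have := sm p p0; rewrite dotC => h1.
  apply: (@le_trans _ _ (dot (p - p0) (x - s p0))); first by lra.
  apply: (le_trans (ler_norm _)); apply: (le_trans (dot_le _ _)).
  rewrite -/n; apply: ler_pM => //; first by rewrite mulr_ge0 // ltW.
    rewrite (ler_wpM2l (ltW n0)) //.
    by apply: (le_trans (ler_normB _ _)); rewrite lerD2l.
  by apply: (le_trans (ler_normB _ _)); rewrite lerD2l.
have half : n * (`|p| + C) * (`|x| + b) <= si / 2 * (`|p| + C).
  rewrite -mulrA mulrCA mulrC ler_wpM2r ?addr_ge0 //.
  have -> : si / 2 = n * (`|x| + b + 1) by rewrite /si; field.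
  by rewrite ler_wpM2l ?lerDl // ltW.
have G1 := cG.1 0 y; rewrite subr0 -/p0 in G1.
have siq : si `^ q' = si * si `^ (q' - 1) by rewrite mulr_powRB1 ?ltW // -[q'](subrK 1) addr_gt0.
have s1 : 1 <= si `^ (q' - 1).
  by rewrite -[leLHS](powRr0 si) ler_powR // ltW.
(* After si |p| / 2 is absorbed, the right side is C si / 2 + 2 C + C si^q', at most 7/2 of C si^q';
   doubling gives 7. *)
have main : si * `|p| <= si * (7 * C * si `^ (q' - 1)).
  rewrite siq in low.
  have h1 : C <= C * (si * si `^ (q' - 1)) by rewrite ler_peMr // -[leLHS]mulr1 ler_pM.
  have h2 : si * C <= C * (si * si `^ (q' - 1)).
    by rewrite mulrC ler_wpM2l // ler_peMr // ltW.
  have h3 : dot (p - p0) y = dot p y - dot p0 y by rewrite dotBl.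
  have h4 : si / 2 * (`|p| + C) = si * `|p| / 2 + si * C / 2 by field.
  have -> : si * (7 * C * si `^ (q' - 1)) = 7 * (C * (si * si `^ (q' - 1))) by ring.
  have h5 : C * (1 + si * si `^ (q' - 1)) = C + C * (si * si `^ (q' - 1)) by ring.
  rewrite h3 in up; rewrite h4 in half; rewrite h5 in low.
  have h6 := le_trans up half.
  lra.
have pb : `|p| <= 7 * C * si `^ (q' - 1) by rewrite -(ler_pM2l si0).
(* Since (q' - 1) (q - 1) = 1, the bound on |p| turns into one on |p|^(q - 1) that is linear in
   |x|. *)
have pq : `|p| `^ (q - 1) <= K1 * (1 + `|x|).
  apply: (@le_trans _ _ ((7 * C * si `^ (q' - 1)) `^ (q - 1))).
    by apply: powR_le; [exact: ltW|rewrite normr_ge0].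
  rewrite powRM ?powR_ge0 ?mulr_ge0 // -powRrM q'1 powRr1; last exact: ltW.
  rewrite /K1 -mulrA; apply: ler_wpM2l; first exact: powR_ge0.
  rewrite /si -[leRHS]mulrA; apply: ler_wpM2l; first by rewrite mulr_ge0 // ltW.
  have : 0 <= b * `|x| by rewrite mulr_ge0.
  by rewrite mulrDr mulrDl mulr1; lra.
have K1K : K1 <= K1 + 1 + B * (1 + K1).
  by rewrite -addrA lerDl addr_ge0 // mulr_ge0 // addr_ge0.
split; first by apply: (le_trans pq); rewrite ler_wpM2r // addr_ge0.
have -> : y = x - s p by rewrite -e addrK.
apply: (le_trans (ler_normB _ _)).
have h1 := sB p.
have h2 : B * (1 + `|p| `^ (q - 1)) <= B * (1 + K1 * (1 + `|x|)) by rewrite ler_wpM2l // lerD2l.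
have h3 : 0 <= B * `|x| by rewrite mulr_ge0.
have h4 : 0 <= K1 * (1 + `|x|) by rewrite mulr_ge0 // addr_ge0.
have h5 : (K1 + 1 + B * (1 + K1)) * (1 + `|x|) = K1 * (1 + `|x|) + 1 + `|x| + B * (1 + K1 * (1 + `|x|)) + B * `|x|.
  by ring.
lra.
Qed.

(** Off a neighbourhood of y, every point of the ball violates the limit equation, hence also the
    i-th equation for i far in the filter, uniformly by compactness; so yi must enter the
    neighbourhood. This works along any filter. *)
Lemma char_stable (I : Type) (F : set_system I) {FF : Filter F}
    (gi si : I -> V -> V) (xi yi : I -> V) (g s : V -> V) (x y : V) (M : R) :
  (forall y0, gi z.1 z.2 @[z --> (F, nbhs y0)] --> g y0) ->
  (forall p0, si z.1 z.2 @[z --> (F, nbhs p0)] --> s p0) ->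
  xi i @[i --> F] --> x ->
  (\forall i \near F, yi i + si i (gi i (yi i)) = xi i) ->
  (\forall i \near F, `|yi i| <= M) ->
  (forall y', y' + s (g y') = x -> y' = y) ->
  yi i @[i --> F] --> y.
Proof.
move=> hg hs hx heq hM huniq U Uy.
have [U' [oU' U'y U'U]] : exists U', [/\ open U', U' y & U' `<=` U].
  by have := Uy; rewrite nbhsE => -[U' [oU' U'y] sub]; exists U'.
pose K := [set z : V | `|z| <= M] `&` ~` U'.
have cK : compact K.
  apply: (@subclosed_compact _ _ [set z : V | `|z| <= M]).
  - apply: closedI; last exact: open_closedC.
    by apply: compact_closed; [exact: norm_hausdorff|exact: rV_ball_compact].
  - exact: rV_ball_compact.
  - by move=> z [].
move/compact_near_coveringP : cK => /(_ I F (fun i z => z + si i (gi i z) <> xi i) FF) cov.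
have {}cov : \forall i \near F, K `<=` (fun z => z + si i (gi i z) <> xi i).
  apply: cov => y0 [_ y0U].
  have ne : y0 + s (g y0) != x.
    by apply/eqP => /huniq e; apply: y0U; rewrite e.
  have c1 : gi z.2 z.1 @[z --> (nbhs y0, F)] --> g y0.
    apply: (@cvg_comp _ _ _ (fun z : V * I => (z.2, z.1)) (fun z : I * V => gi z.1 z.2) (filter_prod (nbhs y0) F) (filter_prod F (nbhs y0))).
      by apply: cvg_pair_filter; [exact: cvg_snd|exact: cvg_fst].
    exact: hg.
  have c2 : si z.2 (gi z.2 z.1) @[z --> (nbhs y0, F)] --> s (g y0).
    apply: (@cvg_comp _ _ _ (fun z : V * I => (z.2, gi z.2 z.1)) (fun z : I * V => si z.1 z.2) (filter_prod (nbhs y0) F) (filter_prod F (nbhs (g y0)))).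
      by apply: cvg_pair_filter; [exact: cvg_snd|exact: c1].
    exact: hs.
  have c3 : z.1 + si z.2 (gi z.2 z.1) - xi z.2 @[z --> (nbhs y0, F)] --> y0 + s (g y0) - x.
    apply: cvgB; first apply: cvgD.
    - exact: cvg_fst.
    - exact: c2.
    apply: (@cvg_comp _ _ _ (snd : V * I -> I) xi _ F); [exact: cvg_snd|exact: hx].
  have ne0 : 0 < `|y0 + s (g y0) - x| by rewrite normr_gt0 subr_eq0.
  have /cvgr_dist_lt/(_ _ ne0) := c3.
  apply: filterS => -[z i] /= hz e.
  by move: hz; rewrite e subrr subr0 ltxx.
have : \forall i \near F, U (yi i).
  apply: filterS3 cov heq hM => i h1 h2 h3.
  apply: U'U; apply: contrapT => nU.
  exact: (h1 (yi i) (conj h3 nU) h2).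
exact.
Qed.

End characteristics.

(** Each component of the gradient, with either sign, is subject to [ae_partial_le]. L is the same
    for all G with the given constants, hence for the whole family G(., m). *)
Lemma grad_lipschitz (R : realType) (d : nat) (C q' r : R) : 0 <= C -> 0 <= q' -> 0 <= r ->
  exists2 L, 0 <= L & forall G : 'rV[R]_d -> R, C11 G ->
  lebesgue_ae (fun x => differentiable (grad G) x /\
      enorm ('J (grad G) x) <= C * (1 + enorm x) `^ (q' - 2)) ->
  forall y y', `|y| <= r -> `|y'| <= r -> `|grad G y - grad G y'| <= L * `|y - y'|.
Proof.
move=> C0 q'0 r0.
(* A segment in the ball has length s <= 2 r, so |z| + s + 1 <= 3 r + 1. The exponent q' replaces q'
   - 2, which may be negative. *)
pose M := C * (1 + d.+1%:R * (3 * r + 1)) `^ q'.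
have M0 : 0 <= M by rewrite mulr_ge0 // powR_ge0.
exists (d%:R * M); first by rewrite mulr_ge0.
move=> G [dG gL] ae y y' yr y'r.
have dM0 : 0 <= d%:R * M by rewrite mulr_ge0.
apply: rV_norm_le => [|j]; first exact: mulr_ge0.
pose g x := grad G x 0 j.
have gE : g = 'D_(delta_mx 0 j) G by apply/funext => x; rewrite /g mxE.
have gLip : locally_lipschitz g by rewrite gE => x; exact: gL.
have gLipN : locally_lipschitz (fun x => - g x).
  move=> x; have [U Ux UL] := gLip x; exists U => //.
  move: UL => [L [Lr hL]]; exists L; split => // L' LL' z /= zU.
  by rewrite -opprD normrN; exact: hL.
have -> : (grad G y - grad G y') 0 j = g y - g y' by rewrite /g mxE [X in _ + X]mxE.
apply: (@coord_path_le R d g M r) => // z i s s0 zr zsr.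
have sr : s <= 2 * r.
  have := rV_coord_le (z + s *: delta_mx 0 i - z) i.
  rewrite addrAC subrr add0r !mxE !eqxx mulr1 (ger0_norm s0) => h.
  rewrite (le_trans h) // -[s *: _](addKr z) (le_trans (ler_normD _ _)) // normrN mulrDl mul1r.
  by rewrite lerD.
have bound x : `|x| <= `|z| + s + 1 -> ~ ~ (differentiable (grad G) x /\
      enorm ('J (grad G) x) <= C * (1 + enorm x) `^ (q' - 2)) ->
    derivable g x (delta_mx 0 i) /\ `|'D_(delta_mx 0 i) g x| <= M.
  move=> xr /contrapT[dx Jx].
  have dx' : derivable (grad G) x (delta_mx 0 i) by exact: diff_derivable.
  have [c1 c2] := derive_coord j dx'.
  split=> //; rewrite c2 deriveE // -mul_rV_lin1 -rowE mxE.
  apply: (le_trans (enorm_coord _ _ _)); apply: (le_trans Jx).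
  rewrite /M ler_wpM2l //.
  have x1 : 1 <= 1 + enorm x by rewrite lerDl enorm_ge0.
  apply: (@le_trans _ _ ((1 + enorm x) `^ q')).
    by rewrite ler_powR // gerBl.
  apply: powR_le => //; rewrite (le_trans _ x1) //= lerD2l.
  apply: (le_trans (enorm_le_norm x)); rewrite ler_wpM2l //.
  by apply: (le_trans xr); rewrite lerD2r; lra.
have h1 := @ae_partial_le R d g _ i M z s ae s0 gLip _.
have h2 := @ae_partial_le R d (fun x => - g x) _ i M z s ae s0 gLipN _.
have h3 : - g (z + s *: delta_mx 0 i) - - g z <= M * s.
  apply: h2 => x xr nx; have [b1 b2] := bound x xr nx.
  split; first exact: derivableN.
  by rewrite deriveN // (le_trans (ler_norm _)) // normrN.
rewrite ler_norml; apply/andP; split; first by lra.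
apply: h1 => x xr nx; have [b1 b2] := bound x xr nx.
by split => //; exact: le_trans (ler_norm _) b2.
Qed.

(** * Integrals in time *)

Section time_integrals.
Variable R : realType.

Definition int (f : R -> R) (a b : R) : R := \int[lebesgue_measure]_(t in `[a, b]) f t.

Implicit Types (f g : R -> R).

Lemma int_integrable f a b : continuous f ->
  (@lebesgue_measure R).-integrable `[a, b] (EFin \o f).
Proof.
move=> cf; apply: continuous_compact_integrable; first exact: segment_compact.
exact: continuous_subspaceT.
Qed.

Lemma int_split f a b c : continuous f -> a <= b <= c -> int f a c = int f a b + int f b c.
Proof.
move=> cf /andP[ab bc].
have := @Rintegral_itvB R f (BLeft a) (BRight c) b (int_integrable a c cf).
rewrite !bnd_simp ab bc => /(_ isT isT) /eqP; rewrite subr_eq => /eqP.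
rewrite /int => ->; rewrite addrC; congr (_ + _).
apply: Rintegral_itv_obnd_cbnd.
apply: (integrableS _ _ _ (@int_integrable f b c cf)); [exact: measurable_itv|exact: measurable_itv|].
by move=> t /=; rewrite !in_itv /= => /andP[/ltW -> ->].
Qed.

Lemma int_cst (c a b : R) : a <= b -> int (fun=> c) a b = c * (b - a).
Proof.
move=> ab; rewrite /int Rintegral_cst; last exact: measurable_itv.
by congr (_ * _); exact: (congr1 fine (lebesgue_itvcc ab)).
Qed.

Lemma int_le f g a b : continuous f -> continuous g ->
  (forall t, a <= t <= b -> f t <= g t) -> int f a b <= int g a b.
Proof.
move=> cf cg fg; apply: le_Rintegral; [exact: measurable_itv|exact: int_integrable|exact: int_integrable|].
by move=> t /=; rewrite in_itv /=; exact: fg.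
Qed.

Lemma intD f g a b : continuous f -> continuous g ->
  int (fun t => f t + g t) a b = int f a b + int g a b.
Proof. by move=> cf cg; apply: RintegralD; [exact: measurable_itv|exact: int_integrable|exact: int_integrable]. Qed.

Lemma intB f g a b : continuous f -> continuous g ->
  int (fun t => f t - g t) a b = int f a b - int g a b.
Proof. by move=> cf cg; apply: RintegralB; [exact: measurable_itv|exact: int_integrable|exact: int_integrable]. Qed.

Lemma intZ f k a b : continuous f -> int (fun t => f t * k) a b = int f a b * k.
Proof. by move=> cf; apply: RintegralZr; [exact: measurable_itv|exact: int_integrable]. Qed.

Lemma int_near f c e a b : continuous f -> a <= b ->
  (forall t, a <= t <= b -> `|f t - c| <= e) -> `|int f a b - c * (b - a)| <= e * (b - a).
Proof.
move=> cf ab h.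
have cc (k : R) : continuous (fun _ : R => k) by move=> x; exact: cvg_cst.
rewrite -!int_cst // -intB // ler_norml; apply/andP; split.
  have -> : - int (fun=> e) a b = int (fun=> - e) a b by rewrite !int_cst // mulNr.
  apply: int_le => //; first by move=> x; apply: cvgB; [exact: cf|exact: cvg_cst].
  by move=> t /h; rewrite ler_norml => /andP[].
apply: int_le => //; first by move=> x; apply: cvgB; [exact: cf|exact: cvg_cst].
by move=> t /h; rewrite ler_norml => /andP[].
Qed.

Lemma int_dot n (f : R -> 'rV[R]_n) (w : 'rV[R]_n) a b : continuous f ->
  int (fun t => dot (f t) w) a b = dot (\row_i int (fun t => f t 0 i) a b) w.
Proof.
move=> cf; rewrite /dot.
have cfi i : continuous (fun t => f t 0 i) by move=> t; apply: cvg_coord; exact: cf.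
have cfw i : continuous (fun t => f t 0 i * w 0 i).
  by move=> t; apply: cvgM; [exact: cfi|exact: cvg_cst].
transitivity (\sum_i int (fun t => f t 0 i * w 0 i) a b); last first.
  by apply: eq_bigr => i _; rewrite intZ // mxE.
elim: (index_enum _) => [|i r IH].
  rewrite big_nil; under eq_fun do rewrite big_nil.
  by rewrite /int Rintegral_cst ?mul0r //; exact: measurable_itv.
rewrite big_cons -IH -intD //.
  by congr int; apply/funext => t; rewrite big_cons.
by move=> t; apply: cvg_big => [|j _]; [exact: add_continuous|exact: cfw].
Qed.

Definition vint n (f : R -> 'rV[R]_n) (a b : R) : 'rV[R]_n := \row_i int (fun t => f t 0 i) a b.

Lemma vint_split n (f : R -> 'rV[R]_n) a b c : continuous f -> a <= b <= c ->
  vint f a c = vint f a b + vint f b c.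
Proof.
move=> cf abc; apply/rowP => i; rewrite !mxE; apply: int_split => //.
by move=> t; apply: cvg_coord; exact: cf.
Qed.

Lemma vint_near n (f : R -> 'rV[R]_n) c e a b : continuous f -> a <= b -> 0 <= e ->
  (forall t, a <= t <= b -> `|f t - c| <= e) -> `|vint f a b - (b - a) *: c| <= e * (b - a).
Proof.
move=> cf ab e0 h; apply: rV_norm_le => [|i]; first by rewrite mulr_ge0 // subr_ge0.
rewrite !mxE [_ * c _ _]mulrC; apply: int_near => //.
  by move=> t; apply: cvg_coord; exact: cf.
move=> t /h; apply: le_trans.
by have := rV_coord_le (f t - c) i; rewrite !mxE.
Qed.

Lemma vint_dist n (f g : R -> 'rV[R]_n) e a b : continuous f -> continuous g -> a <= b -> 0 <= e ->
  (forall t, a <= t <= b -> `|f t - g t| <= e) -> `|vint f a b - vint g a b| <= e * (b - a).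
Proof.
move=> cf cg ab e0 h.
have cfi i : continuous (fun t => f t 0 i) by move=> t; apply: cvg_coord; exact: cf.
have cgi i : continuous (fun t => g t 0 i) by move=> t; apply: cvg_coord; exact: cg.
apply: rV_norm_le => [|i]; first by rewrite mulr_ge0 // subr_ge0.
rewrite !mxE -intB // -[X in `|X|]subr0 -(mul0r (b - a)); apply: int_near => //.
  by move=> t; apply: cvgB; [exact: cfi|exact: cgi].
move=> t /h; rewrite subr0; apply: le_trans.
by have := rV_coord_le (f t - g t) i; rewrite !mxE.
Qed.

Lemma vint_self n (f : R -> 'rV[R]_n) a : vint f a a = 0.
Proof. by apply/rowP => i; rewrite !mxE /int set_itv1 Rintegral_set1. Qed.

End time_integrals.

(** * Measurability of continuous maps *)

Section borel.
Variable R : realType.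

Lemma measurable_open n (U : set 'rV[R]_n) : open U -> measurable U.
Proof. exact: sub_sigma_algebra. Qed.

Lemma continuous_measurable n (f : 'rV[R]_n -> R) : continuous f -> measurable_fun setT f.
Proof.
move=> cf; apply: (measurability (@RGenOInfty.G R) (@RGenOInfty.measurableE R)) => _ [_ [x ->] <-].
rewrite setTI; apply: measurable_open; move/continuousP: cf; apply.
by rewrite set_itvE; exact: open_gt.
Qed.

Lemma continuous_measurable_rV n p (f : 'rV[R]_n -> 'rV[R]_p) : continuous f -> measurable_fun setT f.
Proof.
move=> cf; apply: (measurability (@open 'rV[R]_p) erefl) => _ [U oU <-].
by rewrite setTI; apply: measurable_open; move/continuousP: cf; apply.
Qed.

Lemma coord_continuous_rV n (i : 'I_n) : continuous (fun x : 'rV[R]_n => x 0 i).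
Proof. by move=> x; apply: cvg_coord; exact: cvg_id. Qed.

Lemma enorm_continuous n : continuous (@enorm R 1 n).
Proof.
move=> x; rewrite /enorm; apply: (@cvg_comp _ _ _ _ Num.sqrt (nbhs x) (nbhs (\sum_i \sum_j x i j ^+ 2))); last exact: sqrt_continuous.
apply: cvg_big => [|i _]; first exact: add_continuous.
apply: cvg_big => [|j _]; first exact: add_continuous.
by rewrite !ord1; apply: cvgM; exact: coord_continuous_rV.
Qed.

Lemma measurable_enormB n s :
  measurable_fun setT (fun z : 'rV[R]_n * 'rV[R]_n => (enorm (z.1 - z.2) `^ s)%:E).
Proof.
apply/measurable_EFinP; apply: (measurableT_comp (@measurable_powR R s)).
apply: (measurableT_comp (continuous_measurable_fun (@sqrt_continuous R))).
have -> : (fun z : 'rV[R]_n * 'rV[R]_n => \sum_i \sum_j (z.1 - z.2) i j ^+ 2) =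
   (fun z => \sum_(j <- index_enum 'I_n) (z.1 0 j - z.2 0 j) ^+ 2).
  by apply/funext => z; rewrite big_ord1; apply: eq_bigr => j _; rewrite !mxE.
apply: measurable_sum => j; apply: (@measurable_funX _ _ _ _ _ 2).
have m1 : measurable_fun setT (fun x : 'rV[R]_n => x 0 j) by apply: continuous_measurable; exact: coord_continuous_rV.
apply: measurable_funB.
  by have := measurableT_comp m1 (@measurable_fst _ _ 'rV[R]_n 'rV[R]_n); rewrite /comp; exact.
by have := measurableT_comp m1 (@measurable_snd _ _ 'rV[R]_n 'rV[R]_n); rewrite /comp; exact.
Qed.

End borel.

Lemma powR_to0 (R : realType) (I : Type) (F : set_system I) {FF : Filter F} (u : I -> R) s :
  0 < s -> (forall i, 0 <= u i) -> u i @[i --> F] --> 0 -> u i `^ s @[i --> F] --> 0.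
Proof.
move=> s0 u0 uc; apply/cvgrPdist_le => e e0.
have e1 : 0 < e `^ s^-1 by exact: powR_gt0.
move/cvgrPdist_le/(_ _ e1): uc; apply: filterS => i.
rewrite !sub0r !normrN !ger0_norm ?powR_ge0 // => h.
have := @powR_le _ (u i) (e `^ s^-1) s (ltW s0); rewrite u0 h => /(_ isT).
by rewrite -powRrM mulVf ?gt_eqF // powRr1 // ltW.
Qed.

(** * Push-forwards and the Wasserstein distance *)

Section laws.
Variables (R : realType) (d : nat).
Local Notation V := 'rV[R]_d.
Variable m0 : probability V R.

(** The push-forward as a relation, so that a measure can be required to be the law of a map that
    depends on it. *)
Definition law (f : V -> V) (m : probability V R) :=
  measurable_fun setT f /\ forall A, measurable A -> m A = m0 (f @^-1` A).

Lemma law_id : law id m0.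
Proof. by split; [exact: measurable_id|]. Qed.

Lemma law_exists f : measurable_fun setT f -> exists m, law f m.
Proof.
by move=> mf; exists (distribution m0 (mfun_Sub (mem_set mf))); split.
Qed.

Lemma law_integral f m (F : V -> \bar R) : law f m -> measurable_fun setT F ->
  (forall x, 0 <= F x)%E -> (\int[m]_x F x = \int[m0]_x F (f x))%E.
Proof.
move=> [mf e] mF F0.
rewrite -(@ge0_integral_distribution _ _ _ _ _ m0 (mfun_Sub (mem_set mf)) F mF F0).
by apply: eq_measure_integral => A mA _; exact: e.
Qed.

Lemma law_Rintegral f m (F : V -> R) : law f m -> measurable_fun setT F ->
  m0.-integrable setT (EFin \o (F \o f)) -> \int[m]_x F x = \int[m0]_x F (f x).
Proof.
move=> [mf e] mF iF; rewrite /Rintegral; congr fine.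
have mF' : measurable_fun setT (EFin \o F) by exact/measurable_EFinP.
rewrite -[RHS](@integral_pushforward _ _ _ _ _ _ mf m0 setT (EFin \o F) mF' iF) //.
by apply: eq_measure_integral => A mA _; exact: e.
Qed.

(** The image of [m0] under (f, g) is a coupling of the two laws. *)
Lemma wasserstein_le s f g m1 m2 : 0 < s -> law f m1 -> law g m2 ->
  (\int[m0]_x (enorm (f x - g x) `^ s)%:E < +oo)%E ->
  wasserstein s m1 m2 <= fine (\int[m0]_x (enorm (f x - g x) `^ s)%:E)%E `^ s^-1.
Proof.
move=> s0 [mf e1] [mg e2] fin.
have mfg : measurable_fun setT (fun x => (f x, g x)) by exact: measurable_fun_pair.
pose P : probability (V * V)%type R := distribution m0 (mfun_Sub (mem_set mfg)).
have cP : coupling m1 m2 P.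
  by move=> A mA; rewrite e1 // e2 //; split; congr (m0 _); apply/seteqP; split => x //= [].
have PE : (\int[P]_z (enorm (z.1 - z.2) `^ s)%:E = \int[m0]_x (enorm (f x - g x) `^ s)%:E)%E.
  rewrite (@ge0_integral_distribution _ _ _ _ _ m0 (mfun_Sub (mem_set mfg)) _ (@measurable_enormB R d s)) //.
  by move=> z; rewrite lee_fin powR_ge0.
rewrite /wasserstein; set S := [set _ | _ in _].
have le : (ereal_inf S <= \int[m0]_x (enorm (f x - g x) `^ s)%:E)%E.
  by rewrite -PE; apply: ereal_inf_lbound; exists P.
have ge : (0 <= ereal_inf S)%E.
  by apply: le_ereal_inf_tmp => _ [Q _ <-]; apply: integral_ge0 => z _; rewrite lee_fin powR_ge0.
apply: powR_le; first by rewrite invr_ge0 ltW.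
rewrite fine_ge0 //=; apply: fine_le => //.
  by rewrite ge0_fin_numE // (le_lt_trans le).
by rewrite ge0_fin_numE // integral_ge0 // => x _; rewrite lee_fin powR_ge0.
Qed.

Lemma wasserstein_ge0 s (m1 m2 : probability V R) : 0 <= wasserstein s m1 m2.
Proof. exact: powR_ge0. Qed.

Lemma finite_moment_le s s' (m : probability V R) : 0 <= s <= s' -> finite_moment s' m -> finite_moment s m.
Proof.
move=> ss; rewrite /finite_moment => fin.
have mE r : measurable_fun setT (fun x : V => (enorm x `^ r)%:E).
  apply/measurable_EFinP; apply: (measurableT_comp (@measurable_powR R r)).
  by apply: continuous_measurable; exact: enorm_continuous.
have iE : m.-integrable setT (fun x : V => (enorm x `^ s')%:E).
  apply/integrableP; split=> //.
  by under eq_integral do rewrite gee0_abs ?lee_fin ?powR_ge0 //.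
have i1 : m.-integrable setT (fun x : V => 1%:E) by exact: finite_measure_integrable_cst.
have /integrableP[_] : m.-integrable setT (fun x : V => (enorm x `^ s)%:E).
  apply: le_integrable (integrableD measurableT i1 iE) => // x _ /=.
  rewrite lee_fin !ger0_norm ?powR_ge0 ?addr_ge0 ?powR_ge0 //.
  by apply: powR_le_exp => //; exact: enorm_ge0.
by under eq_integral do rewrite gee0_abs ?lee_fin ?powR_ge0 //.
Qed.

(** The common dominating function; in this form it passes through a map with |y| <= K (1 + |x|) at
    the price of the factor (1 + K)^s. *)
Definition weight (s : R) (x : V) : R := (1 + `|x|) `^ s.

Lemma weight_measurable s : measurable_fun setT (weight s).
Proof.
apply: (measurableT_comp (@measurable_powR R s)); apply: continuous_measurable => x.
by apply: cvgD; [exact: cvg_cst|exact: norm_continuous].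
Qed.

Lemma weight_integrable s : 0 <= s -> finite_moment s m0 -> m0.-integrable setT (EFin \o weight s).
Proof.
move=> s0 fin.
have mE : measurable_fun setT (fun x : V => (enorm x `^ s)%:E).
  apply/measurable_EFinP; apply: (measurableT_comp (@measurable_powR R s)).
  by apply: continuous_measurable; exact: enorm_continuous.
have iE : m0.-integrable setT (fun x : V => (enorm x `^ s)%:E).
  apply/integrableP; split=> //.
  by under eq_integral do rewrite gee0_abs ?lee_fin ?powR_ge0 //.
have i1 : m0.-integrable setT (fun x : V => 1%:E) by exact: finite_measure_integrable_cst.
have iD := integrableZl measurableT (2 `^ s) (integrableD measurableT i1 iE).
apply: le_integrable iD => //.
  by apply/measurable_EFinP; exact: weight_measurable.
move=> x _ /=; rewrite lee_fin !ger0_norm ?powR_ge0 ?mulr_ge0 ?addr_ge0 ?powR_ge0 //.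
apply: (@le_trans _ _ ((1 + enorm x) `^ s)).
  by apply: powR_le => //; rewrite addr_ge0 //= lerD2l norm_le_enorm.
apply: (le_trans (powR_add_le s0 ler01 (enorm_ge0 x))).
by rewrite powR1.
Qed.

Lemma Rintegral_cvg s (F_ : nat -> V -> R) (F : V -> R) K : m0.-integrable setT (EFin \o weight s) ->
  (forall n, measurable_fun setT (F_ n)) -> measurable_fun setT F ->
  (forall n x, `|F_ n x| <= K * weight s x) ->
  (forall x, F_ n x @[n --> \oo] --> F x) ->
  m0.-integrable setT (EFin \o F) /\ \int[m0]_x F_ n x @[n --> \oo] --> \int[m0]_x F x.
Proof.
move=> iw mF_ mF FK Fc.
have iK := integrableZl measurableT K iw.
have mE n : measurable_fun setT (EFin \o F_ n) by exact/measurable_EFinP.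
have [|||i _ c] := @dominated_convergence _ _ _ m0 setT measurableT (fun n => EFin \o F_ n) (EFin \o F) _ mE _ _ iK.
- exact/measurable_EFinP.
- by apply/aeW => x _; apply: cvg_EFin; [exact: nearW|exact: Fc].
- by apply/aeW => x n _ /=; rewrite lee_fin.
split=> //; rewrite /Rintegral.
have fi : (\int[m0]_x (F x)%:E)%E \is a fin_num by exact: integrable_fin_num.
by apply: fine_cvg; rewrite fineK.
Qed.

Lemma finite_moment_law s f m K : 0 <= s -> 0 <= K -> finite_moment s m0 -> law f m ->
  (forall x, `|f x| <= K * (1 + `|x|)) -> finite_moment s m.
Proof.
move=> s0 K0 fin lf fK; rewrite /finite_moment.
have mE : measurable_fun setT (fun x : V => (enorm x `^ s)%:E).
  apply/measurable_EFinP; apply: (measurableT_comp (@measurable_powR R s)).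
  by apply: continuous_measurable; exact: enorm_continuous.
rewrite (law_integral lf mE) => [|x]; last by rewrite lee_fin powR_ge0.
have /integrableP[_] := integrableZl measurableT ((d.+1%:R * K) `^ s) (weight_integrable s0 fin).
apply: le_lt_trans; apply: ge0_le_integral => //.
- by move=> x _; rewrite lee_fin powR_ge0.
- exact: (measurableT_comp mE lf.1).
- apply: measurableT_comp => //; apply/measurable_EFinP; apply: measurable_funM => //.
  exact: weight_measurable.
- move=> x _ /=; rewrite lee_fin ger0_norm ?mulr_ge0 ?powR_ge0 //.
  rewrite -powRM ?mulr_ge0 ?addr_ge0 //; apply: powR_le => //; rewrite enorm_ge0 /=.
  by apply: (le_trans (enorm_le_norm _)); rewrite -mulrA ler_wpM2l.
Qed.

Lemma wasserstein_lip s : 0 < s -> finite_moment s m0 -> exists2 M, 0 <= M &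
  forall f g m1 m2 e, 0 <= e -> law f m1 -> law g m2 ->
    (forall x, `|f x - g x| <= e * (1 + `|x|)) -> wasserstein s m1 m2 <= e * M.
Proof.
move=> s0 fin; have iw := weight_integrable (ltW s0) fin.
pose I := (\int[m0]_x (weight s x)%:E)%E.
have I0 : (0 <= I)%E by apply: integral_ge0 => x _; rewrite lee_fin powR_ge0.
have Ifin : I \is a fin_num by exact: integrable_fin_num.
exists (d.+1%:R * fine I `^ s^-1); first by rewrite mulr_ge0 // powR_ge0.
move=> f g m1 m2 e e0 lf lg fg.
have mfg : measurable_fun setT (fun x => (enorm (f x - g x) `^ s)%:E).
  have mp : measurable_fun setT (fun x => (f x, g x)) by exact: measurable_fun_pair lf.1 lg.1.
  exact: (measurableT_comp (@measurable_enormB R d s) mp).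
have le : (\int[m0]_x (enorm (f x - g x) `^ s)%:E <= ((d.+1%:R * e) `^ s)%:E * I)%E.
  rewrite -ge0_integralZl //; last 3 first.
  - by apply/measurable_EFinP; exact: weight_measurable.
  - by move=> x _; rewrite lee_fin powR_ge0.
  - by rewrite lee_fin powR_ge0.
  apply: ge0_le_integral => //.
  - by move=> x _; rewrite lee_fin powR_ge0.
  - apply: emeasurable_funM => //; apply/measurable_EFinP; exact: weight_measurable.
  - move=> x _ /=; rewrite lee_fin -powRM ?mulr_ge0 ?addr_ge0 //; apply: powR_le; first exact: ltW.
    by rewrite enorm_ge0 /=; apply: (le_trans (enorm_le_norm _)); rewrite -mulrA ler_wpM2l.
have r_fin : (((d.+1%:R * e) `^ s)%:E * I < +oo)%E by rewrite -(fineK Ifin) -EFinM ltry.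
apply: (le_trans (wasserstein_le s0 lf lg (le_lt_trans le r_fin))).
apply: (@le_trans _ _ (((d.+1%:R * e) `^ s * fine I) `^ s^-1)).
  apply: powR_le; first by rewrite invr_ge0 ltW.
  have p0 : (0 <= \int[m0]_x (enorm (f x - g x) `^ s)%:E)%E.
    by apply: integral_ge0 => x _; rewrite lee_fin powR_ge0.
  move: le p0 r_fin; rewrite -(fineK Ifin); move: (\int[m0]_x _)%E => J le p0 _.
  by case: J le p0 => [J|//|//] /=; rewrite -EFinM !lee_fin => -> ->.
rewrite powRM ?powR_ge0 ?fine_ge0 // -powRrM divff ?gt_eqF // powRr1 ?mulr_ge0 //.
by rewrite mulrCA mulrA.
Qed.

Lemma wasserstein_cvg s (f_ : nat -> V -> V) f m_ m K : 0 < s -> finite_moment s m0 ->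
  0 <= K -> (forall n, law (f_ n) (m_ n)) -> law f m ->
  (forall n x, `|f_ n x| <= K * (1 + `|x|)) -> (forall x, f_ n x @[n --> \oo] --> f x) ->
  wasserstein s (m_ n) m @[n --> \oo] --> 0.
Proof.
move=> s0 fin K0 lf_ lf fK fc; have iw := weight_integrable (ltW s0) fin.
have fK' x : `|f x| <= K * (1 + `|x|).
  by apply: (@cvgr_to_le _ _ _ _ _ _ _ (cvg_norm (fc x))); exact: nearW.
pose E n x := enorm (f_ n x - f x) `^ s.
have mE n : measurable_fun setT (E n).
  have mp : measurable_fun setT (fun x => (f_ n x, f x)) by exact: measurable_fun_pair (lf_ n).1 lf.1.
  by apply/measurable_EFinP; exact: (measurableT_comp (@measurable_enormB R d s) mp).
have EK n x : `|E n x| <= (d.+1%:R * (2 * K)) `^ s * weight s x.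
  rewrite ger0_norm ?powR_ge0 // -powRM ?mulr_ge0 ?addr_ge0 //; apply: powR_le; first exact: ltW.
  rewrite enorm_ge0 /=; apply: (le_trans (enorm_le_norm _)); rewrite -mulrA ler_wpM2l //.
  by apply: (le_trans (ler_normB _ _)); rewrite -mulrA mulrDl mul1r lerD.
have Ec x : E n x @[n --> \oo] --> 0.
  apply: powR_to0 => // [n|]; first exact: enorm_ge0.
  have c : f_ n x - f x @[n --> \oo] --> (0 : V) by rewrite -(subrr (f x)); apply: cvgB; [exact: fc|exact: cvg_cst].
  have e0 : enorm (0 : V) = 0.
    by apply/eqP; rewrite eq_le enorm_ge0 andbT (le_trans (enorm_le_norm _)) // normr0 mulr0.
  have ce : {for (0 : V), continuous (@enorm R 1 d)} by exact: enorm_continuous.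
  rewrite /prop_for /continuous_at e0 in ce.
  exact: (@cvg_comp _ _ _ (fun n => f_ n x - f x) (@enorm R 1 d) _ _ _ c ce).
have m_0 : measurable_fun setT (fun _ : V => 0 : R) by exact: measurable_cst.
have [_ c] := Rintegral_cvg iw mE m_0 EK Ec.
have c0 : \int[m0]_x E n x @[n --> \oo] --> 0.
  by move: c; rewrite Rintegral_cst // mul0r.
have c1 : (\int[m0]_x E n x) `^ s^-1 @[n --> \oo] --> 0.
  apply: powR_to0; [by rewrite invr_gt0| |exact: c0].
  by move=> n; apply: Rintegral_ge0 => x _; exact: powR_ge0.
apply: (squeeze_cvgr _ (cvg_cst 0) c1); apply: nearW => n.
apply/andP; split; first exact: wasserstein_ge0.
apply: (wasserstein_le s0 (lf_ n) lf).
have iK := integrableZl measurableT ((d.+1%:R * (2 * K)) `^ s) iw.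
have /integrableP[_] : m0.-integrable setT (EFin \o E n).
  apply: le_integrable iK => //; first exact/measurable_EFinP.
  by move=> x _ /=; rewrite lee_fin (le_trans (EK n x)) // ger0_norm // mulr_ge0 // powR_ge0.
by under eq_integral do rewrite /= ger0_norm ?powR_ge0 //.
Qed.

End laws.

(** * One-sided time derivatives on [0, T] *)

Section time_calculus.
Variables (R : realType) (T : R).

(** Dominated convergence concerns sequences; this reduces limits in time to them. *)
Lemma within_cvg_seq (U : normedModType R) (W : pseudoMetricType R) (f : U -> W) (A : set U) (t : U) (l : W) :
  (forall u : nat -> U, (forall n, A (u n)) -> u n @[n --> \oo] --> t -> f (u n) @[n --> \oo] --> l) ->
  f s @[s --> within A (nbhs t)] --> l.
Proof.
move=> h; apply/cvg_ballP => e e0; apply: contrapT => nb.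
have ex n : exists s, A s /\ `|s - t| < n.+1%:R^-1 /\ ~ ball l e (f s).
  apply: contrapT => nex; apply: nb.
  apply/nbhs_ballP; exists n.+1%:R^-1 => /=; first by rewrite invr_gt0.
  move=> s ts As; apply: contrapT => nl; apply: nex; exists s; split => //; split => //.
  by move: ts; rewrite -ball_normE /= distrC.
have [u hu] := choice ex.
have ut : u n @[n --> \oo] --> t.
  apply/cvgrPdist_lt => e' e'0; near=> n.
  have := (hu n).2.1; rewrite distrC => /lt_trans; apply.
  by near: n; exact: near_infty_natSinv_lt (PosNum e'0).
have := h u (fun n => (hu n).1) ut.
move/cvg_ballP/(_ e e0) => [N _ /(_ N (leqnn N))] /=.
exact: (hu N).2.2.
Unshelve. all: by end_near. Qed.

(** Puts the punctured filter of [time_slope] into the form [within A (nbhs t)], to which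
    [within_cvg_seq] applies. *)
Lemma within_punctured (W : Type) (f : R -> W) (t : R) (F : set_system W) :
  f s @[s --> within [set s | `[0, T]%classic s /\ s != t] (nbhs t)] `=>` F ->
  f s @[s --> within `[0, T] t^'] `=>` F.
Proof.
move=> h P /h nP; have {}nP : nbhs t (fun s => `[0, T]%classic s /\ s != t -> P (f s)) := nP.
change (nbhs t (fun s => s != t -> `[0, T]%classic s -> P (f s))).
by apply: filterS nP => s hs st sT; apply: hs.
Qed.

Lemma slab_cvg (d : nat) (W : topologicalType) (f : R * 'rV[R]_d -> W) (I : Type) (F : set_system I) {FF : Filter F}
    (t : I -> R) (x : I -> 'rV[R]_d) t0 x0 :
  {within slab T, continuous f} -> 0 <= t0 <= T -> (\forall i \near F, 0 <= t i <= T) ->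
  t i @[i --> F] --> t0 -> x i @[i --> F] --> x0 -> f (t i, x i) @[i --> F] --> f (t0, x0).
Proof.
move=> /subspace_continuousP cf t0T tT tt xx.
have c : f @ within (slab T) (nbhs (t0, x0)) --> f (t0, x0).
  by apply: cf; split => //=; rewrite in_itv.
move=> P /c nP.
have cp : (t i, x i) @[i --> F] --> (t0, x0) by apply: cvg_pair_nbhs.
have nP' : F (fun i => slab T (t i, x i) -> P (f (t i, x i))) := cp _ nP.
apply: filterS2 tT nP' => i ti; apply; split => //=; rewrite in_itv.
Qed.

Section slopes.
Variables (f k : R -> R).
Hypothesis fk : forall t, 0 <= t <= T -> time_slope f t s @[s --> within `[0, T] t^'] --> k t.

Lemma time_slope_is_derive t : 0 < t < T -> is_derive t 1 f (k t).
Proof.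
move=> /andP[t0 tT].
have c : h^-1 *: ((f \o shift t) (h *: 1) - f t) @[h --> 0^'] --> k t.
  have c1 : h + t @[h --> (0 : R)^'] `=>` within `[0, T] t^'.
    move=> P nP; have {}nP : nbhs t (fun s => s != t -> `[0, T]%classic s -> P s) := nP.
    change (nbhs (0 : R) (fun h => h != 0 -> P (h + t))).
    have ct : h + t @[h --> (0 : R)] --> t.
      by rewrite -[X in _ --> X]add0r; apply: cvgD; [exact: cvg_id|exact: cvg_cst].
    have i : \forall s \near t, s \in `[0, T].
      near=> s; rewrite in_itv /=; apply/andP; split; apply: ltW; near: s; [exact: lt_nbhsr|exact: lt_nbhsl].
    have nh : nbhs (0 : R) (fun h => (h + t != t -> `[0, T]%classic (h + t) -> P (h + t)) /\ h + t \in `[0, T]).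
      exact: filterI (ct _ nP) (ct _ i).
    apply: filterS nh => h [/= h1 h2] h0; apply: h1 => //.
    by rewrite -subr_eq0 addrK.
  have t0T : 0 <= t <= T by rewrite !ltW.
  have c2 : time_slope f t (h + t) @[h --> 0^'] --> k t.
    move=> P nP; have h1 := fk t0T nP.
    have h2 := c1 (fun s => P (time_slope f t s)) h1.
    exact: h2.
  move: c2; apply: cvg_trans; apply: near_eq_cvg; apply: nearW => h /=.
  by rewrite /time_slope addrK scaler1.
by apply: DeriveDef; [apply/cvg_ex; exists (k t)|apply: cvg_lim].
Unshelve. all: by end_near. Qed.

Lemma time_slope_continuous t : 0 <= t <= T -> f s @[s --> within `[0, T] (nbhs t)] --> f t.
Proof.
move=> tT.
have c : (s - t) * time_slope f t s @[s --> within `[0, T] t^'] --> 0 * k t.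
  apply: cvgM; last exact: fk.
  rewrite -(subrr t); apply: cvgB; last exact: cvg_cst.
  by apply: cvg_within_filter; exact: cvg_within.
apply/cvgrPdist_le => e e0.
rewrite mul0r in c; move/cvgrPdist_le/(_ _ e0): c.
move=> nP; have {}nP : nbhs t (fun s => s != t -> `[0, T]%classic s -> `|0 - (s - t) * time_slope f t s| <= e) := nP.
change (nbhs t (fun s => `[0, T]%classic s -> `|f t - f s| <= e)).
apply: filterS nP => s h sT.
have [->|st] := eqVneq s t; first by rewrite subrr normr0 ltW.
have := h st sT; rewrite sub0r normrN /time_slope /GRing.scale /= mulrA divff ?subr_eq0 // mul1r.
by rewrite distrC.
Qed.

Lemma time_slope_LR a b : 0 <= a -> a < b -> b <= T -> derivable_oo_LRcontinuous f a b.
Proof.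
move=> a0 ab bT; split.
- move=> t; rewrite in_itv /= => /andP[at_ tb].
  by have [] := @time_slope_is_derive t _; rewrite ?(le_lt_trans a0 at_) ?(lt_le_trans tb bT).
- have := @time_slope_continuous a; rewrite a0 (le_trans (ltW ab) bT) => /(_ isT).
  apply: cvg_trans => P nP; have {}nP : nbhs a (fun s => `[0, T]%classic s -> P (f s)) := nP.
  change (nbhs a (fun s => a < s -> P (f s))).
  near=> s => as_; apply: (near nP s) => //; rewrite /= in_itv /= (le_trans a0 (ltW as_)) /=.
  by rewrite (le_trans _ bT) //; apply: ltW; near: s; exact: lt_nbhsl.
- have := @time_slope_continuous b; rewrite bT (le_trans a0 (ltW ab)) => /(_ isT).
  apply: cvg_trans => P nP; have {}nP : nbhs b (fun s => `[0, T]%classic s -> P (f s)) := nP.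
  change (nbhs b (fun s => s < b -> P (f s))).
  near=> s => sb; apply: (near nP s) => //; rewrite /= in_itv /= (le_trans (ltW sb) bT) andbT.
  by rewrite (le_trans a0) //; apply: ltW; near: s; exact: lt_nbhsr.
Unshelve. all: by end_near. Qed.

Lemma time_slope_bound L a b : 0 <= a <= T -> 0 <= b <= T ->
  (forall t, 0 <= t <= T -> `|k t| <= L) -> `|f b - f a| <= L * `|b - a|.
Proof.
move=> aT bT kL.
wlog ab : a b aT bT / a <= b.
  by move=> w; case/orP: (le_total a b) => ab; [exact: w|rewrite distrC [`|b - a|]distrC; exact: w].
move: ab; rewrite le_eqVlt => /orP[/eqP ->|ab]; first by rewrite !subrr normr0 mulr0.
case/andP: (aT) => a0 _; case/andP: (bT) => _ bT'.
have [c|//|c + ->] := @MVT R f k a b ab.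
- rewrite in_itv /= => /andP[ac cb]; apply: time_slope_is_derive.
  by rewrite (le_lt_trans a0 ac) (lt_le_trans cb bT').
- by apply: derivable_oo_LRcontinuous_within; exact: time_slope_LR.
- rewrite in_itv /= => /andP[ac cb]; rewrite normrM ler_wpM2r //; apply: kL.
  by rewrite !ltW // ?(le_lt_trans a0 ac) ?(lt_le_trans cb bT').
Qed.

Lemma time_slope_int t : (forall t0, 0 <= t0 <= T -> k s @[s --> within `[0, T] (nbhs t0)] --> k t0) ->
  0 <= t <= T -> f t = f 0 + \int[lebesgue_measure]_(s in `[0, t]) k s.
Proof.
move=> kc /andP[]; rewrite le_eqVlt => /orP[/eqP <- _|t0 tT].
  by rewrite set_itv1 Rintegral_set1 addr0.
have kcont : {within `[0, t], continuous k}.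
  apply/subspace_continuousP => s /=; rewrite in_itv /= => /andP[s0 st].
  have := kc s; rewrite s0 (le_trans st tT) => /(_ isT); apply: cvg_trans.
  move=> P nP; have {}nP : nbhs s (fun r => `[0, T]%classic r -> P (k r)) := nP.
  change (nbhs s (fun r => `[0, t]%classic r -> P (k r))).
  apply: filterS nP => r h /=; rewrite in_itv /= => /andP[r0 rt].
  by apply: h; rewrite /= in_itv /= r0 (le_trans rt).
have := continuous_FTC2 t0 kcont (time_slope_LR (lexx 0) t0 tT).
rewrite /Rintegral => ->; first by rewrite -EFinB /= addrC subrK.
move=> s; rewrite in_itv /= => /andP[s0 st].
have dk : is_derive s 1 f (k s) by apply: time_slope_is_derive; rewrite s0 (lt_le_trans st tT).
by rewrite derive1E derive_val.
Qed.

End slopes.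
End time_calculus.

(** * Test functions on the slab *)

Section slab.
Variables (R : realType) (d : nat) (T : R).
Local Notation V := 'rV[R]_d.
Hypothesis T0 : 0 < T.

(** As T > 0, every t has other points of [0, T] nearby, on its right if t <= T / 2 and on its left
    otherwise. Properness makes the limit in [time_derive] unique. *)
Lemma within_time_proper t : 0 <= t <= T -> ProperFilter (within `[0, T] t^').
Proof.
move=> /andP[t0 tT]; constructor => [nP|]; last exact: within_filter.
have /nbhs_ballP[r /= r0 rP] : nbhs t (fun s => s != t -> `[0, T]%classic s -> False) := nP.
have nb s : ball t r s -> s != t -> 0 <= s <= T -> False.
  by move=> ts st sT; apply: (rP s) => //=; rewrite in_itv.
pose e := Num.min (r / 2) (T / 2).
have e0 : 0 < e by rewrite lt_min !divr_gt0.
have er : e < r by rewrite gt_min; apply/orP; left; rewrite ltr_pdivrMr // ltr_pMr // ltrDl.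
have eT : e <= T / 2 by rewrite ge_min lexx orbT.
case: (leP t (T / 2)) => tT2.
  apply: (nb (t + e)).
  - by rewrite /ball /= opprD addrA subrr sub0r normrN gtr0_norm.
  - by rewrite -subr_eq0 addrAC subrr add0r gt_eqF.
  - by rewrite addr_ge0 ?(ltW e0) //=; lra.
apply: (nb (t - e)).
- by rewrite /ball /= opprB addrCA subrr addr0 gtr0_norm.
- by rewrite -subr_eq0 addrAC subrr sub0r oppr_eq0 gt_eqF.
- by apply/andP; split; lra.
Qed.

Lemma time_derive_eq (W : normedModType R) (f : R -> W) t l : 0 <= t <= T ->
  time_slope f t s @[s --> within `[0, T] t^'] --> l -> time_derivable T f t /\ time_derive T f t = l.
Proof.
move=> tT c; have pf := within_time_proper tT.
by split; [apply/cvg_ex; exists l|apply: cvg_lim].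
Qed.

Lemma within_slab_eq (W : topologicalType) (f g : R * V -> W) :
  (forall t x, 0 <= t <= T -> f (t, x) = g (t, x)) ->
  (forall t x, 0 <= t <= T -> g z @[z --> within (slab T) (nbhs (t, x))] --> g (t, x)) ->
  {within slab T, continuous f}.
Proof.
move=> fg gc; apply/subspace_continuousP => -[t x] [/=]; rewrite in_itv /= => tT _.
rewrite /from_subspace fg //; have := gc t x tT; apply: cvg_trans; apply: near_eq_cvg.
have h (z : R * V) : slab T z -> g z = f z by case: z => s y [/=]; rewrite in_itv /= => sT _; rewrite fg.
by apply: filterS (withinT _ _) => z; exact: h.
Qed.

Lemma slab_bounded (W : normedModType R) (f : R * V -> W) M : {within slab T, continuous f} ->
  exists2 L, 0 <= L & forall t x, 0 <= t <= T -> `|x| <= M -> `|f (t, x)| <= L.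
Proof.
move=> cf; pose K : set (R * V) := `[0, T] `*` [set x | `|x| <= M].
have cK : compact K by apply: compact_setX; [exact: segment_compact|exact: rV_ball_compact].
have cfK : {within K, continuous f} by apply: continuous_subspaceW cf => z [z1 _].
have [L [Lr hL]] := compact_bounded (continuous_compact cfK cK).
exists (`|L| + 1); first by rewrite addr_ge0.
move=> t x tT xM; apply: (hL (`|L| + 1)); first by rewrite (le_lt_trans (ler_norm _)) // ltrDl.
by exists (t, x) => //; split => //=; rewrite in_itv.
Qed.

Variable rho : R -> V -> R.
Hypothesis rhoC1 : C1_slab T rho.

Lemma rho_time_slope t x : 0 <= t <= T ->
  time_slope (rho^~ x) t s @[s --> within `[0, T] t^'] --> time_derive T (rho^~ x) t.
Proof. by move=> tT; have [h _ _ _] := rhoC1; apply: h; rewrite in_itv. Qed.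

(** The increment is split at rho s (xi t). The mean value theorem in space brings in the gradient
    at time s and at an intermediate point, which converges by joint continuity of the gradient. *)
Lemma rho_chain (xi : R -> V) t v : 0 <= t <= T ->
  xi s @[s --> within `[0, T] (nbhs t)] --> xi t ->
  time_slope xi t s @[s --> within `[0, T] t^'] --> v ->
  time_slope (fun s => rho s (xi s)) t s @[s --> within `[0, T] t^'] -->
    time_derive T (rho^~ (xi t)) t + dot (grad (rho t) (xi t)) v.
Proof.
move=> tT xic xiv; have pf := within_time_proper tT.
have [_ dr _ cg] := rhoC1.
have ex s : exists c : R, 0 <= s <= T -> 0 <= c <= 1 /\
    rho s (xi s) - rho s (xi t) = dot (grad (rho s) (xi t + c *: (xi s - xi t))) (xi s - xi t).
  have [sT|nsT] := pselect (0 <= s <= T); last by exists 0.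
  have drs z : differentiable (rho s) z by apply: dr; rewrite in_itv.
  have [c c01 e] := @line_mvt R V (rho s) (xi t) (xi s - xi t) 0 1 ler01 drs.
  exists c => _; split=> //; move: e.
  rewrite scale1r scale0r addr0 subrKC => ->.
  by rewrite derive_grad // subr0 mulr1.
have [c hc] := choice ex.
have inT : \forall s \near within `[0, T] t^', 0 <= s <= T.
  by apply: withinT => s /=; rewrite in_itv.
have xic' : xi s @[s --> within `[0, T] t^'] --> xi t.
  move=> P /xic nP; have {}nP : nbhs t (fun s => `[0, T]%classic s -> P (xi s)) := nP.
  change (nbhs t (fun s => s != t -> `[0, T]%classic s -> P (xi s))).
  by apply: filterS nP => s h _; exact: h.
have mid : xi t + c s *: (xi s - xi t) @[s --> within `[0, T] t^'] --> xi t.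
  apply/cvgrPdist_le => e e0; move/cvgrPdist_le/(_ _ e0): xic'.
  apply: filterS2 inT => s sT; apply: le_trans.
  rewrite opprD addrA subrr sub0r normrN normrZ distrC.
  have [/andP[c0 c1] _] := hc s sT.
  by rewrite ger0_norm // ler_piMl.
have idc : s @[s --> within `[0, T] t^'] --> t.
  by apply: cvg_within_filter; exact: cvg_within.
have gc : grad (rho s) (xi t + c s *: (xi s - xi t)) @[s --> within `[0, T] t^'] --> grad (rho t) (xi t).
  exact: (@slab_cvg R T d _ (fun z : R * V => grad (rho z.1) z.2) R (within `[0, T] t^') _ id
     (fun s => xi t + c s *: (xi s - xi t)) t (xi t) cg tT inT idc mid).
have main : time_slope (rho^~ (xi t)) t s + dot (grad (rho s) (xi t + c s *: (xi s - xi t))) (time_slope xi t s)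
    @[s --> within `[0, T] t^'] --> time_derive T (rho^~ (xi t)) t + dot (grad (rho t) (xi t)) v.
  by apply: cvgD; [exact: rho_time_slope|exact: dot_cvg].
apply: cvg_trans main; apply: near_eq_cvg; apply: filterS inT => s sT.
have [_ e] := hc s sT.
rewrite /time_slope /= dotZr -e -[X in _ + X]/(_ *: _) -scalerDr; congr (_ *: _).
by rewrite addrC addrA subrK.
Qed.

Hypothesis rho_supp : compactly_supported T rho.

Lemma rho_bounds : exists2 L, 0 <= L & forall t x, 0 <= t <= T ->
  [/\ `|rho t x| <= L, `|time_derive T (rho^~ x) t| <= L & `|grad (rho t) x| <= L].
Proof.
have [_ dr ct cg] := rhoC1; have [M hM] := rho_supp.
have [L1 L10 hL1] := slab_bounded M ct.
have [L2 L20 hL2] := slab_bounded M cg.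
(* [C1_slab] does not state joint continuity of rho itself; its bound comes from time 0 and from the
   bound [L1] on the time derivative. *)
have [L3 L30 hL3] : exists2 L, 0 <= L & forall t x, 0 <= t <= T -> `|x| <= M -> `|rho t x| <= L.
  have zT : 0 <= (0 : R) <= T by rewrite lexx ltW.
  have c0 : {within [set x : V | `|x| <= M], continuous (rho 0)}.
    by apply: continuous_subspaceT => x; apply: differentiable_continuous; apply: dr; rewrite in_itv.
  have [L [Lr hL]] := compact_bounded (continuous_compact c0 (@rV_ball_compact R d M)).
  exists (`|L| + 1 + L1 * T); first by rewrite !addr_ge0 // mulr_ge0 // ltW.
  move=> t x tT xM; rewrite -(subrK (rho 0 x) (rho t x)) addrC (le_trans (ler_normD _ _)) //.
  apply: lerD.
    by apply: (hL (`|L| + 1)); [rewrite (le_lt_trans (ler_norm _)) // ltrDl|exists x].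
  have := @time_slope_bound R T (rho^~ x) _ (fun s sT => @rho_time_slope s x sT) L1 0 t zT tT.
  move=> /(_ (fun s sT => hL1 s x sT xM)) /le_trans; apply.
  rewrite subr0 ler_wpM2l // ger0_norm; by case/andP: tT.
exists (L1 + L2 + L3); first by rewrite !addr_ge0.
move=> t x tT; case: (lerP (enorm x) M) => xM.
  have xM' := le_trans (norm_le_enorm x) xM.
  have := hL1 t x tT xM'; have := hL2 t x tT xM'; have := hL3 t x tT xM'.
  by move=> /= h1 h2 h3; split; lra.
have s0 s : 0 <= s <= T -> rho s x = 0 by move=> sT; apply: hM; rewrite ?in_itv.
split.
- by rewrite s0 // normr0 !addr_ge0.
- have [_ ->] : time_derivable T (rho^~ x) t /\ time_derive T (rho^~ x) t = 0.
    have inT : \forall s \near within `[0, T] t^', 0 = time_slope (rho^~ x) t s.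
      have inT : \forall s \near within `[0, T] t^', 0 <= s <= T.
        by apply: withinT => s /=; rewrite in_itv.
      by apply: filterS inT => s sT; rewrite /time_slope !s0 // subr0 scaler0.
    apply: time_derive_eq => //; have c0 : (fun _ : R => 0 : R) s @[s --> within `[0, T] t^'] --> (0 : R) by exact: cvg_cst.
    by apply: cvg_trans c0; exact: near_eq_cvg.
  by rewrite normr0 !addr_ge0.
- have -> : grad (rho t) x = 0.
    apply/rowP => i; rewrite !mxE.
    have ne : \forall y \near x, rho t y = cst 0 y.
      have /(_ x) ec := @enorm_continuous R d.
      have : \forall y \near x, M < enorm y by move/cvgrPdist_lt: ec => /(_ (enorm x - M)); rewrite subr_gt0 => /(_ xM); apply: filterS => y; rewrite ltr_norml => /andP[_]; lra.
      by apply: filterS => y yM; apply: hM; rewrite ?in_itv.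
    by rewrite (near_eq_derive _ ne) derive_val.
  by rewrite normr0 !addr_ge0.
Qed.

End slab.

(** * Slopes of integrals over [t, T] *)

Lemma int_slope (R : realType) (f : R -> R) (T c e t s : R) : continuous f -> t <= T -> s <= T ->
  (forall r, `|r - t| <= `|s - t| -> `|f r - c| <= e) ->
  `|int f s T - int f t T + (s - t) * c| <= e * `|s - t|.
Proof.
move=> cf tT sT hr; case/orP: (le_total t s) => ts.
  have tsT : t <= s <= T by rewrite ts.
  rewrite (int_split cf tsT) opprD addrCA subrr addr0.
  rewrite -normrN opprD opprK [_ * c]mulrC.
  rewrite [in leRHS]ger0_norm ?subr_ge0 //; apply: int_near => // r /andP[r1 r2]; apply: hr.
  by rewrite !ger0_norm ?subr_ge0 // lerD2r.
have tsT : s <= t <= T by rewrite ts.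
rewrite (int_split cf tsT) addrK.
rewrite -[s - t]opprB mulNr normrN [_ * c]mulrC.
rewrite [in leRHS]ger0_norm ?subr_ge0 //; apply: int_near => // r /andP[r1 r2]; apply: hr.
by rewrite !ler0_norm ?subr_le0 // ?opprB ?lerD2l ?lerN2.
Qed.

Lemma vint_slope (R : realType) n (f : R -> 'rV[R]_n) (T : R) (c : 'rV[R]_n) (e t s : R) :
  continuous f -> t <= T -> s <= T -> 0 <= e ->
  (forall r, `|r - t| <= `|s - t| -> `|f r - c| <= e) ->
  `|vint f s T - vint f t T + (s - t) *: c| <= e * `|s - t|.
Proof.
move=> cf tT sT e0 hr; apply: rV_norm_le => [|i]; first by rewrite mulr_ge0.
rewrite !mxE; apply: int_slope => //.
  by move=> x; apply: cvg_coord; exact: cf.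
move=> x /hr; apply: le_trans.
by have := rV_coord_le (f x - c) i; rewrite !mxE.
Qed.

Lemma time_slope_cvg (R : realType) (W : normedModType R) (T : R) (f : R -> W) (t : R) (c : W) :
  (forall e, 0 < e -> \forall s \near t, 0 <= s <= T -> `|f s - f t - (s - t) *: c| <= e * `|s - t|) ->
  time_slope f t s @[s --> within `[0, T] t^'] --> c.
Proof.
move=> h; apply/cvgrPdist_le => e e0; have := h e e0.
suff H s : (0 <= s <= T -> `|f s - f t - (s - t) *: c| <= e * `|s - t|) ->
    s != t -> `[0, T]%classic s -> `|c - time_slope f t s| <= e.
  by move=> hh; change (nbhs t (fun s => s != t -> `[0, T]%classic s -> `|c - time_slope f t s| <= e)); apply: filterS hh.
move=> hh st /=; rewrite in_itv /= => /hh {hh}.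
have st0 : s - t != 0 by rewrite subr_eq0.
rewrite -ler_pdivrMr ?normr_gt0 //; apply: le_trans.
rewrite /time_slope -[c in leLHS](scalerK st0) -scalerBr normrZ normfV mulrC.
by rewrite -normrN opprB.
Qed.

Lemma two_sided_slope (R : realType) (u u' a b a' b' c e : R) :
  `|a - b + c| <= e -> `|a' - b' + c| <= e -> u + b' - a' <= u' -> u' + a - b <= u ->
  `|u' - u - c| <= e.
Proof.
rewrite !ler_norml => /andP[h1 h1'] /andP[h2 h2'] g1 g2.
by apply/andP; split; lra.
Qed.

Lemma vint_near_slope (R : realType) n (f : R -> 'rV[R]_n) (T t e : R) : continuous f -> 0 <= t <= T -> 0 < e ->
  \forall s \near t, 0 <= s <= T ->
    `|vint f s T - vint f t T - (s - t) *: - f t| <= e * `|s - t|.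
Proof.
move=> cf tT e0.
have /cvgrPdist_le/(_ _ e0)/nbhs_ballP[r /= r0 rU] := cf t.
have := nbhsx_ballx t r r0; apply: filterS => s sr sT.
rewrite scalerN opprK; apply: vint_slope => //; [lra|lra|exact: ltW|].
move=> s' ss'; rewrite distrC; apply: rU.
by rewrite /ball/= distrC (le_lt_trans ss') // distrC.
Qed.

(** * The Hopf formula *)

Section hopf_formula.
Variables (R : realType) (d k : nat) (T q : R).
Local Notation V := 'rV[R]_d.
Local Notation Z := 'rV[R]_k.
Variables (h : V -> Z -> R) (hp : V -> Z -> V) (phi : R -> Z).
Variables (G : V -> R) (g : V -> V) (B C : R).
Hypotheses (T0 : 0 < T) (q1 : 1 < q).
Hypothesis phi_cont : continuous phi.
Hypothesis h_convex : forall c, convex_C1 (h^~ c) (hp^~ c).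
Hypothesis h_cont : continuous (fun z : V * Z => h z.1 z.2).
Hypothesis hp_cont : continuous (fun z : V * Z => hp z.1 z.2).
Hypotheses (B0 : 0 <= B) (C0 : 0 <= C).
Hypothesis hpB : forall p c, `|hp p c| <= B * (1 + `|p| `^ (q - 1)).
Hypothesis G_convex : convex_C1 G g.
Hypothesis GC : forall z, `|G z| <= C * (1 + `|z| `^ (q / (q - 1))).
Hypothesis gC : `|g 0| <= C.

Definition hopf_S (t : R) (p : V) : R := int (fun s => h p (phi s)) t T.
Definition hopf_s (t : R) (p : V) : V := vint (fun s => hp p (phi s)) t T.

Lemma h_phi_cvg (I : Type) (F : set_system I) {FF : Filter F} (p : I -> V) (t : I -> R) p0 t0 :
  p i @[i --> F] --> p0 -> t i @[i --> F] --> t0 ->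
  h (p i) (phi (t i)) @[i --> F] --> h p0 (phi t0).
Proof.
move=> hp0 ht0.
have c : {for (p0, phi t0), continuous (fun z : V * Z => h z.1 z.2)} by exact: h_cont.
apply: (@cvg_comp _ _ _ (fun i => (p i, phi (t i))) (fun z : V * Z => h z.1 z.2) F (nbhs (p0, phi t0)) _ _ c).
apply: cvg_pair_nbhs => //.
by apply: (@cvg_comp _ _ _ t phi F (nbhs t0)) => //; exact: phi_cont.
Qed.

Lemma hp_phi_cvg (I : Type) (F : set_system I) {FF : Filter F} (p : I -> V) (t : I -> R) p0 t0 :
  p i @[i --> F] --> p0 -> t i @[i --> F] --> t0 ->
  hp (p i) (phi (t i)) @[i --> F] --> hp p0 (phi t0).
Proof.
move=> hp0 ht0.
have c : {for (p0, phi t0), continuous (fun z : V * Z => hp z.1 z.2)} by exact: hp_cont.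
apply: (@cvg_comp _ _ _ (fun i => (p i, phi (t i))) (fun z : V * Z => hp z.1 z.2) F (nbhs (p0, phi t0)) _ _ c).
apply: cvg_pair_nbhs => //.
by apply: (@cvg_comp _ _ _ t phi F (nbhs t0)) => //; exact: phi_cont.
Qed.

Lemma h_phi_cont p : continuous (fun s => h p (phi s)).
Proof. by move=> t; apply: h_phi_cvg; [exact: cvg_cst|exact: cvg_id]. Qed.

Lemma hp_phi_cont p : continuous (fun s => hp p (phi s)).
Proof. by move=> t; apply: hp_phi_cvg; [exact: cvg_cst|exact: cvg_id]. Qed.

Local Hint Resolve h_phi_cont hp_phi_cont : core.

Lemma hopf_s_lip p a b : a <= b <= T ->
  `|hopf_s a p - hopf_s b p| <= B * (1 + `|p| `^ (q - 1)) * (b - a).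
Proof.
move=> abT; case/andP: (abT) => ab bT.
rewrite /hopf_s (vint_split (@hp_phi_cont p) abT) addrK.
rewrite -[X in `|X|]subr0 -(scaler0 _ (b - a)); apply: vint_near => //.
  by rewrite mulr_ge0 // addr_ge0 // powR_ge0.
by move=> t _; rewrite subr0.
Qed.

(** The integrands converge uniformly on [0, T] by compactness, and the moving lower limit is
    handled by [hopf_s_lip]. *)
Lemma hopf_s_cvg (I : Type) (F : set_system I) {FF : Filter F} (p : I -> V) (t : I -> R) p0 t0 :
  0 <= t0 <= T -> (\forall i \near F, 0 <= t i <= T) ->
  p i @[i --> F] --> p0 -> t i @[i --> F] --> t0 ->
  hopf_s (t i) (p i) @[i --> F] --> hopf_s t0 p0.
Proof.
move=> t0T tT pp tt; apply/cvgrPdist_le => e e0.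
pose K := B * (1 + `|p0| `^ (q - 1)) + 1.
have K0 : 0 < K by rewrite ltr_pwDr // mulr_ge0 // addr_ge0 // powR_ge0.
have e1 : 0 < e / (2 * T) by rewrite divr_gt0 // mulr_gt0.
have e2 : 0 < e / (2 * K) by rewrite divr_gt0 // mulr_gt0.
have cov := (compact_near_coveringP _).1 (@segment_compact R 0 T) I F
  (fun i s => `|hp p0 (phi s) - hp (p i) (phi s)| <= e / (2 * T)) FF.
have {cov} unif : \forall i \near F, `[0, T] `<=` (fun s => `|hp p0 (phi s) - hp (p i) (phi s)| <= e / (2 * T)).
  apply: cov => s _.
  have c : hp p0 (phi z.1) - hp (p z.2) (phi z.1) @[z --> filter_prod (nbhs s) F] --> hp p0 (phi s) - hp p0 (phi s).
    apply: cvgB.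
      by apply: hp_phi_cvg; [exact: cvg_cst|exact: cvg_fst].
    apply: hp_phi_cvg; last exact: cvg_fst.
    by apply: (@cvg_comp _ _ _ (snd : R * I -> I) p _ F); [exact: cvg_snd|].
  have /cvgr_dist_le/(_ _ e1) := c.
  by apply: filterS => z; rewrite subrr sub0r normrN.
have /cvgrPdist_le/(_ _ e2) near_t := tt.
apply: filterS3 unif tT near_t => i un ti tn.
rewrite -(subrKA (hopf_s (t i) p0)) [e]splitr (le_trans (ler_normD _ _)) //; apply: lerD.
  have lip a b : 0 <= a <= T -> 0 <= b <= T -> a <= b -> `|hopf_s a p0 - hopf_s b p0| <= K * `|b - a|.
    move=> /andP[_ _] /andP[_ bT] ab; apply: (le_trans (hopf_s_lip _ _)); first by rewrite ab.
    by rewrite ger0_norm ?subr_ge0 // ler_wpM2r ?subr_ge0 // lerDl.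
  apply: (@le_trans _ _ (K * `|t0 - t i|)).
    case/orP: (le_total t0 (t i)) => le; first by rewrite [`|t0 - _|]distrC; apply: lip.
    by rewrite distrC; apply: lip.
  by apply: (le_trans (ler_wpM2l (ltW K0) tn)); rewrite le_eqVlt; apply/orP; left; apply/eqP; field; rewrite gt_eqF.
case/andP: ti => ti0 tiT.
apply: (@le_trans _ _ (e / (2 * T) * (T - t i))).
  apply: vint_dist => //; first exact: ltW.
  by move=> s /andP[s1 s2]; apply: un; rewrite /= in_itv /= s2 (le_trans ti0).
apply: (@le_trans _ _ (e / (2 * T) * T)).
  by rewrite ler_wpM2l ?(ltW e1) // gerBl.
by rewrite le_eqVlt; apply/orP; left; apply/eqP; field; rewrite gt_eqF.
Qed.

Lemma hopf_S_convex t : 0 <= t <= T -> convex_C1 (hopf_S t) (hopf_s t).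
Proof.
move=> tT; split=> [p p'|p].
  have cd : continuous (fun s => dot (hp p (phi s)) (p' - p)).
    by move=> s; apply: dot_cvg; [exact: hp_phi_cont|exact: cvg_cst].
  rewrite /hopf_S /hopf_s -int_dot // -intD //.
  apply: int_le => //; first by move=> s; apply: cvgD; [exact: h_phi_cont|exact: cd].
  by move=> s _; exact: (h_convex (phi s)).1.
apply: (@hopf_s_cvg _ (nbhs p) _ id (fun=> t)) => //; first exact: nearW.
exact: cvg_cst.
Qed.

Lemma hopf_s_le t p : 0 <= t <= T -> `|hopf_s t p| <= T * B * (1 + `|p| `^ (q - 1)).
Proof.
move=> /andP[t0 tT]; have := @hopf_s_lip p t T; rewrite tT lexx => /(_ isT).
rewrite {2}/hopf_s vint_self subr0 => /le_trans; apply.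
rewrite [leRHS](_ : _ = B * (1 + `|p| `^ (q - 1)) * T); last by ring.
by rewrite ler_wpM2l ?gerBl // mulr_ge0 // addr_ge0 // powR_ge0.
Qed.

Lemma hopf_s_mono t p p' : 0 <= t <= T -> 0 <= dot (hopf_s t p - hopf_s t p') (p - p').
Proof. by move=> tT; exact: (convex_C1_mono _ _ (hopf_S_convex tT)). Qed.

(* The foot at time T of the characteristic through (t, x), and the constant
   momentum carried by it. *)
Definition hopf_Y (t : R) (x : V) : V := xget 0 [set y | y + hopf_s t (g y) = x].
Definition hopf_P (t : R) (x : V) : V := g (hopf_Y t x).

Lemma hopf_YP t x : 0 <= t <= T -> hopf_Y t x + hopf_s t (hopf_P t x) = x.
Proof.
move=> tT; have [y yP] := char_exists x G_convex (hopf_S_convex tT).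
exact: (@xgetPex _ 0 [set y | y + hopf_s t (g y) = x] (ex_intro _ y yP)).
Qed.

Lemma hopf_Y_unique t x y : 0 <= t <= T -> y + hopf_s t (g y) = x -> hopf_Y t x = y.
Proof.
move=> tT e; apply: (@char_unique R d G g (hopf_s t)) => //.
  by move=> p p'; exact: hopf_s_mono.
by rewrite e; exact: hopf_YP.
Qed.

Lemma hopf_Y_bound : exists2 K, 0 < K & forall t x, 0 <= t <= T ->
  `|hopf_P t x| `^ (q - 1) <= K * (1 + `|x|) /\ `|hopf_Y t x| <= K * (1 + `|x|).
Proof.
have TB0 : 0 <= T * B by rewrite mulr_ge0 // ltW.
have [K K0 hK] := @char_bound R d C (T * B) q (q / (q - 1)) C0 TB0 q1 erefl.
exists K => // t x tT; apply: (hK G g (hopf_s t)) => //.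
- by move=> p p'; exact: hopf_s_mono.
- by move=> p; exact: hopf_s_le.
- exact: hopf_YP.
Qed.

Lemma hopf_Y_cvg (I : Type) (F : set_system I) {FF : Filter F} (x : I -> V) (t : I -> R) x0 t0 :
  0 <= t0 <= T -> (\forall i \near F, 0 <= t i <= T) ->
  x i @[i --> F] --> x0 -> t i @[i --> F] --> t0 ->
  hopf_Y (t i) (x i) @[i --> F] --> hopf_Y t0 x0.
Proof.
move=> t0T tT xx tt; have [K K0 hK] := hopf_Y_bound.
apply: (@char_stable R d I F FF (fun=> g) (fun i => hopf_s (t i)) x (fun i => hopf_Y (t i) (x i)) g
  (hopf_s t0) x0 _ (K * (1 + (`|x0| + 1)))).
- move=> y0; apply: (@cvg_comp _ _ _ (snd : I * V -> V) g _ (nbhs y0)); first exact: cvg_snd.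
  exact: G_convex.2.
- move=> p0; apply: (@hopf_s_cvg _ (filter_prod F (nbhs p0)) _ (fun z => z.2) (fun z => t z.1)) => //.
  + exact: (cvg_fst tT).
  + exact: cvg_snd.
  + by apply: (@cvg_comp _ _ _ (fst : I * V -> I) t _ F); [exact: cvg_fst|].
- exact: xx.
- by apply: filterS tT => i ti; exact: hopf_YP.
- have /cvgrPdist_le/(_ _ ltr01) x1 := xx.
  apply: filterS2 tT x1 => i ti xi; apply: (le_trans (hK _ _ ti).2).
  rewrite ler_pM2l // lerD2l -[x i](subKr x0) (le_trans (ler_normB _ _)) // lerD2l //.
- by move=> y' e; rewrite (hopf_Y_unique t0T e).
Qed.

Lemma hopf_P_cvg (I : Type) (F : set_system I) {FF : Filter F} (x : I -> V) (t : I -> R) x0 t0 :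
  0 <= t0 <= T -> (\forall i \near F, 0 <= t i <= T) ->
  x i @[i --> F] --> x0 -> t i @[i --> F] --> t0 ->
  hopf_P (t i) (x i) @[i --> F] --> hopf_P t0 x0.
Proof.
move=> t0T tT xx tt.
apply: (@cvg_comp _ _ _ (fun i => hopf_Y (t i) (x i)) g F (nbhs (hopf_Y t0 x0))); last exact: G_convex.2.
exact: hopf_Y_cvg.
Qed.

(** With p = g y, Fenchel's equality reads -G^*(p) = G y - p . y, so this is x . p - G^*(p) - S_t(p)
    at the maximiser p. *)
Definition hopf_u (t : R) (x : V) : R :=
  G (hopf_Y t x) + dot (hopf_P t x) (x - hopf_Y t x) - hopf_S t (hopf_P t x).

(* The Hopf formula u(t,x) = max_p (x.p - G*(p) - S_t(p)), tested with the
   maximiser at (t', x'). *)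
Lemma hopf_u_ge t x t' x' : 0 <= t <= T -> 0 <= t' <= T ->
  hopf_u t' x' + dot (hopf_P t' x') (x - x') + hopf_S t' (hopf_P t' x') - hopf_S t (hopf_P t' x') <= hopf_u t x.
Proof.
move=> tT t'T; rewrite /hopf_u.
have xE := hopf_YP x tT.
set y := hopf_Y t x in xE *; set y' := hopf_Y t' x'.
set p := hopf_P t x in xE *; set p' := hopf_P t' x'.
have h1 := G_convex.1 y' y; rewrite -/(hopf_P t' x') -/p' in h1.
have h2 := (hopf_S_convex tT).1 p p'.
have h3 : x - y = hopf_s t p by rewrite -xE addrAC subrr add0r.
rewrite -h3 in h2.
have h4 : dot (x - y) (p' - p) = dot p' (x - y) - dot p (x - y) by rewrite dotC dotBl.
have h5 : dot p' (x - y) = dot p' (x' - y') + dot p' (x - x') - dot p' (y - y').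
  rewrite -dotDr -dotBr; congr dot.
  by rewrite [x' - y' + _]addrC addrA subrK opprB addrA subrK.
lra.
Qed.

(** For equal times the comparison [hopf_u_ge] is the subgradient inequality, with the continuous
    selection [hopf_P]. *)
Lemma hopf_u_convex t : 0 <= t <= T -> convex_C1 (hopf_u t) (hopf_P t).
Proof.
move=> tT; split=> [x z|x].
  by have := @hopf_u_ge t z t x tT tT; rewrite addrK.
by apply: (@hopf_P_cvg _ (nbhs x) _ id (fun=> t)) => //; [exact: nearW|exact: cvg_cst].
Qed.

Lemma hopf_u_T x : hopf_u T x = G x.
Proof.
have TT : 0 <= T <= T by rewrite lexx (ltW T0).
have sT p : hopf_s T p = 0 by exact: vint_self.
have -> : hopf_u T x = G (hopf_Y T x) + dot (hopf_P T x) (x - hopf_Y T x).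
  by rewrite /hopf_u [hopf_S T _]/hopf_S /int set_itv1 Rintegral_set1 subr0.
have e : hopf_Y T x = x by apply: hopf_Y_unique; rewrite // sT addr0.
by rewrite e subrr dot0r addr0.
Qed.

(** Uniformity in the momentum near p matters because the maximiser at time s moves with s. *)
Lemma hopf_S_slope_near t p e : 0 <= t <= T -> 0 < e ->
  \forall z \near (t, p), 0 <= z.1 <= T ->
    `|hopf_S z.1 z.2 - hopf_S t z.2 + (z.1 - t) * h p (phi t)| <= e * `|z.1 - t|.
Proof.
move=> tT e0.
have c : h z.2 (phi z.1) @[z --> nbhs (t, p)] --> h p (phi t).
  by apply: h_phi_cvg; [exact: cvg_snd|exact: cvg_fst].
have /cvgrPdist_le/(_ _ e0) [[U1 U2] /= [U1t U2p] U] := c.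
have /nbhs_ballP[r /= r0 rU] := U1t.
exists (ball t r, U2); first by split=> //; exact: nbhsx_ballx.
move=> [s p'] /= [tr p'U] sT; apply: int_slope; [exact: h_phi_cont|lra|lra|].
move=> s' ss'; rewrite distrC; apply: (U (s', p')); split=> //=; apply: rU.
by rewrite /ball/= distrC (le_lt_trans ss') // distrC.
Qed.

(** Envelope argument: the maximiser of either time is a competitor at the other, so the increment
    of u is trapped between two increments of S, each at a fixed momentum. *)
Lemma hopf_u_slope t x e : 0 <= t <= T -> 0 < e ->
  \forall s \near t, 0 <= s <= T ->
    `|hopf_u s x - hopf_u t x - (s - t) *: h (hopf_P t x) (phi t)| <= e * `|s - t|.
Proof.
move=> tT e0; have nS := hopf_S_slope_near (hopf_P t x) tT e0.
have c : (s, hopf_P s x) @[s --> within `[0, T] (nbhs t)] --> (t, hopf_P t x).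
  apply: cvg_pair_nbhs; first exact: cvg_within.
  apply: hopf_P_cvg => //; [|exact: cvg_cst|exact: cvg_within].
  by apply: withinT => s /=; rewrite in_itv.
have c2 : (s, hopf_P t x) @[s --> nbhs t] --> (t, hopf_P t x).
  by apply: cvg_pair_nbhs; [exact: cvg_id|exact: cvg_cst].
have n1 : \forall s \near t, `[0, T]%classic s -> 0 <= s <= T ->
    `|hopf_S s (hopf_P s x) - hopf_S t (hopf_P s x) + (s - t) * h (hopf_P t x) (phi t)| <= e * `|s - t|.
  exact: (c _ nS).
have n2 : \forall s \near t, 0 <= s <= T ->
    `|hopf_S s (hopf_P t x) - hopf_S t (hopf_P t x) + (s - t) * h (hopf_P t x) (phi t)| <= e * `|s - t|.
  exact: (c2 _ nS).
near=> s => sT.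
have h1 : `|hopf_S s (hopf_P s x) - hopf_S t (hopf_P s x) + (s - t) * h (hopf_P t x) (phi t)| <= e * `|s - t|.
  by apply: (near n1 s) => //; rewrite /= in_itv.
have h2 : `|hopf_S s (hopf_P t x) - hopf_S t (hopf_P t x) + (s - t) * h (hopf_P t x) (phi t)| <= e * `|s - t|.
  by apply: (near n2 s).
have g1 := @hopf_u_ge s x t x sT tT; have g2 := @hopf_u_ge t x s x tT sT.
have xx p : dot p (x - x) = 0 by rewrite subrr dot0r.
rewrite xx addr0 in g1; rewrite xx addr0 in g2.
exact: (two_sided_slope h1 h2 g1 g2).
Unshelve. all: by end_near. Qed.

Lemma hopf_u_time t x : 0 <= t <= T ->
  time_slope (fun s => hopf_u s x) t s @[s --> within `[0, T] t^'] --> h (hopf_P t x) (phi t).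
Proof.
by move=> tT; apply: time_slope_cvg => e e0; exact: hopf_u_slope.
Qed.

Lemma hopf_s_slope t p e : 0 <= t <= T -> 0 < e ->
  \forall s \near t, 0 <= s <= T ->
    `|hopf_s s p - hopf_s t p - (s - t) *: - hp p (phi t)| <= e * `|s - t|.
Proof.
by move=> tT e0; exact: (vint_near_slope (@hp_phi_cont p) tT e0).
Qed.

(* The characteristic issued from (0, x), along which the momentum is constant. *)
Definition hopf_xi (t : R) (x : V) : V := hopf_Y 0 x + hopf_s t (hopf_P 0 x).

Lemma hopf_time0 : 0 <= (0 : R) <= T. Proof. by rewrite lexx ltW. Qed.

Local Notation T00 := hopf_time0.

Lemma hopf_xi0 x : hopf_xi 0 x = x. Proof. exact: (hopf_YP x T00). Qed.

Lemma hopf_xiT x : hopf_xi T x = hopf_Y 0 x.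
Proof. by rewrite /hopf_xi /hopf_s vint_self addr0. Qed.

(** By its definition [hopf_xi t x] has [hopf_Y 0 x] as a foot at time t too, and feet are
    unique. *)
Lemma hopf_P_xi t x : 0 <= t <= T -> hopf_P t (hopf_xi t x) = hopf_P 0 x.
Proof. by move=> tT; rewrite {1}/hopf_P (@hopf_Y_unique t (hopf_xi t x) (hopf_Y 0 x)). Qed.

(** The speed is at most B (1 + |p|^(q - 1)), which [hopf_Y_bound] makes linear in |x|. *)
Lemma hopf_xi_lip : exists2 K, 0 < K & forall s t x, 0 <= s <= T -> 0 <= t <= T ->
  `|hopf_xi s x - hopf_xi t x| <= K * (1 + `|x|) * `|s - t|.
Proof.
have [K K0 hK] := hopf_Y_bound.
exists (B * (1 + K) + 1); first by rewrite ltr_wpDl // mulr_ge0 // addr_ge0 // ltW.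
have lip s t x : 0 <= s <= T -> 0 <= t <= T -> s <= t ->
    `|hopf_xi s x - hopf_xi t x| <= (B * (1 + K) + 1) * (1 + `|x|) * `|s - t|.
  move=> sT tT st; rewrite /hopf_xi opprD addrACA subrr add0r.
  have stT : s <= t <= T by rewrite st; case/andP: tT.
  apply: (le_trans (hopf_s_lip _ stT)).
  rewrite distrC ger0_norm ?subr_ge0 // ler_wpM2r ?subr_ge0 //.
  have [hx _] := hK _ x T00.
  apply: (@le_trans _ _ (B * (1 + K * (1 + `|x|)))); first by rewrite ler_wpM2l // lerD2l.
  have := mulr_ge0 B0 (normr_ge0 x); have := normr_ge0 x; nra.
move=> s t x sT tT; case/orP: (le_total s t) => st; first exact: lip.
by rewrite distrC [`|s - t|]distrC; exact: lip.
Qed.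

Lemma hopf_xi_bound : exists2 K, 0 < K & forall t x, 0 <= t <= T -> `|hopf_xi t x| <= K * (1 + `|x|).
Proof.
have [K K0 hK] := hopf_xi_lip; exists (K * T + 1); first by rewrite ltr_wpDl // mulr_ge0 // ltW.
move=> t x tT; rewrite -[hopf_xi t x](subrK (hopf_xi 0 x)) (le_trans (ler_normD _ _)) //.
have xi0 := hK _ _ x tT T00; rewrite hopf_xi0 in xi0.
rewrite hopf_xi0 mulrDl mul1r; apply: lerD; last by rewrite lerDr.
apply: (le_trans xi0); rewrite subr0 -mulrA mulrC ger0_norm; last by case/andP: tT.
have x1 : 0 <= 1 + `|x| by rewrite addr_ge0.
rewrite mulrC -!mulrA ler_wpM2l ?(ltW K0) // mulrC ler_wpM2r //.
by case/andP: tT.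
Qed.

Lemma hopf_xi_cvg (I : Type) (F : set_system I) {FF : Filter F} (x : I -> V) (t : I -> R) x0 t0 :
  0 <= t0 <= T -> (\forall i \near F, 0 <= t i <= T) ->
  x i @[i --> F] --> x0 -> t i @[i --> F] --> t0 ->
  hopf_xi (t i) (x i) @[i --> F] --> hopf_xi t0 x0.
Proof.
move=> t0T tT xx tt.
have z : \forall i \near F, 0 <= (0 : R) <= T by apply: nearW => i; exact: T00.
apply: cvgD; first by apply: (@hopf_Y_cvg I F FF x (fun=> 0) x0 0 T00 z xx); exact: cvg_cst.
apply: hopf_s_cvg => //.
by apply: (@hopf_P_cvg I F FF x (fun=> 0) x0 0 T00 z xx); exact: cvg_cst.
Qed.

(** * The Hamilton-Jacobi and continuity equations *)

Section solution.
Variables (gamma : R) (m0 : probability V R) (m : R -> probability V R).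
Variable H : V -> V -> Z -> R.
Hypothesis gamma1 : 1 <= gamma.
Hypothesis m0_moment : finite_moment gamma m0.
Hypothesis m_law : forall t, 0 <= t <= T -> law m0 (hopf_xi t) (m t).
Hypothesis HE : forall x p c, H x p c = h p c.
Hypothesis DpHE : forall x p c, DpH H x p c = hp p c.

Let slab_filter (t : R) (x : V) : Filter (within (slab T) (nbhs (t, x))).
Proof. exact: within_filter. Qed.

Lemma hopf_P_slab t x : 0 <= t <= T ->
  hopf_P z.1 z.2 @[z --> within (slab T) (nbhs (t, x))] --> hopf_P t x.
Proof.
move=> tT; have FF := slab_filter t x; apply: hopf_P_cvg => //.
- by apply: filterS (withinT _ _) => -[s y] [/=]; rewrite in_itv.
- by apply: cvg_within_filter; exact: cvg_snd.
- by apply: cvg_within_filter; exact: cvg_fst.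
Qed.

Lemma hopf_u_time_derive t x : 0 <= t <= T ->
  time_derivable T (hopf_u^~ x) t /\ time_derive T (hopf_u^~ x) t = h (hopf_P t x) (phi t).
Proof. by move=> tT; apply: time_derive_eq => //; exact: hopf_u_time. Qed.

Lemma hopf_u_diff t x : 0 <= t <= T ->
  differentiable (hopf_u t) x /\ grad (hopf_u t) x = hopf_P t x.
Proof. by move=> tT; exact: (convex_C1_diff x (hopf_u_convex tT)). Qed.

Lemma hopf_hj_solution : hj_solution T H hopf_u phi G.
Proof.
split; last by move=> x; exact: hopf_u_T.
  split.
  - by move=> t x; rewrite in_itv => tT; have [] := hopf_u_time_derive x tT.
  - by move=> t x; rewrite in_itv => tT; have [] := hopf_u_diff x tT.
  - apply: (@within_slab_eq R d T R _ (fun z => h (hopf_P z.1 z.2) (phi z.1))) => [t x tT|t x tT].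
      by have [_ ->] := hopf_u_time_derive x tT.
    have FF := slab_filter t x; apply: h_phi_cvg; first exact: hopf_P_slab.
    by apply: cvg_within_filter; exact: cvg_fst.
  - apply: (@within_slab_eq R d T _ _ (fun z => hopf_P z.1 z.2)) => [t x tT|t x tT].
      by have [_ ->] := hopf_u_diff x tT.
    exact: hopf_P_slab.
move=> t x; rewrite in_itv => tT.
have [_ ->] := hopf_u_time_derive x tT; have [_ ->] := hopf_u_diff x tT.
by rewrite HE addNr.
Qed.

Lemma hopf_wasserstein : wasserstein_continuous T m gamma.
Proof.
have g0 : 0 < gamma by rewrite (lt_le_trans ltr01).
have [K K0 hK] := hopf_xi_bound; have [L L0 hL] := hopf_xi_lip.
split=> t; rewrite in_itv /= => tT.
  by apply: (finite_moment_law (ltW g0) (ltW K0) m0_moment (m_law tT)) => x; exact: hK.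
have [M M0 hM] := wasserstein_lip g0 m0_moment.
have c : L * `|r - t| * M @[r --> within `[0, T] (nbhs t)] --> L * `|t - t| * M.
  apply: cvgM; last exact: cvg_cst.
  apply: cvgM; first exact: cvg_cst.
  apply: cvg_norm; apply: cvgB; last exact: cvg_cst.
  exact: cvg_within.
rewrite subrr normr0 mulr0 mul0r in c.
apply: (squeeze_cvgr _ (cvg_cst 0) c).
have inT : \forall r \near within `[0, T] (nbhs t), 0 <= r <= T.
  by apply: withinT => s /=; rewrite in_itv.
apply: filterS inT => r rT; apply/andP; split; first exact: wasserstein_ge0.
apply: (hM _ _ _ _ _ _ (m_law rT) (m_law tT)); first by rewrite mulr_ge0 // ltW.
by move=> x; apply: (le_trans (hL _ _ _ rT tT)); rewrite mulrAC.
Qed.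

Lemma hopf_xi_time t x : 0 <= t <= T ->
  time_slope (hopf_xi^~ x) t s @[s --> within `[0, T] t^'] --> - hp (hopf_P 0 x) (phi t).
Proof.
move=> tT; apply: time_slope_cvg => e e0.
have := hopf_s_slope (hopf_P 0 x) tT e0; apply: filterS => s hs sT.
by rewrite /hopf_xi opprD addrACA subrr add0r; exact: hs.
Qed.

Lemma hopf_xi_within t x : 0 <= t <= T -> hopf_xi s x @[s --> within `[0, T] (nbhs t)] --> hopf_xi t x.
Proof.
move=> tT; apply: (@hopf_xi_cvg _ _ _ (fun=> x) id) => //.
- by apply: withinT => s /=; rewrite in_itv.
- exact: cvg_cst.
- exact: cvg_within.
Qed.

Lemma hopf_xi_continuous t : 0 <= t <= T -> continuous (hopf_xi t).
Proof.
move=> tT x; apply: (@hopf_xi_cvg _ (nbhs x) _ id (fun=> t)) => //; first exact: nearW.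
exact: cvg_cst.
Qed.

(** The test function is differentiated along each characteristic and integrated against [m0].
    Dominated convergence shows that the integral [M] has the continuous derivative [N], so the
    fundamental theorem of calculus in time alone concludes, without exchanging integrals. *)
Lemma hopf_continuity : continuity_solution T H hopf_u m phi m0.
Proof.
move=> rho rhoC1 rho_supp t; rewrite in_itv /= => tT.
have z0T := hopf_time0.
have [_ dr ct cg] := rhoC1.
have [L L0 hL] := rho_bounds T0 rhoC1 rho_supp.
have [K K0 hK] := hopf_Y_bound.
pose v x s := hp (hopf_P 0 x) (phi s).
pose kk x s := time_derive T (rho^~ (hopf_xi s x)) s + dot (grad (rho s) (hopf_xi s x)) (- v x s).
have slope x s : 0 <= s <= T ->
    time_slope (fun r => rho r (hopf_xi r x)) s r @[r --> within `[0, T] s^'] --> kk x s.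
  move=> sT; apply: (rho_chain T0 rhoC1 sT); first exact: hopf_xi_within.
  exact: hopf_xi_time.
(* L bounds the derivatives of rho, B (1 + K) (1 + |x|) the speed, and d + 1 comes from the inner
   product. *)
pose D := L + d.+1%:R * L * (B * (1 + K)).
have D0 : 0 <= D by rewrite addr_ge0 // !mulr_ge0 // addr_ge0 // ltW.
have vb x s : `|v x s| <= B * (1 + K) * weight 1 x.
  rewrite /weight powRr1 ?addr_ge0 //.
  apply: (le_trans (hpB _ _)); rewrite -mulrA ler_wpM2l //.
  have [h1 _] := hK 0 x z0T; have := normr_ge0 x; nra.
have kb x s : 0 <= s <= T -> `|kk x s| <= D * weight 1 x.
  move=> sT; have [_ h2 h3] := hL s (hopf_xi s x) sT.
  have w1 : 1 <= weight 1 x by rewrite /weight powRr1 ?addr_ge0 // lerDl.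
  apply: (le_trans (ler_normD _ _)); rewrite mulrDl; apply: lerD.
    by apply: (le_trans h2); rewrite ler_peMr.
  apply: (le_trans (dot_le _ _)); rewrite normrN -!mulrA ler_wpM2l // ler_pM // !mulrA.
  exact: vb.
have iw : m0.-integrable setT (EFin \o weight 1).
  by apply: (weight_integrable ler01); apply: finite_moment_le m0_moment; rewrite ler01.
have xi_mf s : 0 <= s <= T -> measurable_fun setT (hopf_xi s).
  by move=> sT; exact: (m_law sT).1.
have td_cont s : 0 <= s <= T -> continuous (fun y => time_derive T (rho^~ y) s).
  move=> sT y; apply: (@slab_cvg R T d _ (fun z : R * V => time_derive T (rho^~ z.2) z.1) _ (nbhs y) _ (fun=> s) id) => //.
  + exact: nearW.
  + exact: cvg_cst.
have gr_cont s : 0 <= s <= T -> continuous (fun y => grad (rho s) y).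
  move=> sT y; apply: (@slab_cvg R T d _ (fun z : R * V => grad (rho z.1) z.2) _ (nbhs y) _ (fun=> s) id) => //.
  + exact: nearW.
  + exact: cvg_cst.
have rho_cont s : 0 <= s <= T -> continuous (rho s).
  by move=> sT y; apply: differentiable_continuous; apply: dr; rewrite in_itv.
pose F s y := time_derive T (rho^~ y) s - dot (hp (hopf_P s y) (phi s)) (grad (rho s) y).
have Fmf s : 0 <= s <= T -> measurable_fun setT (F s).
  move=> sT; apply: continuous_measurable => y; apply: cvgB; first exact: td_cont.
  apply: dot_cvg; last exact: gr_cont.
  apply: hp_phi_cvg; last exact: cvg_cst.
  apply: (@hopf_P_cvg _ (nbhs y) _ id (fun=> s)) => //; first exact: nearW.
  exact: cvg_cst.
have Fk s x : 0 <= s <= T -> F s (hopf_xi s x) = kk x s.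
  by move=> sT; rewrite /kk dotNr dotC /F hopf_P_xi.
have kmf s : 0 <= s <= T -> measurable_fun setT (kk^~ s).
  move=> sT; have -> : kk^~ s = F s \o hopf_xi s by apply/funext => x /=; rewrite Fk.
  by apply: measurableT_comp; [exact: Fmf|exact: xi_mf].
have kint s : 0 <= s <= T -> m0.-integrable setT (EFin \o kk^~ s).
  move=> sT; apply: le_integrable (integrableZl measurableT D iw) => //.
    by apply/measurable_EFinP; exact: kmf.
  move=> x _ /=; rewrite lee_fin [leRHS]ger0_norm; first exact: kb.
  by rewrite mulr_ge0 // powR_ge0.
pose M s := \int[m0]_x rho s (hopf_xi s x).
pose N s := \int[m0]_x kk x s.
have rmf s : 0 <= s <= T -> measurable_fun setT (fun x => rho s (hopf_xi s x)).
  move=> sT; apply: (@measurableT_comp _ _ _ _ _ _ (rho s) setT (hopf_xi s)); last exact: xi_mf.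
  by apply: continuous_measurable; exact: rho_cont.
have rint s : 0 <= s <= T -> m0.-integrable setT (EFin \o (fun x => rho s (hopf_xi s x))).
  have iL : m0.-integrable setT (fun _ : V => L%:E) by exact: finite_measure_integrable_cst.
  move=> sT; apply: le_integrable iL => //.
  - by apply/measurable_EFinP; exact: rmf.
  - move=> x _ /=; rewrite lee_fin [leRHS]ger0_norm //.
    by have [] := hL s (hopf_xi s x) sT.
have Mm s : 0 <= s <= T -> \int[m s]_x rho s x = M s.
  move=> sT; apply: (law_Rintegral (m_law sT)); last exact: rint.
  by apply: continuous_measurable; exact: rho_cont.
have NF s : 0 <= s <= T -> \int[m s]_x F s x = N s.
  move=> sT; rewrite (law_Rintegral (m_law sT) (Fmf _ sT)).
    by rewrite /N; congr (Rintegral _ _ _); apply/funext => x; exact: Fk.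
  have -> : F s \o hopf_xi s = kk^~ s by apply/funext => x /=; rewrite Fk.
  exact: kint.
(* By the mean value bound all difference quotients are at most D (1 + |x|), so the derivative
   passes under the integral. *)
have NM s : 0 <= s <= T -> time_slope M s r @[r --> within `[0, T] s^'] --> N s.
  move=> sT; apply: within_punctured; apply: within_cvg_seq => r rs rc.
  have rT n : 0 <= r n <= T by have [] := rs n; rewrite /= in_itv.
  pose Q n x := time_slope (fun r => rho r (hopf_xi r x)) s (r n).
  have Qmf n : measurable_fun setT (Q n).
    apply: measurable_funM => //; apply: measurable_funB; exact: rmf.
  have QD n x : `|Q n x| <= D * weight 1 x.
    have st : r n - s != 0 by rewrite subr_eq0; have [] := rs n.
    rewrite /Q /time_slope normrZ normfV mulrC ler_pdivrMr ?normr_gt0 //.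
    exact: (time_slope_bound (slope x) sT (rT n) (kb x)).
  have Qc x : Q n x @[n --> \oo] --> kk x s.
    apply: (@cvg_comp _ _ _ r (time_slope (fun r => rho r (hopf_xi r x)) s) \oo (within `[0, T] s^')); last exact: slope.
    move=> P nP; have {}nP : nbhs s (fun r => r != s -> `[0, T]%classic r -> P r) := nP.
    have hn : \forall n \near \oo, r n != s -> `[0, T]%classic (r n) -> P (r n) := rc _ nP.
    apply: (@filterS _ \oo _ _ _ _ hn) => n hrn; have [h1 h2] := rs n; exact: hrn.
  have [_ c] := Rintegral_cvg iw Qmf (kmf _ sT) QD Qc.
  apply: cvg_trans c; apply: near_eq_cvg; apply: nearW => n.
  rewrite /Q /time_slope /M -RintegralB //; [|exact: rint|exact: rint].
  rewrite -[RHS]/(_ * _) -RintegralZl //.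
  exact: (integrableB measurableT (rint _ (rT n)) (rint _ sT)).
have Nc s : 0 <= s <= T -> N r @[r --> within `[0, T] (nbhs s)] --> N s.
  move=> sT; apply: within_cvg_seq => r rs rc.
  have rT n : 0 <= r n <= T by have := rs n; rewrite /= in_itv.
  have kc x : kk x (r n) @[n --> \oo] --> kk x s.
    have xc : hopf_xi (r n) x @[n --> \oo] --> hopf_xi s x.
      by apply: (@hopf_xi_cvg _ _ _ (fun=> x) r) => //; [exact: nearW|exact: cvg_cst].
    apply: cvgD.
      by apply: (@slab_cvg R T d _ (fun z : R * V => time_derive T (rho^~ z.2) z.1) _ \oo _ r) => //; exact: nearW.
    apply: dot_cvg.
      by apply: (@slab_cvg R T d _ (fun z : R * V => grad (rho z.1) z.2) _ \oo _ r) => //; exact: nearW.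
    by apply: cvgN; apply: hp_phi_cvg => //; exact: cvg_cst.
  by have [_] := Rintegral_cvg iw (fun n => kmf _ (rT n)) (kmf _ sT) (fun n x => kb x _ (rT n)) kc.
rewrite Mm // (time_slope_int NM Nc tT); congr (_ + _).
  by congr (Rintegral _ _ _); apply/funext => x; rewrite hopf_xi0.
apply: eq_Rintegral => s; rewrite inE /= in_itv /= => /andP[s0 st].
have sT : 0 <= s <= T by rewrite s0 (le_trans st) //; case/andP: tT.
rewrite -NF //; congr (Rintegral _ _ _); apply/funext => y; rewrite /F DpHE.
by have [_ ->] := hopf_u_diff y sT.
Qed.

End solution.

End hopf_formula.

(** * The backward differential equation *)

Section exp_weight.
Variables (R : realType) (T L : R).
Hypotheses (L0 : 0 < L).

(** Weight of a Bielecki norm, equal to 1 at the terminal time; the rate 2 L makes the Picard step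
    contract by 1/2. *)
Definition exp_weight (t : R) : R := expR (2 * L * (T - t)).

Lemma exp_weight_continuous : continuous exp_weight.
Proof.
move=> t; apply: (@cvg_comp _ _ _ (fun t => 2 * L * (T - t)) expR (nbhs t) (nbhs (2 * L * (T - t)))); last exact: continuous_expR.
apply: cvgM; first exact: cvg_cst.
by apply: cvgB; [exact: cvg_cst|exact: cvg_id].
Qed.

Lemma exp_weight_ge1 t : t <= T -> 1 <= exp_weight t.
Proof. by move=> tT; rewrite -expR0 ler_expR mulr_ge0 ?subr_ge0 // mulr_ge0 // ltW. Qed.

Lemma int_exp_weight t : 0 <= t <= T -> L * int exp_weight t T = (exp_weight t - 1) / 2.
Proof.
move=> tT.
pose F s := - (2 * L)^-1 * exp_weight s.
have L2 : 2 * L != 0 by rewrite mulf_neq0 // gt_eqF.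
have dF (s : R) : is_derive s 1 F (exp_weight s).
  have d1 : is_derive s (1 : R) ((2 * L) \*: (cst T - id)) ((2 * L) *: (0 - 1)) by exact: is_deriveZ.
  have d1' : is_derive s (1 : R) (fun s => 2 * L * (T - s)) ((2 * L) *: (0 - 1)) by exact: d1.
  have d2 := @is_derive1_comp R expR (fun s => 2 * L * (T - s)) s _ _ (is_derive_expR _) d1'.
  have d3 := is_deriveZ (- (2 * L)^-1) d2.
  have -> : exp_weight s = - (2 * L)^-1 *: (expR (2 * L * (T - s)) * ((2 * L) *: (0 - 1))).
    by rewrite /GRing.scale /= /exp_weight; field; rewrite gt_eqF.
  exact: d3.
case/andP: tT => t0; rewrite le_eqVlt => /orP[/eqP ->|tT].
  by rewrite /int set_itv1 Rintegral_set1 mulr0 /exp_weight subrr mulr0 expR0 subrr mul0r.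
have cF : continuous F.
  by move=> s; apply: differentiable_continuous; apply/derivable1_diffP; have [] := dF s.
have lr : derivable_oo_LRcontinuous F t T.
  split; first by move=> s _; have [] := dF s.
  - by apply: cvg_at_right_filter; exact: cF.
  - by apply: cvg_at_left_filter; exact: cF.
have := @continuous_FTC2 R exp_weight F t T tT (continuous_subspaceT exp_weight_continuous) lr.
rewrite /int /Rintegral => ->; last first.
  by move=> s _; rewrite derive1E; have [_ ->] := dF s.
rewrite -EFinB /= /F {1}/exp_weight subrr mulr0 expR0; field.
by rewrite gt_eqF.
Qed.

End exp_weight.

Lemma vint_le (R : realType) n (u v : R -> 'rV[R]_n) (b : R -> R) a a' : continuous u -> continuous v -> continuous b ->
  a <= a' -> (forall s, a <= s <= a' -> `|u s - v s| <= b s) -> `|vint u a a' - vint v a a'| <= int b a a'.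
Proof.
move=> cu cv cb aa h.
have c0 : continuous (fun _ : R => 0 : R) by move=> x; exact: cvg_cst.
have b0 : 0 <= int b a a'.
  rewrite -(mul0r (a' - a)) -int_cst //; apply: int_le => // s /h; exact: le_trans.
apply: rV_norm_le => // i; rewrite !mxE.
have cui : continuous (fun t => u t 0 i) by move=> t; apply: cvg_coord; exact: cu.
have cvi : continuous (fun t => v t 0 i) by move=> t; apply: cvg_coord; exact: cv.
have hi s : a <= s <= a' -> `|u s 0 i - v s 0 i| <= b s.
  by move=> /h; apply: le_trans; have := rV_coord_le (u s - v s) i; rewrite !mxE.
rewrite -intB // ler_norml; apply/andP; split.
  have -> : - int b a a' = int (fun s => b s * -1) a a' by rewrite intZ // mulrN1.
  apply: int_le => [s|s|s /hi].
  - by apply: cvgM; [exact: cb|exact: cvg_cst].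
  - by apply: cvgB; [exact: cui|exact: cvi].
  - by rewrite ler_norml mulrN1 => /andP[].
apply: int_le => [s|//|s /hi]; first by apply: cvgB; [exact: cui|exact: cvi].
by rewrite ler_norml => /andP[].
Qed.

Section backward_ode.
Variables (R : realType) (k : nat) (T L L1 K : R) (f : R -> 'rV[R]_k -> 'rV[R]_k).
Local Notation Z := 'rV[R]_k.
Hypotheses (T0 : 0 < T) (L0 : 0 < L) (L10 : 0 < L1).
Hypothesis f_cont : continuous (fun z : R * Z => f z.1 z.2).
Hypothesis f_bound : forall t c, `|f t c| <= K.
Hypothesis f_growth : forall t c, `|f t c| <= L1 * (1 + `|c|).
Hypothesis f_lip : forall t c c', `|f t c - f t c'| <= L * `|c - c'|.

(** Time frozen outside [0, T]: paths and drift become continuous on the whole line, as the lemmas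
    on integrals require. *)
Definition clamp (t : R) : R := Num.max 0 (Num.min t T).

Lemma clamp_itv t : 0 <= clamp t <= T.
Proof. by rewrite /clamp le_max lexx /= ge_max (ltW T0) ge_min lexx orbT. Qed.

Lemma clamp_id t : 0 <= t <= T -> clamp t = t.
Proof. by move=> /andP[t0 tT]; rewrite /clamp min_l // max_r. Qed.

Lemma clamp_continuous : continuous clamp.
Proof.
move=> t; apply: (@continuous_max _ _ (fun=> 0) (fun t => Num.min t T)); first exact: cvg_cst.
by apply: (@continuous_min _ _ id (fun=> T)); [exact: cvg_id|exact: cvg_cst].
Qed.

Lemma f_path_continuous (w : R -> Z) : continuous w -> continuous (fun s => f s (w s)).
Proof.
move=> cw s; have c : {for (s, w s), continuous (fun z : R * Z => f z.1 z.2)} by exact: f_cont.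
apply: (@cvg_comp _ _ _ (fun s => (s, w s)) (fun z : R * Z => f z.1 z.2) (nbhs s) (nbhs (s, w s)) _ _ c).
by apply: cvg_pair_nbhs; [exact: cvg_id|exact: cw].
Qed.

Let K0 : 0 <= K. Proof. exact: le_trans (normr_ge0 _) (f_bound 0 0). Qed.

Definition picard_step (c : Z) (w : R -> Z) (t : R) : Z := c + vint (fun s => f s (w s)) (clamp t) T.

Lemma picard_step_lip c w s t : continuous w ->
  `|picard_step c w s - picard_step c w t| <= K * `|clamp s - clamp t|.
Proof.
move=> cw; have cf := f_path_continuous cw.
wlog st : s t / clamp s <= clamp t.
  by move=> W; case/orP: (le_total (clamp s) (clamp t)) => h; [exact: W|rewrite distrC [`|clamp s - _|]distrC; exact: W].
rewrite /picard_step opprD addrACA subrr add0r.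
have stT : clamp s <= clamp t <= T by rewrite st; case/andP: (clamp_itv t).
rewrite (vint_split cf stT) addrK distrC [`|clamp t - _|]ger0_norm ?subr_ge0 //.
rewrite -[X in `|X|]subr0 -(scaler0 _ (clamp t - clamp s)); apply: vint_near => // r _.
by rewrite subr0.
Qed.

Lemma picard_step_continuous c w : continuous w -> continuous (picard_step c w).
Proof.
move=> cw t; apply/cvgrPdist_le => e e0.
have e1 : 0 < e / (K + 1) by rewrite divr_gt0 // ltr_wpDl.
have /cvgrPdist_le/(_ _ e1) := @clamp_continuous t.
apply: filterS => s h; apply: (le_trans (picard_step_lip c t s cw)).
apply: (le_trans (ler_wpM2l K0 h)).
by rewrite mulrA ler_pdivrMr ?ltr_wpDl // mulrC mulrDr mulr1 lerDl ltW.
Qed.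

Fixpoint picard (c : Z) (j : nat) : R -> Z :=
  if j is j'.+1 then picard_step c (picard c j') else fun=> c.

Lemma picard_continuous c j : continuous (picard c j).
Proof.
elim: j => [|j IH] /=; first by move=> t; exact: cvg_cst.
exact: picard_step_continuous.
Qed.

(** L times the integral of the weight over [t, T] is (weight - 1) / 2: the factor 1/2 contracts,
    and the -1 leaves room for |c - c'|. *)
Lemma picard_step_diff c c' w w' a t : continuous w -> continuous w' -> 0 <= a ->
  (forall s, 0 <= s <= T -> `|w s - w' s| <= a * exp_weight T L s) -> 0 <= t <= T ->
  `|picard_step c w t - picard_step c' w' t| <= `|c - c'| + a * ((exp_weight T L t - 1) / 2).
Proof.
move=> cw cw' a0 h tT; rewrite /picard_step clamp_id //.
rewrite opprD addrACA (le_trans (ler_normD _ _)) // lerD2l.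
have cb : continuous (fun s => exp_weight T L s * (L * a)).
  by move=> s; apply: cvgM; [exact: exp_weight_continuous|exact: cvg_cst].
case/andP: (tT) => t0 tT'.
apply: (@le_trans _ _ (int (fun s => exp_weight T L s * (L * a)) t T)).
  apply: vint_le => //; [exact: f_path_continuous|exact: f_path_continuous|].
  move=> s /andP[ts sT]; apply: (le_trans (f_lip _ _ _)).
  rewrite mulrCA ler_wpM2l ?(ltW L0) // mulrC; apply: h.
  by rewrite sT (le_trans t0 ts).
rewrite intZ; last exact: exp_weight_continuous.
by rewrite -int_exp_weight // le_eqVlt; apply/orP; left; apply/eqP; ring.
Qed.

Lemma picard_lip c c' j t : 0 <= t <= T -> `|picard c j t - picard c' j t| <= `|c - c'| * exp_weight T L t.
Proof.
elim: j t => [|j IH] t tT /=.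
  by rewrite ler_peMr // exp_weight_ge1 //; case/andP: tT.
apply: (le_trans (picard_step_diff _ _ _ _ (normr_ge0 (c - c')) IH tT)); try exact: picard_continuous.
have := @exp_weight_ge1 R T _ L0 t; case/andP: tT => _ -> /(_ isT) w1.
have := normr_ge0 (c - c'); nra.
Qed.

Lemma picard_cauchy c j t : 0 <= t <= T ->
  `|picard c j.+1 t - picard c j t| <= K * T * 2^-1 ^+ j * exp_weight T L t.
Proof.
have KT : 0 <= K * T by rewrite mulr_ge0 // ltW.
elim: j t => [|j IH] t tT.
  rewrite expr0 mulr1 /= /picard_step addrAC subrr add0r clamp_id //.
  case/andP: tT => t0 tT.
  apply: (@le_trans _ _ (K * (T - t))).
    rewrite -[X in `|X|]subr0 -(scaler0 _ (T - t)); apply: vint_near => //.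
      by apply: f_path_continuous => s; exact: cvg_cst.
    by move=> s _; rewrite subr0.
  apply: (@le_trans _ _ (K * T)); first by rewrite ler_wpM2l // gerBl.
  by rewrite ler_peMr // exp_weight_ge1.
have a0 : 0 <= K * T * 2^-1 ^+ j by rewrite mulr_ge0 // exprn_ge0 // invr_ge0.
have := picard_step_diff c c (@picard_continuous c j.+1) (@picard_continuous c j) a0 IH tT.
move=> /le_trans; apply; rewrite subrr normr0 add0r exprS.
have := @exp_weight_ge1 R T _ L0 t; case/andP: tT => _ -> /(_ isT) w1.
rewrite [leRHS](_ : _ = K * T * 2^-1 ^+ j * (exp_weight T L t / 2)); last by field.
by rewrite ler_wpM2l //; lra.
Qed.

(** Gronwall's bound with the growth constant [L1] in place of [L]. The two are kept apart because
    the Lipschitz constant will depend on the clipping level of the drift, which is chosen from this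
    bound. *)
Lemma picard_growth c j t : 0 <= t <= T -> 1 + `|picard c j t| <= (1 + `|c|) * exp_weight T L1 t.
Proof.
elim: j t => [|j IH] t tT /=.
  by rewrite ler_peMr ?addr_ge0 // exp_weight_ge1 //; case/andP: tT.
rewrite /picard_step clamp_id //; case/andP: (tT) => t0 tT'.
have cb : continuous (fun s => exp_weight T L1 s * (L1 * (1 + `|c|))).
  by move=> s; apply: cvgM; [exact: exp_weight_continuous|exact: cvg_cst].
have c0 : continuous (fun _ : R => 0 : Z) by move=> s; exact: cvg_cst.
have e0 : vint (fun _ : R => 0 : Z) t T = 0.
  by apply/rowP => i; rewrite !mxE /int Rintegral_cst ?mxE ?mul0r.
have h : `|vint (fun s => f s (picard c j s)) t T| <= (1 + `|c|) * ((exp_weight T L1 t - 1) / 2).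
  rewrite -[vint _ _ _]subr0 -e0 -int_exp_weight // mulrCA mulrA.
  rewrite [leRHS]mulrC -intZ; last exact: exp_weight_continuous.
  apply: vint_le => //; first by apply: f_path_continuous; exact: picard_continuous.
  move=> s /andP[ts sT]; rewrite subr0; apply: (le_trans (f_growth _ _)).
  rewrite [leRHS]mulrCA ler_wpM2l ?(ltW L10) // mulrC; apply: IH.
  by rewrite sT (le_trans t0 ts).
have := ler_normD c (vint (fun s => f s (picard c j s)) t T).
have := @exp_weight_ge1 R T _ L10 t tT'; have := normr_ge0 c; nra.
Qed.

Lemma geometric_cauchy (u : nat -> Z) A :
  (forall j, `|u j.+1 - u j| <= A * 2^-1 ^+ j) ->
  exists l, forall j, `|l - u j| <= 2 * A * 2^-1 ^+ j.
Proof.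
move=> h.
have A0 : 0 <= A by have := h 0%N; rewrite expr0 mulr1; exact: le_trans.
have h2 n j : `|u (n + j)%N - u j| <= 2 * A * 2^-1 ^+ j.
  elim: n j => [|n IH] j; first by rewrite subrr normr0 !mulr_ge0 // exprn_ge0 // invr_ge0.
  rewrite -(subrKA (u j.+1)) (le_trans (ler_normD _ _)) // addSnnS.
  apply: (le_trans (lerD (IH j.+1) (h j))).
  by rewrite exprS le_eqVlt; apply/orP; left; apply/eqP; field.
have geo : 2 * A * 2^-1 ^+ j @[j --> \oo] --> 2 * A * 0.
  by apply: cvgM; [exact: cvg_cst|apply: cvg_expr; rewrite ger0_norm ?invr_ge0 // invf_lt1 // ltr1n].
rewrite mulr0 in geo.
have /cvg_ex[l ul] : cvg (u @ \oo).
  apply: cauchy_cvg; apply/cauchy_exP => e e0.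
  move/cvgrPdist_lt/(_ _ e0): geo => [N _ hN]; exists (u N).
  exists N => // n /= Nn; rewrite -ball_normE /= distrC -(subnK Nn).
  apply: (le_lt_trans (h2 _ _)); have := hN N (leqnn N).
  rewrite /= sub0r normrN; apply: le_lt_trans; exact: ler_norm.
exists l => j; have c : `|u n - u j| @[n --> \oo] --> `|l - u j|.
  by apply: cvg_norm; apply: cvgB; [exact: ul|exact: cvg_cst].
apply: (cvgr_to_le c); exists j => // n /= jn; rewrite -(subnK jn); exact: h2.
Qed.

Lemma picard_clamp c j t : picard c j t = picard c j (clamp t).
Proof. by case: j => [//|j] /=; rewrite /picard_step [clamp (clamp t)]clamp_id // clamp_itv. Qed.

Lemma picard_limit c : exists2 w : R -> Z, continuous w &
  forall e, 0 < e -> exists N : nat, forall j t, (N <= j)%N -> `|w t - picard c j t| <= e.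
Proof.
pose A := K * T * exp_weight T L 0.
have ex t : exists l, forall j, `|l - picard c j t| <= 2 * A * 2^-1 ^+ j.
  apply: geometric_cauchy => j; rewrite !(picard_clamp c _ t).
  have tT := clamp_itv t; apply: (le_trans (picard_cauchy c j tT)).
  rewrite mulrAC ler_wpM2r ?exprn_ge0 ?invr_ge0 // ler_wpM2l ?mulr_ge0 ?(ltW T0) //.
  by rewrite /exp_weight ler_expR ler_wpM2l ?mulr_ge0 ?(ltW L0) // lerD2l lerN2; case/andP: tT.
have [w hw] := choice ex.
have A0 : 0 <= A by rewrite !mulr_ge0 ?(ltW T0) // expR_ge0.
have geo : 2 * A * 2^-1 ^+ j @[j --> \oo] --> 2 * A * 0.
  by apply: cvgM; [exact: cvg_cst|apply: cvg_expr; rewrite ger0_norm ?invr_ge0 // invf_lt1 // ltr1n].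
rewrite mulr0 in geo.
have unif e : 0 < e -> exists N : nat, forall j t, (N <= j)%N -> `|w t - picard c j t| <= e.
  move=> e0; move/cvgrPdist_lt/(_ _ e0): geo => [N _ hN]; exists N => j t Nj.
  apply: (le_trans (hw t j)); have := hN j Nj; rewrite /= sub0r normrN => /ltW; apply: le_trans.
  exact: ler_norm.
exists w => // t; apply/cvgrPdist_le => e e0.
have e3 : 0 < e / 3 by rewrite divr_gt0.
have [N hN] := unif _ e3.
have /cvgrPdist_le/(_ _ e3) := @picard_continuous c N t.
apply: filterS => s h; have h1 := hN N t (leqnn N); have h2 := hN N s (leqnn N).
rewrite -(subrKA (picard c N t)) -[picard c N t - _](subrKA (picard c N s)).
rewrite (le_trans (ler_normD _ _)) //; have := ler_normD (picard c N t - picard c N s) (picard c N s - w s).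
rewrite [`|picard c N s - w s|]distrC; lra.
Qed.

(** [sol c] is the path that ends at c. The third property gives the stability of feet under changes
    of c, the fourth the level at which the drift may be clipped. *)
Lemma backward_ode_exists : exists sol : Z -> R -> Z,
  [/\ forall c, continuous (sol c),
      forall c t, 0 <= t <= T -> sol c t = c + vint (fun s => f s (sol c s)) t T,
      forall c c' t, 0 <= t <= T -> `|sol c t - sol c' t| <= `|c - c'| * exp_weight T L 0 &
      forall c t, 0 <= t <= T -> 1 + `|sol c t| <= (1 + `|c|) * exp_weight T L1 0].
Proof.
have ex c : exists w : R -> Z, continuous w /\
    forall e, 0 < e -> exists N : nat, forall j t, (N <= j)%N -> `|w t - picard c j t| <= e.
  by have [w cw hw] := picard_limit c; exists w.
have [sol hsol] := choice ex.
have wle l t : 0 < l -> 0 <= t -> exp_weight T l t <= exp_weight T l 0.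
  by move=> l0 t0; rewrite /exp_weight ler_expR ler_wpM2l ?mulr_ge0 ?(ltW l0) // lerD2l lerN2.
have sc c := (hsol c).1; have su c := (hsol c).2.
exists sol; split => //.
- move=> c t tT; case/andP: (tT) => t0 tT'.
  apply/eqP; rewrite -subr_eq0 -normr_eq0 eq_le normr_ge0 andbT.
  apply/ler_addgt0Pr => e e0; rewrite add0r.
  pose e' := e / (1 + L * T).
  have LT : 0 < 1 + L * T by rewrite addr_gt0 // mulr_gt0.
  have e'0 : 0 < e' by rewrite divr_gt0.
  have [N hN] := su c _ e'0.
  have h1 := hN N.+1 t (leqnSn N).
  rewrite -(subrKA (picard c N.+1 t)) (le_trans (ler_normD _ _)) //=.
  have -> : e = e' + L * e' * T by rewrite /e'; field; rewrite gt_eqF.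
  apply: lerD; first exact: h1.
  rewrite /picard_step clamp_id // opprD addrACA subrr add0r.
  apply: (@le_trans _ _ (L * e' * (T - t))).
    apply: vint_dist => //.
    + by apply: f_path_continuous; exact: picard_continuous.
    + exact: f_path_continuous.
    + by rewrite mulr_ge0 // ltW.
    + move=> s _; apply: (le_trans (f_lip _ _ _)); rewrite ler_wpM2l ?(ltW L0) // distrC.
      exact: hN.
  by rewrite ler_wpM2l ?gerBl // mulr_ge0 // ltW.
- move=> c c' t tT; apply/ler_addgt0Pr => e e0.
  have e2 : 0 < e / 2 by rewrite divr_gt0.
  have [N hN] := su c _ e2; have [N' hN'] := su c' _ e2.
  pose j := maxn N N'.
  have h1 := hN j t (leq_maxl _ _); have h2 := hN' j t (leq_maxr _ _).
  have h3 := picard_lip c c' j tT.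
  have h4 : `|c - c'| * exp_weight T L t <= `|c - c'| * exp_weight T L 0.
    by rewrite ler_wpM2l // wle //; case/andP: tT.
  rewrite -(subrKA (picard c j t)) -[picard c j t - _](subrKA (picard c' j t)).
  rewrite (le_trans (ler_normD _ _)) //; have := ler_normD (picard c j t - picard c' j t) (picard c' j t - sol c' t).
  rewrite [`|picard c' j t - _|]distrC; lra.
- move=> c t tT; apply/ler_addgt0Pr => e e0.
  have [N hN] := su c _ e0; have h1 := hN N t (leqnn N).
  have h3 := picard_growth c N tT.
  have h4 : (1 + `|c|) * exp_weight T L1 t <= (1 + `|c|) * exp_weight T L1 0.
    by rewrite ler_wpM2l ?addr_ge0 // wle //; case/andP: tT.
  have := ler_normD (sol c t - picard c N t) (picard c N t); rewrite subrK; lra.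
Qed.

End backward_ode.

(** * Truncation of the drift *)

Lemma min_lip (R : realDomainType) (a x y : R) : `|Num.min x a - Num.min y a| <= `|x - y|.
Proof.
rewrite /Order.min ler_norml.
case: (ltP x a) => xa; case: (ltP y a) => ya; case: (ltP (x - y) 0) => xy;
  (rewrite (ltr0_norm xy) || rewrite (ger0_norm xy)); by apply/andP; split; lra.
Qed.

Lemma max_lip (R : realDomainType) (a x y : R) : `|Num.max a x - Num.max a y| <= `|x - y|.
Proof.
rewrite /Order.max ler_norml.
case: (ltP a x) => xa; case: (ltP a y) => ya; case: (ltP (x - y) 0) => xy;
  (rewrite (ltr0_norm xy) || rewrite (ger0_norm xy)); by apply/andP; split; lra.
Qed.

Section clipping.
Variables (R : realType) (k : nat) (M : R).
Hypothesis M0 : 0 <= M.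
Local Notation Z := 'rV[R]_k.

Definition clip (c : Z) : Z := \row_i Num.max (- M) (Num.min (c 0 i) M).

Lemma clip_le c : `|clip c| <= M.
Proof.
apply: rV_norm_le => // i; rewrite mxE ler_norml le_max lexx /= ge_max ge_min lexx orbT andbT.
by rewrite (le_trans _ M0) // oppr_le0.
Qed.

Lemma clip_id c : `|c| <= M -> clip c = c.
Proof.
move=> cM; apply/rowP => i; rewrite mxE; have := le_trans (rV_coord_le c i) cM.
by rewrite ler_norml => /andP[h1 h2]; rewrite min_l // max_r.
Qed.

Lemma clip_lip c c' : `|clip c - clip c'| <= `|c - c'|.
Proof.
apply: rV_norm_le => // i; rewrite !mxE.
apply: le_trans (rV_coord_le (c - c') i); rewrite !mxE.
by apply: le_trans (max_lip _ _ _) (min_lip _ _ _).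
Qed.

Lemma clip_le_norm c : `|clip c| <= `|c|.
Proof.
have c0 : clip 0 = 0 by apply: clip_id; rewrite normr0.
by have := clip_lip c 0; rewrite c0 !subr0.
Qed.

Lemma clip_cvg (I : Type) (F : set_system I) {FF : Filter F} (c : I -> Z) c0 :
  c i @[i --> F] --> c0 -> clip (c i) @[i --> F] --> clip c0.
Proof.
move=> cc; apply/cvgrPdist_le => e e0; move/cvgrPdist_le/(_ _ e0): cc.
by apply: filterS => i; apply: le_trans; exact: clip_lip.
Qed.

End clipping.

(** [0 < n] provides two distinct points, so that the Lipschitz supremum is not over the empty set
    and is nonnegative. *)
Lemma C01_bound (R : realType) n p r (F : 'rV[R]_n -> 'M[R]_(p, r)) (a : R) :
  (0 < n)%N -> (C01_norm F <= a%:E)%E ->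
  forall c c', enorm (F c) <= a /\ enorm (F c - F c') <= a * enorm (c - c').
Proof.
move=> n0; rewrite /C01_norm; set s1 := ereal_sup _; set s2 := ereal_sup _ => h c c'.
have ge1 d : ((enorm (F d))%:E <= s1)%E by apply: ereal_sup_ubound; exists d.
have ge2 d d' : d != d' -> ((enorm (F d - F d') / enorm (d - d'))%:E <= s2)%E.
  by move=> dd; apply: ereal_sup_ubound; exists (d, d').
have s10 : (0 <= s1)%E by apply: le_trans (ge1 c); rewrite lee_fin enorm_ge0.
have s20 : (0 <= s2)%E.
  have d0 : (delta_mx 0 (Ordinal n0) : 'rV[R]_n) != 0.
    by apply/eqP => /rowP/(_ (Ordinal n0)); rewrite !mxE !eqxx => /eqP; rewrite oner_eq0.
  by apply: le_trans (ge2 _ _ d0); rewrite lee_fin divr_ge0 // enorm_ge0.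
have le1 : (s1 <= a%:E)%E by apply: le_trans h; rewrite leeDl.
have le2 : (s2 <= a%:E)%E by apply: le_trans h; rewrite leeDr.
have e0 p' r' : enorm (0 : 'M[R]_(p', r')) = 0.
  by rewrite /enorm big1 ?sqrtr0 // => i _; rewrite big1 // => j _; rewrite mxE expr0n.
split; first by rewrite -lee_fin; exact: le_trans (ge1 c) le1.
have [->|cc] := eqVneq c c'; first by rewrite !subrr !e0 mulr0.
have cc0 : 0 < enorm (c - c').
  by rewrite (lt_le_trans _ (norm_le_enorm _)) // normr_gt0 subr_eq0.
rewrite -ler_pdivrMr // -lee_fin; exact: le_trans (ge2 _ _ cc) le2.
Qed.

Lemma mulmx_trmx_le (R : realType) k p (v : 'rV[R]_k) (N : 'M[R]_(p, k)) :
  `|v *m N^T| <= k%:R * `|v| * enorm N.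
Proof.
apply: rV_norm_le => [|i]; first by rewrite !mulr_ge0 // enorm_ge0.
rewrite mxE (le_trans (ler_norm_sum _ _ _)) //.
apply: (@le_trans _ _ (\sum_(j < k) `|v| * enorm N)).
  apply: ler_sum => j _; rewrite normrM mxE ler_pM //; first exact: rV_coord_le.
  exact: enorm_coord.
by rewrite sumr_const card_ord -[_ *+ k]mulr_natl mulrA.
Qed.

Section truncated_drift.
Variables (R : realType) (k : nat) (T : R).
Local Notation Z := 'rV[R]_k.
Variables (A : R -> Z -> 'M[R]_k) (B : R -> Z -> Z).
Hypotheses (T0 : 0 < T) (k0 : (0 < k)%N).
Hypothesis A_cont : {within slab T, continuous (fun z : R * Z => A z.1 z.2)}.
Hypothesis B_cont : {within slab T, continuous (fun z : R * Z => B z.1 z.2)}.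
Hypothesis AB_bound :
  (ereal_sup [set (C01_norm (A t) + C01_norm (B t))%E | t in `[0%R, T]%classic] < +oo)%E.

Lemma C01_norm_ge0 p r (F : 'rV[R]_k -> 'M[R]_(p, r)) : (0 <= C01_norm F)%E.
Proof.
rewrite /C01_norm adde_ge0 //.
  by apply: le_trans (ereal_sup_ubound _); last (by exists 0); rewrite lee_fin enorm_ge0.
have d0 : (delta_mx 0 (Ordinal k0) : Z) != 0.
  by apply/eqP => /rowP/(_ (Ordinal k0)); rewrite !mxE !eqxx => /eqP; rewrite oner_eq0.
by apply: le_trans (ereal_sup_ubound _); last (by exists (delta_mx 0 (Ordinal k0), 0)); rewrite lee_fin divr_ge0 // enorm_ge0.
Qed.

Lemma drift_bounds : exists2 a : R, 0 <= a & forall t c c', 0 <= t <= T ->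
  [/\ enorm (A t c) <= a, enorm (A t c - A t c') <= a * enorm (c - c'),
      enorm (B t c) <= a & enorm (B t c - B t c') <= a * enorm (c - c')].
Proof.
move: AB_bound; set s := ereal_sup _ => sfin.
have le t : 0 <= t <= T -> (C01_norm (A t) + C01_norm (B t) <= s)%E.
  by move=> tT; apply: ereal_sup_ubound; exists t => //=; rewrite in_itv.
have s0 : (0 <= s)%E.
  have T00 : 0 <= (0 : R) <= T by rewrite lexx ltW.
  by apply: le_trans (le 0 T00); rewrite adde_ge0 // C01_norm_ge0.
have sE : s = (fine s)%:E by rewrite fineK // ge0_fin_numE.
exists (fine s); first exact: fine_ge0.
move=> t c c' /le; rewrite sE => h.
have hA : (C01_norm (A t) <= (fine s)%:E)%E by apply: le_trans h; rewrite leeDl // C01_norm_ge0.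
have hB : (C01_norm (B t) <= (fine s)%:E)%E by apply: le_trans h; rewrite leeDr // C01_norm_ge0.
have [h1 h2] := C01_bound k0 hA c c'; have [h3 h4] := C01_bound k0 hB c c'.
by split.
Qed.

Definition clip_drift (M t : R) (c : Z) : Z := drift A B (clamp T t) (clip M c).

Lemma clip_drift_continuous M : 0 <= M -> continuous (fun z : R * Z => clip_drift M z.1 z.2).
Proof.
move=> M0 [t0 c0].
have tT : \forall z \near nbhs (t0, c0), 0 <= clamp T z.1 <= T.
  by apply: nearW => z; exact: clamp_itv.
have tc : clamp T z.1 @[z --> nbhs (t0, c0)] --> clamp T t0.
  by apply: (@cvg_comp _ _ _ (fst : R * Z -> R) (clamp T) _ (nbhs t0)); [exact: cvg_fst|exact: clamp_continuous].
have cc : clip M z.2 @[z --> nbhs (t0, c0)] --> clip M c0.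
  by apply: clip_cvg => //; exact: cvg_snd.
have Ac : A (clamp T z.1) (clip M z.2) @[z --> nbhs (t0, c0)] --> A (clamp T t0) (clip M c0).
  exact: (slab_cvg A_cont (clamp_itv T0 t0) tT tc cc).
have Bc : B (clamp T z.1) (clip M z.2) @[z --> nbhs (t0, c0)] --> B (clamp T t0) (clip M c0).
  exact: (slab_cvg B_cont (clamp_itv T0 t0) tT tc cc).
rewrite /clip_drift /drift; apply: cvgD; last exact: Bc.
apply: cvg_rV => i.
have coordE (v : Z) (N : 'M[R]_k) : (v *m N^T) 0 i = \sum_j v 0 j * N i j.
  by rewrite mxE; apply: eq_bigr => j _; congr (_ * _); rewrite mxE.
rewrite coordE; under eq_fun do rewrite coordE.
apply: cvg_big => [|j _]; first exact: add_continuous.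
apply: cvgM; first exact: cvg_coord.
by apply: (@cvg_comp _ _ _ (fun z : R * Z => A (clamp T z.1) (clip M z.2)) (fun N : 'M[R]_k => N i j) _ _ _ Ac); exact: coord_continuous.
Qed.

(** A(t, phi) phi need not be globally Lipschitz, as the increment of A is multiplied by phi;
    clipping bounds that factor by M. The order of quantifiers matters: the growth constant [L1]
    does not depend on M, the Lipschitz constant [K] does. *)
Lemma clip_drift_bounds : exists2 L1, 0 < L1 & forall M, 0 <= M ->
  (forall t c, `|clip_drift M t c| <= L1 * (1 + `|c|)) /\
  exists2 K, 0 < K & forall t c c', `|clip_drift M t c| <= K /\
    `|clip_drift M t c - clip_drift M t c'| <= K * `|c - c'|.
Proof.
have [a a0 h] := drift_bounds.
pose n := k.+1%:R : R.
have n1 : 1 <= n by rewrite ler1n.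
have kn : k%:R <= n by rewrite ler_nat.
have growth M : 0 <= M -> forall t c, `|clip_drift M t c| <= n * a * (1 + `|clip M c|).
  move=> M0 t c; have [h1 _ h3 _] := h _ (clip M c) 0 (clamp_itv T0 t).
  rewrite /clip_drift /drift (le_trans (ler_normD _ _)) // mulrDr mulr1 addrC lerD //.
    by apply: (le_trans (norm_le_enorm _)); apply: (le_trans h3); rewrite ler_peMl.
  apply: (le_trans (mulmx_trmx_le _ _)); rewrite mulrAC ler_wpM2r //.
  by rewrite ler_pM // enorm_ge0.
have na : 0 <= n * a by rewrite mulr_ge0 // ler0n.
exists (n * a + 1); first by rewrite ltr_wpDl.
move=> M M0; split=> [t c|].
  apply: (le_trans (growth M M0 t c)); rewrite ler_pM ?addr_ge0 // ?lerDl //.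
  by rewrite lerD2l clip_le_norm.
pose K := n * a * (1 + M) + (n * a * (1 + n * M) + n * a) + 1.
have n0 : 0 <= n by exact: le_trans ler01 n1.
have K1 : 0 <= n * a * (1 + M) by rewrite mulr_ge0 // addr_ge0.
have K2 : 0 <= n * a * (1 + n * M) by rewrite mulr_ge0 // addr_ge0 // mulr_ge0.
exists K; first by rewrite ltr_wpDl // !addr_ge0.
move=> t c c'; split.
  apply: (le_trans (growth M M0 t c)); apply: (@le_trans _ _ (n * a * (1 + M))).
    by rewrite ler_wpM2l // lerD2l clip_le.
  rewrite /K; lra.
have [h1 h2 h3 h4] := h _ (clip M c) (clip M c') (clamp_itv T0 t).
have cd := clip_lip M c c'.
have ed : enorm (clip M c - clip M c') <= n * `|c - c'|.
  by apply: (le_trans (enorm_le_norm _)); rewrite ler_wpM2l.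
have -> : clip_drift M t c - clip_drift M t c' =
    (clip M c - clip M c') *m (A (clamp T t) (clip M c))^T +
    clip M c' *m (A (clamp T t) (clip M c) - A (clamp T t) (clip M c'))^T +
    (B (clamp T t) (clip M c) - B (clamp T t) (clip M c')).
  rewrite /clip_drift /drift linearB /= mulmxBl mulmxBr.
  by rewrite subrKA opprD addrACA.
have e1 : `|(clip M c - clip M c') *m (A (clamp T t) (clip M c))^T| <= n * a * `|c - c'|.
  apply: (le_trans (mulmx_trmx_le _ _)); rewrite [n * a * _]mulrAC.
  by rewrite !ler_pM ?mulr_ge0 ?enorm_ge0.
have e2 : `|clip M c' *m (A (clamp T t) (clip M c) - A (clamp T t) (clip M c'))^T| <= n * a * (n * M) * `|c - c'|.
  apply: (le_trans (mulmx_trmx_le _ _)).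
  have -> : n * a * (n * M) * `|c - c'| = n * M * (a * (n * `|c - c'|)) by ring.
  rewrite !ler_pM ?mulr_ge0 ?enorm_ge0 ?clip_le //.
  by apply: (le_trans h2); rewrite ler_wpM2l.
have e3 : `|B (clamp T t) (clip M c) - B (clamp T t) (clip M c')| <= n * a * `|c - c'|.
  apply: (le_trans (norm_le_enorm _)); apply: (le_trans h4).
  by rewrite [n * a]mulrC -mulrA ler_wpM2l.
apply: (le_trans (ler_normD _ _)); apply: (le_trans (lerD (ler_normD _ _) (lexx _))).
apply: (le_trans (lerD (lerD e1 e2) e3)).
have := normr_ge0 (c - c'); have := mulr_ge0 K1 (normr_ge0 (c - c')); rewrite /K; nra.
Qed.

End truncated_drift.

(** * Limits along ultrafilters *)

Lemma fmap_ultra (S W : Type) (F : set_system S) (f : S -> W) : UltraFilter F -> UltraFilter (f @ F).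
Proof.
move=> UF; apply: Build_UltraFilter => G PG FG; apply/seteqP; split=> [A GA|A FA]; last exact: FG.
have [//|h] := in_ultra_setVsetC (f @^-1` A) UF.
have GN : G (~` A) by apply: FG.
have GI : G (A `&` ~` A) by exact: filterI.
by have /filter_ex[x []] := GI.
Qed.

Lemma ultra_bounded_cvg (R : realType) n (U : set_system nat) (u : nat -> 'rV[R]_n) M :
  UltraFilter U -> (forall i, `|u i| <= M) -> exists l : 'rV[R]_n, u i @[i --> U] --> l.
Proof.
move=> UU uM; have := @rV_ball_compact R n M; rewrite compact_ultra => /(_ (u @ U) (fmap_ultra u UU)).
have h : (u @ U) [set x | `|x| <= M].
  by apply: (@filterS _ U _ setT) => [i _|]; [exact: uM|exact: filterT].
by move=> /(_ h) [l [_ ul]]; exists l.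
Qed.

Lemma ultra_bounded_cvgR (R : realType) (U : set_system nat) (u : nat -> R) M :
  UltraFilter U -> (forall i, `|u i| <= M) -> exists l : R, u i @[i --> U] --> l.
Proof.
move=> UU uM; have := @segment_compact R (- M) M; rewrite compact_ultra => /(_ (u @ U) (fmap_ultra u UU)).
have h : (u @ U) `[- M, M]%classic.
  apply: (@filterS _ U _ setT) => [i _|]; last exact: filterT.
  by rewrite /= in_itv /= -ler_norml; exact: uM.
by move=> /(_ h) [l [_ ul]]; exists l.
Qed.

Lemma cell_dist (R : realDomainType) (u v w M : R) :
  u <= w + M -> w + M < u + v -> 0 <= v -> `|u - M - w| <= v.
Proof. by move=> h1 h2 h3; rewrite ler_norml; apply/andP; split; lra. Qed.

(** * The fixed point *)

Section quantisation.
Variables (R : realType) (d : nat).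
Local Notation V := 'rV[R]_d.

(** Coordinates are clipped to [-n, n] and rounded down to multiples of 1 / (n + 1). *)
Lemma quantise (n : nat) : exists (p : nat) (code : V -> 'I_p) (node : 'I_p -> V),
  [/\ forall j, measurable (code @^-1` [set j]),
      forall x, `|node (code x)| <= `|x| + 1 &
      forall x, `|x| <= n%:R -> `|node (code x) - x| <= n.+1%:R^-1].
Proof.
pose N := n.+1%:R : R; have N0 : 0 < N by rewrite ltr0n.
pose M := n%:R : R; have M0 : 0 <= M by rewrite ler0n.
pose lev (a : R) : nat := Num.truncn (N * (Num.max (- M) (Num.min a M) + M)).
(* The interval [-n, n] has 2 n (n + 1) steps of length 1 / (n + 1), hence one more level than
   steps, as the right end is attained. *)
pose J := (n.+1 * (2 * n)).+1.
have arg0 a : 0 <= N * (Num.max (- M) (Num.min a M) + M).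
  by rewrite mulr_ge0 ?(ltW N0) // -lerBlDr sub0r le_max lexx.
have levJ a : (lev a < J)%N.
  rewrite ltnS -(ler_nat R); have /andP[h _] := truncn_itv (arg0 a).
  apply: (le_trans h); rewrite natrM ler_wpM2l ?(ltW N0) // natrM.
  have : Num.max (- M) (Num.min a M) <= M by rewrite ge_max ge_min lexx orbT andbT; lra.
  rewrite -/M; lra.
pose code (x : V) : {ffun 'I_d -> 'I_J} := [ffun i => Ordinal (levJ (x 0 i))].
pose nd (c : {ffun 'I_d -> 'I_J}) : V := \row_i ((c i)%:R / N - M).
exists #|{ffun 'I_d -> 'I_J}|, (fun x => enum_rank (code x)), (fun j => nd (enum_val j)).
have near_clip x i : `|nd (code x) 0 i - clip M x 0 i| <= N^-1.
  rewrite !mxE ffunE /=; have /andP[h1 h2] := truncn_itv (arg0 (x 0 i)).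
  rewrite -/(lev _) in h1 h2; set l := lev _ in h1 h2 *; set a := Num.max _ _ in h1 h2 *.
  have h1' : l%:R / N <= a + M by rewrite ler_pdivrMr // mulrC.
  have h2' : a + M < (l%:R + 1) / N by rewrite ltr_pdivlMr // mulrC natr1.
  rewrite mulrDl mul1r in h2'.
  have Ni : 0 <= N^-1 by rewrite invr_ge0 ltW.
  exact: cell_dist h1' h2' Ni.
have clip_le' x : `|clip M x| <= `|x| by exact: clip_le_norm.
split=> [j|x|x xn]; rewrite ?enum_rankK.
- have -> : (fun x => enum_rank (code x)) @^-1` [set j] =
      \bigcap_(i in [set: 'I_d]) [set x : V | lev (x 0 i) = enum_val j i].
    apply/seteqP; split=> x /= h.
      by move=> i _ /=; rewrite -h enum_rankK ffunE.
    rewrite -[RHS]enum_valK; congr enum_rank; apply/ffunP => i; rewrite ffunE.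
    by apply/val_inj => /=; exact: h.
  apply: fin_bigcap_measurable => [|i _]; first exact: finite_finset.
  have -> : [set x : V | lev (x 0 i) = enum_val j i] =
      (fun x : V => N * (clip M x 0 i + M)) @^-1`
        `[(enum_val j i)%:R, (enum_val j i).+1%:R[%classic.
    apply/seteqP; split=> x /=; rewrite in_itv /= mxE.
      by move=> <-; exact: truncn_itv.
    by move=> h; apply: truncn_def.
  rewrite -[X in measurable X]setTI; apply: continuous_measurable => //.
  move=> x; apply: cvgM; first exact: cvg_cst.
  apply: cvgD; last exact: cvg_cst.
  by apply: cvg_coord; apply: clip_cvg => //; exact: cvg_id.
- have -> : nd (code x) = clip M x + (nd (code x) - clip M x) by rewrite addrC subrK.
  rewrite (le_trans (ler_normD _ _)) // lerD //.
  apply: rV_norm_le => // i; rewrite mxE [X in _ + X]mxE; apply: (le_trans (near_clip x i)).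
  by rewrite invf_le1 // ler1n.
- rewrite -{2}(clip_id xn); apply: rV_norm_le => [|i]; first by rewrite invr_ge0.
  by rewrite mxE [X in _ + X]mxE; exact: near_clip.
Qed.

End quantisation.

(** Equi-Lipschitz bounds near y0 upgrade convergence at the point y0 to convergence jointly in
    index and point, the form that [char_stable] asks for. *)
Lemma joint_cvg (R : realType) (n p : nat) (I : Type) (F : set_system I) {FF : Filter F}
    (gi : I -> 'rV[R]_n -> 'rV[R]_p) (g : 'rV[R]_n -> 'rV[R]_p) y0 L :
  (\forall i \near F, forall y y', `|y| <= `|y0| + 1 -> `|y'| <= `|y0| + 1 ->
    `|gi i y - gi i y'| <= L * `|y - y'|) ->
  gi i y0 @[i --> F] --> g y0 ->
  gi z.1 z.2 @[z --> filter_prod F (nbhs y0)] --> g y0.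
Proof.
move=> lip c; apply/cvgrPdist_le => e e0.
pose L' := `|L| + 1; have L'0 : 0 < L' by rewrite ltr_wpDl.
have e2 : 0 < e / 2 by rewrite divr_gt0.
pose dl := Num.min 1 (e / 2 / L').
have dl0 : 0 < dl by rewrite lt_min ltr01 divr_gt0.
move/cvgrPdist_le/(_ _ e2): c => c.
have nI : \forall z \near filter_prod F (nbhs y0), `|g y0 - gi z.1 y0| <= e / 2 /\
    forall y y', `|y| <= `|y0| + 1 -> `|y'| <= `|y0| + 1 -> `|gi z.1 y - gi z.1 y'| <= L * `|y - y'|.
  exact: (@cvg_fst _ _ F (nbhs y0) _ _ (filterI c lip)).
have nY : \forall z \near filter_prod F (nbhs y0), `|y0 - z.2| < dl.
  have nb : nbhs y0 (fun y => `|y0 - y| < dl).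
    by apply/nbhs_ballP; exists dl => // z; rewrite -ball_normE.
  exact: (@cvg_snd _ _ F (nbhs y0) _ _ nb).
apply: filterS2 nI nY => -[i y] /= [h1 h2] h3.
have h4 : `|y0 - y| <= 1 by apply: ltW; apply: lt_le_trans h3 _; rewrite ge_min lexx.
have h5 : `|y0 - y| <= e / 2 / L' by apply: ltW; apply: lt_le_trans h3 _; rewrite ge_min lexx orbT.
have yb : `|y| <= `|y0| + 1.
  by rewrite -[y](subKr y0) (le_trans (ler_normB _ _)) // lerD2l.
have h6 := h2 y0 y (ler_wpDr ler01 (lexx _)) yb.
rewrite -(subrKA (gi i y0)) (le_trans (ler_normD _ _)) // [e]splitr; apply: lerD => //.
apply: (le_trans h6); apply: (@le_trans _ _ (L' * `|y0 - y|)).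
  by rewrite ler_wpM2r // (le_trans (ler_norm _)) // lerDl.
by rewrite mulrC -ler_pdivlMr.
Qed.

Lemma modulus_cvg0 (R : realType) (w : R -> R) (u : nat -> R) : modulus w ->
  (forall n, 0 <= u n) -> u n @[n --> \oo] --> 0 -> w (u n) @[n --> \oo] --> 0.
Proof.
move=> [cw _ w0] u0 uc.
have c : w s @[s --> within `[0, +oo[ (nbhs (0 : R))] --> w 0.
  by move/subspace_continuousP: cw; apply; rewrite /= in_itv /= lexx.
rewrite w0 in c => P nP.
have h : nbhs (0 : R) (fun s => `[0, +oo[%classic s -> P (w s)) := c P nP.
have h2 : \forall n \near \oo, `[0, +oo[%classic (u n) -> P (w (u n)) := uc _ h.
apply: (@filterS _ \oo _ _ _ _ h2) => n; apply.
by rewrite /= in_itv /= u0.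
Qed.

(** * Dependence of the terminal data on the final law *)

Section mean_field.
Variables (R : realType) (d k : nat) (T q r : R).
Local Notation V := 'rV[R]_d.
Local Notation Z := 'rV[R]_k.
Variable G : V -> probability V R -> R.
Variable m0 : probability V R.
Variable Phi : R -> V -> V -> Z.
Variable C : R.
Let gamma := r / (q - 1).
Let q' := q / (q - 1).
Hypotheses (q1 : 1 < q) (qr : q <= r) (C0 : 0 <= C).
Hypothesis m0_moment : finite_moment gamma m0.
Hypothesis Phi_cont : continuous (fun z : V * V => Phi T z.1 z.2).
Hypothesis Phi_bound : forall y p, `|Phi T y p| <= C * (1 + `|p| `^ r).
Hypothesis G_convex : forall m, finite_moment gamma m -> convex_C1 (G^~ m) (DG G ^~ m).
Hypothesis G_bound : forall m, finite_moment gamma m -> forall z,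
  `|G z m| <= C * (1 + `|z| `^ q') /\ `|DG G z m| <= C * (1 + `|z| `^ (q' - 1)).
Hypothesis G_lip : forall b, 0 <= b -> exists2 L, 0 <= L & forall m, finite_moment gamma m ->
  forall y y', `|y| <= b -> `|y'| <= b -> `|DG G y m - DG G y' m| <= L * `|y - y'|.
Hypothesis G_modulus : exists2 omega : R -> R, modulus omega & exists2 D : R, 0 < D &
    forall m1 m2, finite_moment gamma m1 -> finite_moment gamma m2 ->
    forall x,
      `|G x m1 - G x m2| + enorm (DG G x m1 - DG G x m2) <=
      D * (1 + enorm x `^ q') * omega (wasserstein gamma m1 m2).

Lemma gamma_gt0 : 0 < gamma.
Proof. by rewrite divr_gt0 ?subr_gt0 // (lt_le_trans _ qr) // (lt_trans ltr01). Qed.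

Lemma gamma_ge1 : 1 <= gamma.
Proof. by rewrite ler_pdivlMr ?subr_gt0 // mul1r (le_trans _ qr) // gerBl. Qed.

Lemma q'1E : q' - 1 = (q - 1)^-1.
Proof. by rewrite /q'; field; rewrite subr_eq0 gt_eqF. Qed.

Lemma iweight : m0.-integrable setT (EFin \o weight gamma).
Proof. exact: weight_integrable (ltW gamma_gt0) m0_moment. Qed.

(** |DG| grows like |y|^(q' - 1) and Phi like |p|^r; the exponents match since (q' - 1) r = r / (q -
    1) = gamma. *)
Lemma Phi_DG_bound : exists2 D, 0 <= D & forall m, finite_moment gamma m ->
  forall y, `|Phi T y (DG G y m)| <= D * weight gamma y.
Proof.
have r0 : 0 <= r by rewrite (le_trans _ qr) // (le_trans ler01) // ltW.
exists (C * (1 + (2 * C) `^ r)); first by rewrite mulr_ge0 // addr_ge0 // powR_ge0.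
move=> m mm y; have w1 : 1 <= weight gamma y.
  rewrite -(powRr0 (1 + `|y|)); apply: ler_powR; [by rewrite lerDl|exact: ltW gamma_gt0].
apply: (le_trans (Phi_bound _ _)); rewrite -mulrA ler_wpM2l // mulrDl mul1r lerD //.
have [_ h] := G_bound mm y.
have e0 : 0 <= (q - 1)^-1 by rewrite invr_ge0 subr_ge0 ltW.
have h2 : `|DG G y m| <= 2 * C * (1 + `|y|) `^ (q - 1)^-1.
  apply: (le_trans h); rewrite q'1E [2 * C]mulrC -mulrA ler_wpM2l //.
  have a1 : 1 <= (1 + `|y|) `^ (q - 1)^-1.
    have y1 : 1 <= 1 + `|y| by rewrite lerDl.
    by have := ler_powR y1 e0; rewrite powRr0.
  have a2 : `|y| `^ (q - 1)^-1 <= (1 + `|y|) `^ (q - 1)^-1.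
    by apply: powR_le => //; rewrite normr_ge0 /= lerDr.
  by lra.
apply: (@le_trans _ _ ((2 * C * (1 + `|y|) `^ (q - 1)^-1) `^ r)).
  by apply: powR_le => //; rewrite normr_ge0.
by rewrite powRM ?mulr_ge0 ?powR_ge0 // -powRrM /weight /gamma [_^-1 * r]mulrC.
Qed.

Section law_bounds.
Variable K : R.
Hypothesis K0 : 0 <= K.

Lemma weight_law (x y : V) : `|y| <= K * (1 + `|x|) -> weight gamma y <= (1 + K) `^ gamma * weight gamma x.
Proof.
move=> yK; rewrite /weight -powRM ?addr_ge0 //; apply: powR_le; first exact: ltW gamma_gt0.
rewrite addr_ge0 //=; have := normr_ge0 x; nra.
Qed.

Lemma law_moment f m : law m0 f m -> (forall x, `|f x| <= K * (1 + `|x|)) -> finite_moment gamma m.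
Proof. by move=> lf fK; exact: (finite_moment_law (ltW gamma_gt0) K0 m0_moment lf fK). Qed.

Lemma Phi_DG_measurable m i : finite_moment gamma m ->
  measurable_fun setT (fun y => Phi T y (DG G y m) 0 i).
Proof.
move=> mm; apply: continuous_measurable => y; apply: cvg_coord.
have c : {for (y, DG G y m), continuous (fun z : V * V => Phi T z.1 z.2)} by exact: Phi_cont.
apply: (@cvg_comp _ _ _ (fun y => (y, DG G y m)) (fun z : V * V => Phi T z.1 z.2) (nbhs y) (nbhs (y, DG G y m)) _ _ c).
by apply: cvg_pair_nbhs; [exact: cvg_id|exact: (G_convex mm).2].
Qed.

Lemma Phi_DG_law f m : law m0 f m -> (forall x, `|f x| <= K * (1 + `|x|)) -> forall i,
  [/\ measurable_fun setT (fun x => Phi T (f x) (DG G (f x) m) 0 i),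
      m0.-integrable setT (EFin \o (fun x => Phi T (f x) (DG G (f x) m) 0 i)) &
      terminal_phi G T Phi m 0 i = \int[m0]_x Phi T (f x) (DG G (f x) m) 0 i].
Proof.
move=> lf fK i; have mm := law_moment lf fK.
have [D D0 hD] := Phi_DG_bound.
have mF := Phi_DG_measurable i mm.
have mFf : measurable_fun setT (fun x => Phi T (f x) (DG G (f x) m) 0 i).
  exact: (measurableT_comp mF lf.1).
have iF : m0.-integrable setT (EFin \o (fun x => Phi T (f x) (DG G (f x) m) 0 i)).
  apply: le_integrable (integrableZl measurableT (D * (1 + K) `^ gamma) iweight) => //.
    exact/measurable_EFinP.
  move=> x _ /=; rewrite lee_fin [leRHS]ger0_norm ?mulr_ge0 ?powR_ge0 //.
  apply: (le_trans (rV_coord_le _ _)); apply: (le_trans (hD _ mm _)).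
  by rewrite -mulrA ler_wpM2l // weight_law.
split=> //; rewrite mxE.
exact: (law_Rintegral lf mF iF).
Qed.

Lemma terminal_phi_bound : exists2 c, 0 <= c & forall f m, law m0 f m ->
  (forall x, `|f x| <= K * (1 + `|x|)) -> `|terminal_phi G T Phi m| <= c.
Proof.
have [D D0 hD] := Phi_DG_bound.
have I0 : 0 <= \int[m0]_x weight gamma x by apply: Rintegral_ge0 => x _; exact: powR_ge0.
exists (D * (1 + K) `^ gamma * \int[m0]_x weight gamma x).
  by rewrite !mulr_ge0 // powR_ge0.
move=> f m lf fK; have mm := law_moment lf fK.
apply: rV_norm_le => [|i]; first by rewrite !mulr_ge0 // powR_ge0.
have [mF iF ->] := Phi_DG_law lf fK i.
apply: (le_trans (le_normr_Rintegral measurableT iF)).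
rewrite -RintegralZl //; last exact: iweight.
apply: le_Rintegral => //.
- exact: (integrable_norm iF).
- exact: (integrableZl measurableT (D * (1 + K) `^ gamma) iweight).
- move=> x _; apply: (le_trans (rV_coord_le _ _)); apply: (le_trans (hD _ mm _)).
  by rewrite -mulrA ler_wpM2l // weight_law.
Qed.

Section law_limits.
Variables (f_ : nat -> V -> V) (f : V -> V) (m_ : nat -> probability V R) (m : probability V R).
Hypothesis lf_ : forall n, law m0 (f_ n) (m_ n).
Hypothesis lf : law m0 f m.
Hypothesis fK_ : forall n x, `|f_ n x| <= K * (1 + `|x|).
Hypothesis fc : forall x, f_ n x @[n --> \oo] --> f x.

Lemma law_limit_bound x : `|f x| <= K * (1 + `|x|).
Proof.
have nx : `|f_ n x| @[n --> \oo] --> `|f x| by apply: cvg_norm; exact: fc.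
by apply: (cvgr_to_le nx); apply: nearW => n; exact: fK_.
Qed.

Lemma law_limit_G x : G x (m_ n) @[n --> \oo] --> G x m /\ DG G x (m_ n) @[n --> \oo] --> DG G x m.
Proof.
have mm_ n := law_moment (lf_ n) (fK_ n); have mm := law_moment lf law_limit_bound.
have Wc := wasserstein_cvg gamma_gt0 m0_moment K0 lf_ lf fK_ fc.
have [w wm [D D0 hG]] := G_modulus.
have c := modulus_cvg0 wm (fun n => wasserstein_ge0 gamma (m_ n) m) Wc.
have {}c : D * (1 + enorm x `^ q') * w (wasserstein gamma (m_ n) m) @[n --> \oo] --> D * (1 + enorm x `^ q') * 0.
  by apply: cvgM => //; exact: cvg_cst.
rewrite mulr0 in c.
split; apply/cvgrPdist_le => e e0; move/cvgrPdist_le/(_ _ e0): c.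
  apply: (@filterS _ \oo) => n; rewrite sub0r normrN => h.
  apply: le_trans (le_trans (ler_norm _) h); apply: le_trans (hG _ _ (mm_ n) mm x).
  by rewrite distrC lerDl enorm_ge0.
apply: (@filterS _ \oo) => n; rewrite sub0r normrN => h.
apply: le_trans (le_trans (ler_norm _) h); apply: le_trans (hG _ _ (mm_ n) mm x).
by rewrite distrC (le_trans (norm_le_enorm _)) // lerDr.
Qed.

Lemma law_limit_DG y0 : DG G z.2 (m_ z.1) @[z --> filter_prod \oo (nbhs y0)] --> DG G y0 m.
Proof.
have mm_ n := law_moment (lf_ n) (fK_ n).
have [L L0 hL] := G_lip (addr_ge0 (normr_ge0 y0) ler01).
apply: (@joint_cvg R d d nat \oo _ (fun n y => DG G y (m_ n)) (fun y => DG G y m) y0 L).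
  by apply: nearW => n y y'; exact: hL.
exact: (law_limit_G y0).2.
Qed.

(** The integrals are pulled back to [m0], so that laws varying with n become integrands varying
    with n and dominated convergence applies. *)
Lemma law_limit_phi : terminal_phi G T Phi (m_ n) @[n --> \oo] --> terminal_phi G T Phi m.
Proof.
have mm_ n := law_moment (lf_ n) (fK_ n); have mm := law_moment lf law_limit_bound.
have [D D0 hD] := Phi_DG_bound.
apply: cvg_rV => i.
have [mF iF ->] := Phi_DG_law lf law_limit_bound i.
have -> : (fun n => terminal_phi G T Phi (m_ n) 0 i) =
    (fun n => \int[m0]_x Phi T (f_ n x) (DG G (f_ n x) (m_ n)) 0 i).
  by apply/funext => n; have [_ _ ->] := Phi_DG_law (lf_ n) (fK_ n) i.
have [||||_] := @Rintegral_cvg _ _ m0 gamma (fun n x => Phi T (f_ n x) (DG G (f_ n x) (m_ n)) 0 i)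
  (fun x => Phi T (f x) (DG G (f x) m) 0 i) (D * (1 + K) `^ gamma) iweight => //.
- by move=> n; have [] := Phi_DG_law (lf_ n) (fK_ n) i.
- move=> n x; apply: (le_trans (rV_coord_le _ _)); apply: (le_trans (hD _ (mm_ n) _)).
  by rewrite -mulrA ler_wpM2l // weight_law.
- move=> x; apply: cvg_coord.
  have c : {for (f x, DG G (f x) m), continuous (fun z : V * V => Phi T z.1 z.2)} by exact: Phi_cont.
  apply: (@cvg_comp _ _ _ (fun n => (f_ n x, DG G (f_ n x) (m_ n))) (fun z : V * V => Phi T z.1 z.2) \oo (nbhs (f x, DG G (f x) m)) _ _ c).
  apply: cvg_pair_nbhs; first exact: fc.
  apply: (@cvg_comp _ _ _ (fun n => (n, f_ n x)) (fun z : nat * V => DG G z.2 (m_ z.1)) \oo (filter_prod \oo (nbhs (f x)))); last exact: law_limit_DG.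
  by apply: cvg_pair_filter; [exact: cvg_id|exact: fc].
Qed.

End law_limits.
End law_bounds.

(** * Feet of characteristics and their fixed point *)

Section fixed_point.
Variables (h : V -> Z -> R) (hp : V -> Z -> V) (sol : Z -> R -> Z) (B W : R).
Hypotheses (T0 : 0 < T) (B0 : 0 <= B).
Hypothesis h_convex : forall c, convex_C1 (h^~ c) (hp^~ c).
Hypothesis h_cont : continuous (fun z : V * Z => h z.1 z.2).
Hypothesis hp_cont : continuous (fun z : V * Z => hp z.1 z.2).
Hypothesis hpB : forall p c, `|hp p c| <= B * (1 + `|p| `^ (q - 1)).
Hypothesis sol_cont : forall c, continuous (sol c).
Hypothesis sol_lip : forall c c' t, 0 <= t <= T -> `|sol c t - sol c' t| <= `|c - c'| * W.

Let z0T : 0 <= (0 : R) <= T. Proof. by rewrite lexx ltW. Qed.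

Lemma sol_cvg (I : Type) (F : set_system I) {FF : Filter F} (c : I -> Z) (t : I -> R) c0 t0 :
  c i @[i --> F] --> c0 -> t i @[i --> F] --> t0 ->
  sol (c i) (clamp T (t i)) @[i --> F] --> sol c0 (clamp T t0).
Proof.
move=> cc tt; apply/cvgrPdist_le => e e0.
have e2 : 0 < e / 2 by rewrite divr_gt0.
have W1 : 0 < `|W| + 1 by rewrite ltr_wpDl.
have e3 : 0 < e / 2 / (`|W| + 1) by rewrite divr_gt0.
have sc : sol c0 (clamp T (t i)) @[i --> F] --> sol c0 (clamp T t0).
  have ct : clamp T (t i) @[i --> F] --> clamp T t0.
    by apply: (@cvg_comp _ _ _ t (clamp T) F (nbhs t0)) => //; exact: clamp_continuous.
  by apply: (@cvg_comp _ _ _ (fun i => clamp T (t i)) (sol c0) F (nbhs (clamp T t0))) => //; exact: sol_cont.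
move/cvgrPdist_le/(_ _ e2): sc => n1; move/cvgrPdist_le/(_ _ e3): cc => n2.
apply: filterS2 n1 n2 => i h1 h2.
rewrite -(subrKA (sol c0 (clamp T (t i)))) (le_trans (ler_normD _ _)) // [e]splitr lerD //.
apply: (le_trans (sol_lip _ _ (clamp_itv T0 _))).
apply: (@le_trans _ _ (`|c0 - c i| * (`|W| + 1))).
  by rewrite ler_wpM2l // (le_trans (ler_norm _)) // lerDl.
by rewrite -ler_pdivlMr.
Qed.

Lemma hopf_s_stable (I : Type) (F : set_system I) {FF : Filter F} (c : I -> Z) c0 p0 :
  c i @[i --> F] --> c0 ->
  hopf_s T hp (sol (c z.1)) 0 z.2 @[z --> filter_prod F (nbhs p0)] --> hopf_s T hp (sol c0) 0 p0.
Proof.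
move=> cc; pose GG := filter_prod F (nbhs p0); apply/cvgrPdist_le => e e0.
have e1 : 0 < e / T by rewrite divr_gt0.
have cov := (compact_near_coveringP _).1 (@segment_compact R 0 T) (I * V)%type GG
  (fun z s => `|hp p0 (sol c0 (clamp T s)) - hp z.2 (sol (c z.1) (clamp T s))| <= e / T) _.
have {cov} unif : \forall z \near GG, `[0, T] `<=`
    (fun s => `|hp p0 (sol c0 (clamp T s)) - hp z.2 (sol (c z.1) (clamp T s))| <= e / T).
  apply: cov => s _.
  have conv : hp p0 (sol c0 (clamp T z.1)) - hp z.2.2 (sol (c z.2.1) (clamp T z.1))
      @[z --> filter_prod (nbhs s) GG] --> hp p0 (sol c0 (clamp T s)) - hp p0 (sol c0 (clamp T s)).
    have hpc (I' : Type) (F' : set_system I') (FF' : Filter F') (p : I' -> V) (w : I' -> Z) w0 :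
        p i @[i --> F'] --> p0 -> w i @[i --> F'] --> w0 -> hp (p i) (w i) @[i --> F'] --> hp p0 w0.
      move=> pp ww; have ch : {for (p0, w0), continuous (fun z : V * Z => hp z.1 z.2)} by exact: hp_cont.
      apply: (@cvg_comp _ _ _ (fun i => (p i, w i)) (fun z : V * Z => hp z.1 z.2) F' (nbhs (p0, w0)) _ _ ch).
      exact: cvg_pair_nbhs.
    apply: cvgB; apply: hpc.
    - exact: cvg_cst.
    - by apply: (@sol_cvg _ _ _ (fun=> c0) fst); [exact: cvg_cst|exact: cvg_fst].
    - by apply: (@cvg_comp _ _ _ (snd : R * (I * V) -> I * V) (snd : I * V -> V) _ GG); [exact: cvg_snd|exact: cvg_snd].
    - apply: (@sol_cvg _ _ _ (fun z => c z.2.1) fst); last exact: cvg_fst.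
      apply: (@cvg_comp _ _ _ (snd : R * (I * V) -> I * V) (fun z => c z.1) _ GG); first exact: cvg_snd.
      by apply: (@cvg_comp _ _ _ (fst : I * V -> I) c GG F); [exact: cvg_fst|].
  have /cvgr_dist_le/(_ _ e1) := conv.
  by apply: filterS => z; rewrite subrr sub0r normrN.
apply: filterS unif => z un.
apply: (@le_trans _ _ (e / T * (T - 0))); last by rewrite subr0 divfK // gt_eqF.
apply: vint_dist; [exact: hp_phi_cont|exact: hp_phi_cont|exact: ltW|exact: ltW|].
move=> s sT; have := un s; rewrite /= in_itv /= clamp_id //; exact.
Qed.

(* The bounds are those that make the characteristics grow linearly. *)
Definition regular_cost (G' : V -> R) (g' : V -> V) :=
  [/\ convex_C1 G' g', forall z, `|G' z| <= C * (1 + `|z| `^ q') & `|g' 0| <= C].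

(** [char_bound] is uniform in the cost and in the path, so one K serves all candidates for the
    fixed point. *)
Lemma foot_bound : exists2 K, 0 < K & forall G' g' (w : R -> Z) x, continuous w ->
  regular_cost G' g' -> `|hopf_Y T hp w g' 0 x| <= K * (1 + `|x|).
Proof.
have TB0 : 0 <= T * B by rewrite mulr_ge0 // ltW.
have [K K0 hK] := @char_bound R d C (T * B) q q' C0 TB0 q1 erefl.
exists K => // G' g' w x cw [c1 c2 c3].
apply: (hK G' g' (hopf_s T hp w 0) x _ c1 _ c2 c3 _ _).2.
- by move=> p p'; apply: (hopf_s_mono T0 cw h_convex h_cont hp_cont B0 hpB); exact: z0T.
- by move=> p; apply: (hopf_s_le cw hp_cont B0 hpB); exact: z0T.
- exact: (hopf_YP T0 cw h_convex h_cont hp_cont B0 hpB c1 x z0T).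
Qed.

Lemma foot_stable (I : Type) (F : set_system I) {FF : Filter F} (Gi : I -> V -> R)
    (gi : I -> V -> V) G' g' (c : I -> Z) c0 (x : I -> V) x0 :
  (\forall i \near F, regular_cost (Gi i) (gi i)) -> convex_C1 G' g' ->
  (forall y0, gi z.1 z.2 @[z --> filter_prod F (nbhs y0)] --> g' y0) ->
  c i @[i --> F] --> c0 -> x i @[i --> F] --> x0 ->
  hopf_Y T hp (sol (c i)) (gi i) 0 (x i) @[i --> F] --> hopf_Y T hp (sol c0) g' 0 x0.
Proof.
move=> reg c' gg cc xx; have [K K0 hK] := foot_bound.
apply: (@char_stable R d I F FF gi (fun i => hopf_s T hp (sol (c i)) 0) x
  (fun i => hopf_Y T hp (sol (c i)) (gi i) 0 (x i)) g' (hopf_s T hp (sol c0) 0) x0 _ (K * (1 + (`|x0| + 1)))).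
- exact: gg.
- by move=> p0; exact: hopf_s_stable.
- exact: xx.
- apply: filterS reg => i [c1 _ _].
  exact: (hopf_YP T0 (@sol_cont (c i)) h_convex h_cont hp_cont B0 hpB c1 (x i) z0T).
- have /cvgrPdist_le/(_ _ ltr01) x1 := xx.
  apply: filterS2 reg x1 => i ri xi; apply: (le_trans (hK _ _ _ _ (@sol_cont _) ri)).
  rewrite ler_pM2l // lerD2l -[x i](subKr x0) (le_trans (ler_normB _ _)) // lerD2l //.
- move=> y' e; exact/esym/(hopf_Y_unique T0 (@sol_cont c0) h_convex h_cont hp_cont B0 hpB c' z0T e).
Qed.

Lemma DG_regular m : finite_moment gamma m -> regular_cost (G^~ m) (DG G ^~ m).
Proof.
move=> mm; split; [exact: G_convex|by move=> z; have [] := G_bound mm z|].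
have [_] := G_bound mm 0; rewrite normr0 powR0 ?addr0 ?mulr1 // q'1E.
by rewrite invr_neq0 // subr_eq0 gt_eqF.
Qed.

(** The final position for the data determined by m; equilibrium means [law m0 (foot m) m]. *)
Definition foot (m : probability V R) (x : V) : V :=
  hopf_Y T hp (sol (terminal_phi G T Phi m)) (DG G ^~ m) 0 x.

(* With the initial positions rounded to finitely many nodes, only the feet of the
   characteristics issued from the nodes matter, a finite-dimensional unknown. *)
Lemma approximate_fixed_point (n : nat) : exists (tau : V -> V) (m : probability V R),
  [/\ forall x, `|tau x| <= `|x| + 1, forall x, `|x| <= n%:R -> `|tau x - x| <= n.+1%:R^-1,
      finite_moment gamma m & law m0 (fun x => foot m (tau x)) m].
Proof.
have [p [code [node [mcode node1 node2]]]] := quantise R d n.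
have [K K0 hK] := foot_bound.
(* A candidate foot map: the rows of [Y] are the feet of the nodes, and x is sent to the row of its
   cell. *)
pose eta (Y : 'M[R]_(p, d)) (x : V) : V := row (code x) Y.
have meta Y : measurable_fun setT (eta Y).
  move=> _ A mA; rewrite setTI.
  have -> : eta Y @^-1` A = \bigcup_(j in [set j | A (row j Y)]) (code @^-1` [set j]).
    apply/seteqP; split=> x /=; first by move=> h1; exists (code x).
    by move=> [j /= h1 h2]; rewrite /eta h2.
  by apply: fin_bigcup_measurable => [|j _]; [exact: finite_finset|exact: mcode].
have [mu hmu] := choice (fun Y => law_exists m0 (meta Y)).
have rowK Y x : `|eta Y x| <= `|mxvec Y|.
  apply: rV_norm_le => // i; rewrite mxE -(mxvecE Y (code x) i); exact: rV_coord_le.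
have rowK1 Y M x : `|mxvec Y| <= M -> `|eta Y x| <= M * (1 + `|x|).
  move=> YM; apply: (le_trans (rowK Y x)); apply: (le_trans YM).
  by rewrite ler_peMr ?lerDl // (le_trans _ YM).
have mmu Y : finite_moment gamma (mu Y) by apply: (law_moment (normr_ge0 (mxvec Y)) (hmu Y)) => x; exact: rowK1.
(* [F] recomputes the feet of the nodes for the law of the candidate, flattened into a row vector
   for Brouwer's theorem. *)
have [F Fcoord] : exists F : 'rV[R]_(p * d) -> 'rV[R]_(p * d),
    forall v j i, F v 0 (mxvec_index j i) = foot (mu (vec_mx v)) (node j) 0 i.
  exists (fun v => mxvec (\matrix_(j, i) foot (mu (vec_mx v)) (node j) 0 i)).
  by move=> v j i; rewrite mxvecE mxE.
pose M := \sum_j K * (1 + `|node j|) + 1.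
have M0 : 0 < M by rewrite ltr_wpDl // sumr_ge0 // => j _; rewrite mulr_ge0 ?addr_ge0 // ltW.
have FM v : `|F v| <= M.
  apply: rV_norm_le; first exact: ltW.
  move=> l; case/mxvec_indexP: l => j i; rewrite Fcoord.
  apply: (le_trans (rV_coord_le _ _)); apply: (le_trans (hK _ _ _ _ (@sol_cont _) (DG_regular (mmu _)))).
  rewrite /M (bigD1 j) //= -addrA lerDl addr_ge0 // sumr_ge0 // => j' _.
  by rewrite mulr_ge0 ?addr_ge0 // ltW.
have Fc : continuous F.
  (* Continuity is checked on sequences, since the dependence of [terminal_phi] on the law rests on
     dominated convergence. *)
  move=> v; suff : F w @[w --> within setT (nbhs v)] --> F v by rewrite withinET.
  apply: within_cvg_seq => u _ uv.
  have [L hL] : exists L, forall i, `|u i| <= L.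
    have /cvg_seq_bounded[L [_ hL]] : cvgn u by apply/cvg_ex; exists v.
    by exists (L + 1) => i; apply: hL; rewrite // ltrDl.
  have L0 : 0 <= L by exact: le_trans (normr_ge0 _) (hL 0%N).
  have b1 i x : `|eta (vec_mx (u i)) x| <= L * (1 + `|x|).
    by apply: rowK1; rewrite vec_mxK.
  have c1 x : eta (vec_mx (u i)) x @[i --> \oo] --> eta (vec_mx v) x.
    apply: cvg_rV => i; rewrite !mxE; under eq_fun do rewrite !mxE.
    exact: cvg_coord.
  have cphi := law_limit_phi L0 (fun i => hmu (vec_mx (u i))) (hmu (vec_mx v)) b1 c1.
  have cDG y0 := law_limit_DG L0 (fun i => hmu (vec_mx (u i))) (hmu (vec_mx v)) b1 c1 (y0 := y0).
  apply: cvg_rV => l; case/mxvec_indexP: l => j i; rewrite (Fcoord v j i).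
  have -> : (fun n => F (u n) 0 (mxvec_index j i)) = (fun n => foot (mu (vec_mx (u n))) (node j) 0 i).
    by apply/funext => n'; exact: Fcoord.
  apply: cvg_coord.
  apply: (@foot_stable nat \oo _ (fun n => G^~ (mu (vec_mx (u n)))) (fun n => DG G ^~ (mu (vec_mx (u n))))
     (G^~ (mu (vec_mx v))) (DG G ^~ (mu (vec_mx v)))) => //.
  - by apply: nearW => n'; exact: DG_regular.
  - exact: G_convex.
  - exact: cvg_cst.
have [v Fv] := brouwer M0 Fc FM.
exists (fun x => node (code x)), (mu (vec_mx v)); split => //.
have -> : (fun x => foot (mu (vec_mx v)) (node (code x))) = eta (vec_mx v); last exact: hmu.
apply/funext => x; apply/rowP => i; rewrite -Fcoord Fv.
by rewrite !mxE.
Qed.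

(** The common local Lipschitz constant of the gradients passes to their pointwise limit. *)
Lemma equi_limit (U : set_system nat) (mn : nat -> probability V R) (g : V -> V) : ProperFilter U ->
  (forall n, finite_moment gamma (mn n)) -> (forall y, DG G y (mn n) @[n --> U] --> g y) ->
  continuous g /\ forall y0, DG G z.2 (mn z.1) @[z --> filter_prod U (nbhs y0)] --> g y0.
Proof.
move=> PU fin gc; split=> y0; have [L L0 hL] := G_lip (addr_ge0 (normr_ge0 y0) ler01).
  have lip : forall y y', `|y| <= `|y0| + 1 -> `|y'| <= `|y0| + 1 -> `|g y - g y'| <= L * `|y - y'|.
    move=> y y' yb y'b; have c : `|DG G y (mn n) - DG G y' (mn n)| @[n --> U] --> `|g y - g y'|.
      by apply: cvg_norm; apply: cvgB; exact: gc.
    by apply: (cvgr_to_le c); apply: nearW => n; exact: (hL _ (fin n)).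
  apply/cvgrPdist_le => e e0.
  have L1 : 0 < L + 1 by rewrite ltr_wpDl.
  have e1 : 0 < e / (L + 1) by rewrite divr_gt0.
  have cid : y @[y --> nbhs y0] --> y0 by exact: cvg_id.
  have /cvgrPdist_le/(_ _ e1) n1 := cid; have /cvgrPdist_le/(_ _ ltr01) n2 := cid.
  apply: filterS2 n1 n2 => y h1 h2.
  apply: (le_trans (lip y0 y _ _)); first by rewrite lerDl.
    by rewrite -[y](subKr y0) (le_trans (ler_normB _ _)) // lerD2l.
  apply: (@le_trans _ _ ((L + 1) * `|y0 - y|)); first by rewrite ler_wpM2r // lerDl.
  by rewrite mulrC -ler_pdivlMr.
apply: (@joint_cvg R d d nat U _ (fun n y => DG G y (mn n)) g y0 L); last exact: gc.
by apply: nearW => n; exact: hL.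
Qed.

Lemma mean_field_fixed_point : exists2 m : probability V R, finite_moment gamma m & law m0 (foot m) m.
Proof.
have [tm htm] : exists tm : nat -> (V -> V) * probability V R, forall n,
    [/\ forall x, `|(tm n).1 x| <= `|x| + 1,
        forall x, `|x| <= n%:R -> `|(tm n).1 x - x| <= n.+1%:R^-1,
        finite_moment gamma (tm n).2 & law m0 (fun x => foot (tm n).2 ((tm n).1 x)) (tm n).2].
  have ex n : exists z : (V -> V) * probability V R,
    [/\ forall x, `|z.1 x| <= `|x| + 1, forall x, `|x| <= n%:R -> `|z.1 x - x| <= n.+1%:R^-1,
        finite_moment gamma z.2 & law m0 (fun x => foot z.2 (z.1 x)) z.2].
    by have [tau [m hm]] := approximate_fixed_point n; exists (tau, m).
  by have [f hf] := choice ex; exists f.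
pose tau n := (tm n).1; pose mn n := (tm n).2.
have fin n : finite_moment gamma (mn n) by have [] := htm n.
have [K K0 hK] := foot_bound.
have K20 : 0 <= 2 * K by rewrite mulr_ge0 // ltW.
have fK n x : `|foot (mn n) (tau n x)| <= 2 * K * (1 + `|x|).
  have [h1 _ _ _] := htm n; have h2 := hK _ _ _ (tau n x) (@sol_cont (terminal_phi G T Phi (mn n))) (DG_regular (fin n)).
  apply: (le_trans h2); rewrite [2 * K]mulrC -mulrA ler_pM2l //.
  have := h1 x; rewrite -/(tau n x); have := normr_ge0 x; lra.
have lawn n : law m0 (fun x => foot (mn n) (tau n x)) (mn n) by have [] := htm n.
have [cb cb0 hcb] := terminal_phi_bound K20.
have cbn n : `|terminal_phi G T Phi (mn n)| <= cb by exact: (hcb _ _ (lawn n) (fK n)).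
(* Bounded quantities converge along an ultrafilter, so G and DG get limits at all points y at once,
   with no diagonal extraction. *)
have [U [UU Uoo]] := @ultraFilterLemma nat \oo _.
have PU : ProperFilter U by exact: ultra_proper.
have [c cc] := ultra_bounded_cvg UU cbn.
have [Gl hGl] : exists Gl : V -> R, forall y, G y (mn n) @[n --> U] --> Gl y.
  have [f hf] := choice (fun y => ultra_bounded_cvgR UU (fun n => (G_bound (fin n) y).1)).
  by exists f.
have [gl hgl] : exists gl : V -> V, forall y, DG G y (mn n) @[n --> U] --> gl y.
  have [f hf] := choice (fun y => ultra_bounded_cvg UU (fun n => (G_bound (fin n) y).2)).
  by exists f.
have [glc gj] := equi_limit PU fin hgl.
have reg : regular_cost Gl gl.
  split.
  - split=> // y z; rewrite -subr_le0.
    have c1 : G y (mn n) + dot (DG G y (mn n)) (z - y) - G z (mn n) @[n --> U] --> Gl y + dot (gl y) (z - y) - Gl z.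
      apply: cvgB; last exact: hGl.
      by apply: cvgD; [exact: hGl|apply: dot_cvg; [exact: hgl|exact: cvg_cst]].
    by apply: (cvgr_to_le c1); apply: nearW => n; rewrite subr_le0; exact: (G_convex (fin n)).1.
  - move=> z; have c1 : `|G z (mn n)| @[n --> U] --> `|Gl z| by apply: cvg_norm; exact: hGl.
    by apply: (cvgr_to_le c1); apply: nearW => n; exact: (G_bound (fin n) z).1.
  - have c1 : `|DG G 0 (mn n)| @[n --> U] --> `|gl 0| by apply: cvg_norm; exact: hgl.
    by apply: (cvgr_to_le c1); apply: nearW => n; have [] := DG_regular (fin n).
have unif (j : nat) : \forall n \near U, forall y, `|y| <= j%:R -> `|DG G y (mn n) - gl y| <= j.+1%:R^-1.
  have e0 : 0 < j.+1%:R^-1 :> R by rewrite invr_gt0.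
  have cov := (compact_near_coveringP _).1 (@rV_ball_compact R d j%:R) nat U
    (fun n y => `|DG G y (mn n) - gl y| <= j.+1%:R^-1) _.
  apply: cov => y0 _.
  have cv : DG G z.1 (mn z.2) - gl z.1 @[z --> filter_prod (nbhs y0) U] --> gl y0 - gl y0.
    apply: cvgB.
      apply: (@cvg_comp _ _ _ (fun z : V * nat => (z.2, z.1)) (fun z : nat * V => DG G z.2 (mn z.1)) _ (filter_prod U (nbhs y0))); last exact: gj.
      by apply: cvg_pair_filter; [exact: cvg_snd|exact: cvg_fst].
    by apply: (@cvg_comp _ _ _ (fst : V * nat -> V) gl _ (nbhs y0)); [exact: cvg_fst|exact: glc].
  have /cvgr_dist_le/(_ _ e0) := cv.
  by apply: filterS => z; rewrite subrr sub0r normrN.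
(* Back to a sequence: n_j is taken in a set of the ultrafilter, with error 1 / (j + 1) for the
   vector and for the gradients on the ball of radius j. *)
have [nj hnj] : exists nj : nat -> nat, forall j, [/\ (j <= nj j)%N,
    `|c - terminal_phi G T Phi (mn (nj j))| <= j.+1%:R^-1 &
    forall y, `|y| <= j%:R -> `|DG G y (mn (nj j)) - gl y| <= j.+1%:R^-1].
  have ex j : exists n, [/\ (j <= n)%N, `|c - terminal_phi G T Phi (mn n)| <= j.+1%:R^-1 &
      forall y, `|y| <= j%:R -> `|DG G y (mn n) - gl y| <= j.+1%:R^-1].
    have e0 : 0 < j.+1%:R^-1 :> R by rewrite invr_gt0.
    have U1 : U [set n | (j <= n)%N] by apply: Uoo; exists j.
    have U2 : U [set n | `|c - terminal_phi G T Phi (mn n)| <= j.+1%:R^-1] by move/cvgrPdist_le/(_ _ e0): cc.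
    have U3 : U ([set n | (j <= n)%N] `&` ([set n | `|c - terminal_phi G T Phi (mn n)| <= j.+1%:R^-1] `&`
       [set n | forall y, `|y| <= j%:R -> `|DG G y (mn n) - gl y| <= j.+1%:R^-1])).
      by apply: filterI => //; apply: filterI => //; exact: unif.
    by have [n [/= h1 [h2 h3]]] := filter_ex U3; exists n.
  by have [f hf] := choice ex; exists f.
have small e : 0 < e -> \forall j \near \oo, j.+1%:R^-1 <= e :> R.
  move=> e0; near=> j; apply: ltW; near: j; exact: near_infty_natSinv_lt (PosNum e0).
have large (y : V) : \forall j \near \oo, `|y| <= j%:R :> R.
  exists (Num.truncn `|y|).+1 => // j /= hj.
  have /andP[_ h1] := truncn_itv (normr_ge0 y); apply: ltW; apply: lt_le_trans h1 _.
  by rewrite ler_nat.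
have cj : terminal_phi G T Phi (mn (nj j)) @[j --> \oo] --> c.
  apply/cvgrPdist_le => e e0; apply: (@filterS _ \oo _ _ _ _ (small e e0)) => j; apply: le_trans.
  by have [] := hnj j.
have gp y : DG G y (mn (nj j)) @[j --> \oo] --> gl y.
  apply/cvgrPdist_le => e e0; apply: (@filterS2 _ \oo _ _ _ _ _ (small e e0) (large y)) => j h1 h2.
  by have [_ _ h3] := hnj j; rewrite distrC (le_trans (h3 y h2)).
have [_ gpj] := equi_limit _ (fun j => fin (nj j)) gp.
have tj x : tau (nj j) x @[j --> \oo] --> x.
  apply/cvgrPdist_le => e e0; apply: (@filterS2 _ \oo _ _ _ _ _ (small e e0) (large x)) => j h1 h2.
  have [h3 _ _] := hnj j; have [_ h4 _ _] := htm (nj j).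
  rewrite distrC; apply: (le_trans (h4 x _)); first by rewrite (le_trans h2) // ler_nat.
  by apply: le_trans h1; rewrite lef_pV2 ?posrE // ler_nat.
(* Built from the limits [c] and [gl] alone; m is then defined as the law of this map. *)
pose f x := hopf_Y T hp (sol c) gl 0 x.
have [cl _ _] := reg.
have fj x : foot (mn (nj j)) (tau (nj j) x) @[j --> \oo] --> f x.
  apply: (@foot_stable nat \oo _ (fun j => G^~ (mn (nj j))) (fun j => DG G ^~ (mn (nj j))) Gl gl) => //.
  by apply: nearW => j; exact: DG_regular.
have fc : continuous f.
  move=> x; apply: (@foot_stable V (nbhs x) _ (fun=> Gl) (fun=> gl) Gl gl (fun=> c) c id) => //.
  - exact: nearW.
  - move=> y0; apply: (@cvg_comp _ _ _ (snd : V * V -> V) gl _ (nbhs y0)); first exact: cvg_snd.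
    exact: glc.
  - exact: cvg_cst.
have [m lm] := law_exists m0 (continuous_measurable_rV fc).
have fKj j x := fK (nj j) x.
have lawj j := lawn (nj j).
(* Feet converge pointwise with linear growth, so their laws converge in d_gamma to m, and the
   modulus of G identifies the limit. *)
have E1 : gl = DG G ^~ m.
  apply/funext => y; have [_ c1] := law_limit_G K20 lawj lm fKj fj y.
  exact: (cvg_unique _ (gp y) c1).
have E2 : c = terminal_phi G T Phi m.
  exact: (cvg_unique _ cj (law_limit_phi K20 lawj lm fKj fj)).
exists m; last by rewrite /foot -E1 -E2.
exact: (law_moment K20 lm (law_limit_bound fKj fj)).
Unshelve. all: by end_near. Qed.

End fixed_point.

End mean_field.

(** * From the assumptions to the theorem *)

Lemma enorm_powR_le (R : realType) (n : nat) (x : 'rV[R]_n) (s : R) : 0 <= s ->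
  1 + enorm x `^ s <= n.+1%:R `^ s * (1 + `|x| `^ s).
Proof.
move=> s0; rewrite mulrDr mulr1; apply: lerD.
  have n1 : 1 <= n.+1%:R :> R by rewrite ler1n.
  by have := ler_powR n1 s0; rewrite powRr0.
rewrite -powRM //; apply: powR_le => //; rewrite enorm_ge0 /=; exact: enorm_le_norm.
Qed.

Section components.
Variables (R : realType) (d k : nat).
Local Notation V := 'rV[R]_d.

Lemma jacobian_mvt (F : V -> 'rV[R]_k) (D : R) (x y : V) : 0 <= D ->
  (forall z, differentiable F z) ->
  (forall c, 0 <= c <= 1 -> enorm ('J F (x + c *: (y - x))) <= D) ->
  `|F y - F x| <= d%:R * D * `|y - x|.
Proof.
move=> D0 dF JD; apply: rV_norm_le => [|i]; first by rewrite !mulr_ge0.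
have dFi z : differentiable (fun x => F x 0 i) z.
  apply: (@differentiable_comp _ _ _ _ F (fun N : 'rV[R]_k => N 0 i)); first exact: dF.
  exact: differentiable_coord.
have [c c01] := @line_mvt R V (fun x => F x 0 i) x (y - x) 0 1 ler01 dFi.
rewrite scale1r scale0r addr0 subrKC subr0 mulr1 => e.
rewrite mxE [X in _ + X]mxE e.
have dd : derivable F (x + c *: (y - x)) (y - x) by exact: diff_derivable.
have [_ ->] := derive_coord i dd.
rewrite deriveE // -mul_rV_lin1 mxE (le_trans (ler_norm_sum _ _ _)) //.
apply: (@le_trans _ _ (\sum_(j < d) `|y - x| * D)).
  apply: ler_sum => j _; rewrite normrM ler_pM //; first exact: rV_coord_le.
  by apply: (le_trans (enorm_coord _ _ _)); exact: JD.
by rewrite sumr_const card_ord -[leLHS]mulr_natl mulrA mulrAC.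
Qed.

(** Partial Jacobians bounded for bounded p make Phi Lipschitz in each variable near a point, and an
    intermediate point (y, p0) joins the two. *)
Lemma partial_continuous (Phi : V -> V -> 'rV[R]_k) (C s s' : R) : 0 <= C -> 0 <= s -> 0 <= s' ->
  (forall y p, differentiable (Phi^~ p) y) -> (forall y p, differentiable (Phi y) p) ->
  (forall y p, enorm ('J (Phi^~ p) y) <= C * (1 + enorm p `^ s)) ->
  (forall y p, enorm ('J (Phi y) p) <= C * (1 + enorm p `^ s')) ->
  continuous (fun z : V * V => Phi z.1 z.2).
Proof.
move=> C0 s0 s'0 dy dp Jy Jp [y0 p0]; apply/cvgrPdist_le => e e0.
pose b := d.+1%:R * (`|p0| + 1) : R.
have b0 : 0 <= b by rewrite mulr_ge0 // addr_ge0.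
pose L1 := d%:R * (C * (1 + b `^ s')); pose L2 := d%:R * (C * (1 + b `^ s)).
have L10 : 0 <= L1 by rewrite !mulr_ge0 // addr_ge0 // powR_ge0.
have L20 : 0 <= L2 by rewrite !mulr_ge0 // addr_ge0 // powR_ge0.
have L0 : 0 < L1 + L2 + 1 by rewrite ltr_wpDl // addr_ge0.
have e1 : 0 < e / (L1 + L2 + 1) by rewrite divr_gt0.
have cp : z.2 @[z --> nbhs (y0, p0)] --> p0 by exact: cvg_snd.
have cy : z.1 @[z --> nbhs (y0, p0)] --> y0 by exact: cvg_fst.
have /cvgrPdist_le/(_ _ ltr01) n1 := cp; have /cvgrPdist_le/(_ _ e1) n2 := cp.
have /cvgrPdist_le/(_ _ e1) n3 := cy.
apply: filterS3 n1 n2 n3 => -[y p] /= h1 h2 h3.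
have pb (p' : V) : `|p0 - p'| <= 1 -> enorm p' <= b.
  move=> h; apply: (le_trans (enorm_le_norm p')); rewrite ler_wpM2l //.
  by rewrite -[p'](subKr p0) (le_trans (ler_normB _ _)) // lerD2l.
have m1 : `|Phi y p - Phi y p0| <= L1 * `|p - p0|.
  apply: jacobian_mvt => // [|c c01]; first by rewrite mulr_ge0 // addr_ge0 // powR_ge0.
  apply: (le_trans (Jp _ _)); rewrite ler_wpM2l // lerD2l; apply: powR_le => //.
  rewrite enorm_ge0 /=; apply: pb; rewrite opprD addrA subrr sub0r normrN normrZ distrC.
  by case/andP: c01 => c0 c1; rewrite ger0_norm // mulr_ile1.
have m2 : `|Phi y p0 - Phi y0 p0| <= L2 * `|y - y0|.
  apply: (@jacobian_mvt (Phi^~ p0)) => // [|c c01]; first by rewrite mulr_ge0 // addr_ge0 // powR_ge0.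
  apply: (le_trans (Jy _ _)); rewrite ler_wpM2l // lerD2l; apply: powR_le => //.
  by rewrite enorm_ge0 /=; apply: pb; rewrite subrr normr0.
rewrite distrC -(subrKA (Phi y p0)) (le_trans (ler_normD _ _)) //.
apply: (le_trans (lerD m1 m2)); rewrite [`|p - p0|]distrC [`|y - y0|]distrC.
apply: (@le_trans _ _ ((L1 + L2 + 1) * (e / (L1 + L2 + 1)))); last by rewrite mulrC divfK // gt_eqF.
rewrite mulrDl mul1r mulrDl -[leLHS]addr0; apply: lerD; last exact: ltW.
by apply: lerD; rewrite ler_wpM2l.
Qed.

End components.

Lemma C11_convex_C1 (R : realType) (d : nat) (F : 'rV[R]_d -> R) :
  C11 F -> convex_function setT F -> convex_C1 F (grad F).
Proof.
move=> [dF lF] cF; split=> [y z|].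
  by rewrite -derive_grad //; exact: convex_subgradient.
move=> y; apply: cvg_rV => i; rewrite mxE.
have -> : (fun x => grad F x 0 i) = 'D_(delta_mx 0 i) F by apply/funext => x; rewrite mxE.
have ll : locally_lipschitz ('D_(delta_mx 0 i) F) by move=> x; exact: lF.
exact: (locally_lipschitz_continuous ll).
Qed.

Lemma H_convex_C1 (R : realType) (d k : nat) (H : 'rV[R]_d -> 'rV[R]_d -> 'rV[R]_k -> R) :
  C11 (fun z : 'rV[R]_d * 'rV[R]_d * 'rV[R]_k => H z.1.1 z.1.2 z.2) ->
  (forall x phi, convex_function setT (fun p => H x p phi)) ->
  forall x c, convex_C1 (fun p => H x p c) (fun p => DpH H x p c).
Proof.
move=> HC11 Hconv x c; split=> [y z|y].
  by rewrite /DpH -derive_grad; [exact: convex_subgradient (H_diff_p _ _ _ _)|exact: H_diff_p].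
by apply: (@DpH_cvg R d k H HC11 _ (nbhs y) _ (fun=> x) id (fun=> c)); [exact: cvg_cst|exact: cvg_id|exact: cvg_cst].
Qed.

Theorem theorem4p1 (R : realType) (d k : nat) (T q r : R)
    (H : 'rV[R]_d -> 'rV[R]_d -> 'rV[R]_k -> R)
    (G : 'rV[R]_d -> probability 'rV[R]_d R -> R)
    (m0 : probability 'rV[R]_d R)
    (Phi : R -> 'rV[R]_d -> 'rV[R]_d -> 'rV[R]_k)
    (A : R -> 'rV[R]_k -> 'M[R]_k) (B : R -> 'rV[R]_k -> 'rV[R]_k) :
  (0 < d)%N -> (0 < k)%N -> 0 < T -> 1 < q -> q <= r ->
  let q' := q / (q - 1) in
  let gamma := r / (q - 1) in
  {within slab T, continuous (fun z : R * 'rV[R]_k => A z.1 z.2)} ->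
  {within slab T, continuous (fun z : R * 'rV[R]_k => B z.1 z.2)} ->
  partially_differentiable Phi T ->
  (forall (t : R) x p phi, t \in `[0, T] ->
    time_derive T (fun s => Phi s x p) t
    - DpH H x p phi *m DxPhi Phi t x p
    + DxH H x p phi *m DpPhi Phi t x p
    + Phi t x p *m (A t phi)^T + B t phi = 0) ->
  (exists2 C : R, 0 < C & forall (t : R) y p, t \in `[0, T] ->
    [/\ enorm (Phi t y p) <= C * (1 + enorm p `^ r),
        enorm (DpPhi Phi t y p) <= C * (1 + enorm p `^ (r - 1)) &
        enorm (DxPhi Phi t y p) <= C * (1 + enorm p `^ (r - q + 1))]) ->
  (exists2 lambda : R, gamma < lambda & finite_moment lambda m0) ->
  C11 (fun z : 'rV[R]_d * 'rV[R]_d * 'rV[R]_k => H z.1.1 z.1.2 z.2) ->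
  (forall x phi, convex_function setT (fun p => H x p phi)) ->
  (exists2 C : R, 0 < C &
    (forall x p phi,
      `|H x p phi| + enorm (DxH H x p phi) <= C * (1 + enorm p `^ q) /\
      enorm (DpH H x p phi) <= C * (1 + enorm p `^ (q - 1))) /\
    lebesgue_ae3 (fun x p phi =>
      [/\ differentiable (fun y => DxH H y p phi) x,
          differentiable (fun y => DpH H y p phi) x,
          forall v : 'rV[R]_d, dot (v *m DxxH H x p phi) v <= 0 &
          enorm (DpxH H x p phi) <= C])) ->
  (forall m, finite_moment gamma m ->
    C11 (fun x => G x m) /\ convex_function setT (fun x => G x m)) ->
  (exists2 C : R, 0 < C & forall m, finite_moment gamma m ->
    (forall x,
      `|G x m| <= C * (1 + enorm x `^ q') /\
      enorm (DG G x m) <= C * (1 + enorm x `^ (q' - 1))) /\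
    lebesgue_ae (fun x =>
      differentiable (fun y => DG G y m) x /\
      enorm (DxxG G x m) <= C * (1 + enorm x) `^ (q' - 2))) ->
  (exists2 omega : R -> R, modulus omega & exists2 C : R, 0 < C &
    forall m1 m2, finite_moment gamma m1 -> finite_moment gamma m2 ->
    forall x,
      `|G x m1 - G x m2| + enorm (DG G x m1 - DG G x m2) <=
      C * (1 + enorm x `^ q') * omega (wasserstein gamma m1 m2)) ->
  (ereal_sup [set (C01_norm (A t) + C01_norm (B t))%E | t in `[0%R, T]%classic]
    < +oo)%E ->
  exists (u : R -> 'rV[R]_d -> R) (m : R -> probability 'rV[R]_d R)
    (phi : R -> 'rV[R]_k),
    [/\ hj_solution T H u phi (fun x => G x (m T)),
        wasserstein_continuous T m gamma,
        m 0 = m0,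
        continuity_solution T H u m phi m0 &
        ode_solution T phi (drift A B) (terminal_phi G T Phi (m T))].
Proof.
move=> d0 k0 T0 q1 qr q' gamma A_cont B_cont PhiD _ [C1 C10 hPhi] [lambda gl m0l] HC11 Hconv
  [C2 C20 [hH Hae]] GC11 [C3 C30 hG] Gmod ABb.
have T00 : 0 <= (0 : R) <= T by rewrite lexx ltW.
have TT0 : 0 <= T <= T by rewrite lexx ltW.
have q10 : 0 <= q - 1 by rewrite subr_ge0 ltW.
have q0 : 0 <= q by rewrite (le_trans ler01) // ltW.
have r0 : 0 <= r by exact: le_trans q0 qr.
have q'0 : 0 <= q' by rewrite divr_ge0.
have q'1 : 0 <= q' - 1 by rewrite /q' (q'1E q1) invr_ge0.
have g0 := gamma_gt0 q1 qr.
have m0g : finite_moment gamma m0 by apply: finite_moment_le m0l; rewrite (ltW g0) ltW.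
pose n := d.+1%:R : R.
have n1 : 1 <= n by rewrite ler1n.
pose h p c := H 0 p c; pose hp p c := DpH H 0 p c.
have HE x p c : H x p c = h p c.
  by apply: (H_state_free HC11 (fun x p c => (hH x p c).1) Hae).
have DpHE x p c : DpH H x p c = hp p c.
  by rewrite /hp /DpH; congr (grad _ p); apply/funext => p'; rewrite HE.
have h_convex c : convex_C1 (h^~ c) (hp^~ c) by exact: H_convex_C1.
have h_cont : continuous (fun z : 'rV[R]_d * 'rV[R]_k => h z.1 z.2).
  move=> z; apply: (@H_cvg R d k H HC11 _ (nbhs z) _ (fun=> 0) fst snd); first exact: cvg_cst.
    exact: cvg_fst.
  exact: cvg_snd.
have hp_cont : continuous (fun z : 'rV[R]_d * 'rV[R]_k => hp z.1 z.2).
  move=> z; apply: (@DpH_cvg R d k H HC11 _ (nbhs z) _ (fun=> 0) fst snd); first exact: cvg_cst.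
    exact: cvg_fst.
  exact: cvg_snd.
pose B' := C2 * n `^ (q - 1).
have B'0 : 0 <= B' by rewrite mulr_ge0 ?powR_ge0 // ltW.
have hpB p c : `|hp p c| <= B' * (1 + `|p| `^ (q - 1)).
  apply: (le_trans (norm_le_enorm _)); apply: (le_trans (hH 0 p c).2).
  by rewrite -mulrA ler_pM2l // enorm_powR_le.
(* One constant for all growth bounds; passing from Euclidean to sup norms costs the factors n^s. *)
pose C := C1 * n `^ r + C3 * n `^ q' + C3 * n `^ (q' - 1).
have C1n : 0 <= C1 * n `^ r by rewrite mulr_ge0 ?powR_ge0 // ltW.
have C3n : 0 <= C3 * n `^ q' by rewrite mulr_ge0 ?powR_ge0 // ltW.
have C3n' : 0 <= C3 * n `^ (q' - 1) by rewrite mulr_ge0 ?powR_ge0 // ltW.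
have C0 : 0 <= C by rewrite !addr_ge0.
have toC (a b c s : R) (x : 'rV[R]_d) : 0 <= s -> 0 <= c -> c * n `^ s <= C -> a <= c * (1 + enorm x `^ s) ->
    a <= C * (1 + `|x| `^ s).
  move=> s0 c0 cC /le_trans; apply; apply: (@le_trans _ _ (c * n `^ s * (1 + `|x| `^ s))).
    by rewrite -mulrA ler_wpM2l // enorm_powR_le.
  by rewrite ler_wpM2r // addr_ge0 // powR_ge0.
have TinI : T \in `[0, T] by rewrite in_itv /= lexx ltW.
have Phi_cont : continuous (fun z : 'rV[R]_d * 'rV[R]_d => Phi T z.1 z.2).
  apply: (@partial_continuous R d k (Phi T) C1 (r - q + 1) (r - 1)) => //.
  - exact: ltW.
  - by rewrite addr_ge0 // subr_ge0.
  - by rewrite subr_ge0 (le_trans _ qr) // ltW.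
  - by move=> y p; have [] := PhiD T y p TinI.
  - by move=> y p; have [] := PhiD T y p TinI.
  - by move=> y p; have [] := hPhi T y p TinI.
  - by move=> y p; have [] := hPhi T y p TinI.
have Phi_bound y p : `|Phi T y p| <= C * (1 + `|p| `^ r).
  have [h1 _ _] := hPhi T y p TinI.
  apply: (toC _ 0 C1) => //; [exact: ltW|rewrite /C -addrA lerDl addr_ge0 //|].
  exact: le_trans (norm_le_enorm _) h1.
have G_convex m : finite_moment gamma m -> convex_C1 (G^~ m) (DG G ^~ m).
  by move=> /GC11[h1 h2]; exact: C11_convex_C1.
have G_bound m : finite_moment gamma m -> forall z,
    `|G z m| <= C * (1 + `|z| `^ q') /\ `|DG G z m| <= C * (1 + `|z| `^ (q' - 1)).
  move=> /hG[h1 _] z; have [h2 h3] := h1 z; split.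
    apply: (toC _ 0 C3) => //; [exact: ltW|].
    by rewrite /C addrAC lerDr addr_ge0.
  apply: (toC _ 0 C3) => //; [exact: ltW|by rewrite /C lerDr addr_ge0|].
  exact: le_trans (norm_le_enorm _) h3.
have G_lip b : 0 <= b -> exists2 L, 0 <= L & forall m, finite_moment gamma m ->
    forall y y', `|y| <= b -> `|y'| <= b -> `|DG G y m - DG G y' m| <= L * `|y - y'|.
  move=> b0; have [L L0 hL] := @grad_lipschitz R d C3 q' b (ltW C30) q'0 b0.
  exists L => // m mm; have [h1 _] := GC11 m mm; have [_ h2] := hG m mm.
  exact: (hL (G^~ m) h1 h2).
have [K K0 hK] := foot_bound q1 C0 T0 B'0 h_convex h_cont hp_cont hpB.
have [cb cb0 hcb] := terminal_phi_bound q1 qr C0 m0g Phi_cont Phi_bound G_convex G_bound (ltW K0).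
have [L1 L10 hL1] := clip_drift_bounds T0 k0 ABb.
(* [cb] bounds the terminal value for every law given by feet of characteristics, and [L1] does not
   involve M; so the clipping level is fixed before the clipped equation is solved. *)
pose M := (1 + cb) * exp_weight T L1 0.
have M0 : 0 <= M by rewrite mulr_ge0 ?addr_ge0 // expR_ge0.
have [fgrowth [Kf Kf0 hKf]] := hL1 M M0.
pose f := clip_drift T A B M.
have f_cont := clip_drift_continuous T0 A_cont B_cont M0.
have [sol [sol_cont sol_eq sol_lip sol_bound]] := backward_ode_exists T0 Kf0 L10 f_cont
  (fun t c => (hKf t c 0).1) fgrowth (fun t c c' => (hKf t c c').2).
have [mT mTg mTlaw] := mean_field_fixed_point q1 qr C0 m0g Phi_cont Phi_bound G_convex G_bound G_lip Gmod
  T0 B'0 h_convex h_cont hp_cont hpB sol_cont sol_lip.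
pose c := terminal_phi G T Phi mT; pose phi := sol c.
have reg := DG_regular q1 G_convex G_bound mTg.
have [Gc GC gC] := reg.
have phi_cont : continuous phi by exact: sol_cont.
have cle : `|c| <= cb by apply: (hcb _ _ mTlaw) => x; exact: (hK (G^~ mT) (DG G ^~ mT) phi x phi_cont reg).
have phiM t : 0 <= t <= T -> `|phi t| <= M.
  move=> tT; have := sol_bound c t tT.
  have : (1 + `|c|) * exp_weight T L1 0 <= M by rewrite ler_wpM2r ?expR_ge0 // lerD2l.
  rewrite -/phi => h1 h2; apply: le_trans h1; apply: le_trans h2; by rewrite lerDr.
pose xi := hopf_xi T hp phi (DG G ^~ mT).
have xi_cont t : 0 <= t <= T -> continuous (xi t).
  exact: (hopf_xi_continuous T0 q1 phi_cont h_convex h_cont hp_cont B'0 C0 hpB Gc GC gC).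
(* The equalities m 0 = m0 and m T = mT are wanted between the measures themselves, so both ends are
   prescribed; outside [0, T] the default is m0. *)
have ex t : exists m : probability 'rV[R]_d R, [/\ t = 0 -> m = m0, t = T -> m = mT & 0 <= t <= T -> law m0 (xi t) m].
  have [->|t0] := eqVneq t 0.
    exists m0; split => // [e|_]; first by move: T0; rewrite -e ltxx.
    have -> : xi 0 = id; last exact: law_id.
    by apply/funext => x; exact: (hopf_xi0 T0 phi_cont h_convex h_cont hp_cont B'0 hpB Gc).
  have [->|tT] := eqVneq t T.
    exists mT; split => // [e|_]; first by move: T0; rewrite e ltxx.
    have -> : xi T = foot T G Phi hp sol mT by apply/funext => x; rewrite /xi hopf_xiT.
    exact: mTlaw.
  have [tI|tI] := boolP (0 <= t <= T); last by exists m0; split => // e; move: t0 tT; rewrite e eqxx.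
  have [m hm] := law_exists m0 (continuous_measurable_rV (xi_cont t tI)).
  by exists m; split => // e; move: t0 tT; rewrite e eqxx.
have [m hm] := choice ex.
have m_law t : 0 <= t <= T -> law m0 (xi t) (m t) by have [] := hm t.
have mTE : m T = mT by have [_ h1 _] := hm T; exact: h1.
exists (hopf_u T h hp phi (G^~ mT) (DG G ^~ mT)), m, phi; split.
- rewrite mTE.
  exact: (hopf_hj_solution T0 q1 phi_cont h_convex h_cont hp_cont B'0 C0 hpB Gc GC gC HE).
- exact: (hopf_wasserstein T0 q1 phi_cont h_convex h_cont hp_cont B'0 C0 hpB Gc GC gC (gamma_ge1 q1 qr) m0g m_law).
- by have [h1 _ _] := hm 0; exact: h1.
- exact: (hopf_continuity T0 q1 phi_cont h_convex h_cont hp_cont B'0 C0 hpB Gc GC gC (gamma_ge1 q1 qr) m0g m_law DpHE).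
- have F_cont : continuous (fun s => f s (phi s)) by exact: f_path_continuous.
  split; last by rewrite mTE /phi sol_eq // vint_self addr0.
  move=> t; rewrite in_itv => tT.
  have sl : time_slope phi t s @[s --> within `[0, T] t^'] --> - f t (phi t).
    apply: time_slope_cvg => e e0; have := vint_near_slope F_cont tT e0.
    apply: filterS => s hs sT.
    have phiE r' : 0 <= r' <= T -> phi r' = c + vint (fun s => f s (phi s)) r' T by exact: sol_eq.
    have -> : phi s - phi t = vint (fun s => f s (phi s)) s T - vint (fun s => f s (phi s)) t T.
      by rewrite (phiE s sT) (phiE t tT) opprD addrACA subrr add0r.
    exact: hs.
  have [h1 h2] := time_derive_eq T0 tT sl.
  (* On [0, T] the path is bounded by M, so neither clamping nor clipping changes the drift. *)
  split=> //; rewrite h2 opprK /f /clip_drift clamp_id // clip_id //; exact: phiM.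
Qed.
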